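(* Let $\eta=e^{\pi i/3}$, let $N$ be an even positive integer, $c=4\operatorname{Im}\eta/N$, $r>0$, and let $\Gamma_c' := \langle\Lambda_{\eta,c},\ (0,5c/6)\,\mu(\eta)\rangle\subset\mathbb{H}\rtimes S^1$, assumed to be a Heisenberg Bieberbach group. Let $M'=\Gamma_c'\backslash\mathbb{H}$, equipped with the CR structure induced from $\mathbb{H}$ and the contact form $r\theta_{\mathbb{H}}$, and let $\Delta_b$ and $T$ be its sub-Laplacian and Reeb vector field. For $n\in\mathbb{Z}\setminus\{0\}$ and $k\in\mathbb{Z}_{\ge0}$, the multiplicity $m_{n,k}'$ of $$\sigma_{n,k}=\left(\frac{(4k+2)\pi|n|}{cr},\frac{2\pi n}{cr}\right)$$ in the joint spectrum of $\Delta_b$ and $i^{-1}T$ on $M'$ is given by $$\begin{aligned} m_{n,k}'=\frac16\Bigg(&|n|N+2(-1)^{n+k}+2\cos\frac{\pi(|n|+k-1)}{3}+\frac{2}{\sqrt3}\cos\left(\frac{2\pi(|n|+k)}{3}-\frac{\pi}{6}\right)\\ &+\frac{4}{\sqrt3}\cos\left(\frac{2\pi(|n|+k-|n|N)}{3}-\frac{\pi}{6}\right)\Bigg).\end{aligned}$$ Moreover, for any $\kappa>0$, the multiplicity of $(\kappa,0)$ in the joint spectrum is equal to $\#E_\kappa/6$, where $E_\kappa=\{\zeta\in L_\eta' : \pi^2|\zeta|^2/r=\kappa\}$.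
   Context: The Heisenberg group is $\mathbb{H} = \mathbb{C}\times\mathbb{R}$ with multiplication $(z,t)\cdot(z',t') = (z+z', t+t'+2\operatorname{Im}(z\bar z'))$. For $\lambda\in\mathbb{C}^*$ let $\mu(\lambda)(z,t)=(\lambda z,|\lambda|^2t)$. $\mathbb{H}\rtimes\mathbb{C}^*$ has multiplication $(g,\lambda)\cdot(h,\nu)=(g\cdot\mu(\lambda)(h),\lambda\nu)$ and acts on $\mathbb{H}$ by $(g,\lambda)h=g\cdot\mu(\lambda)(h)$; $(g,\lambda)$ is also written $g\,\mu(\lambda)$, $\mathbb{H}$ is identified with the elements $(g,1)$, and $\mathbb{H}\rtimes S^1$ is the subgroup with $|\lambda|=1$. A Heisenberg Bieberbach group is a discrete torsion-free subgroup $\Gamma\subset\mathbb{H}\rtimes S^1$ with $\Gamma\backslash\mathbb{H}$ compact. For $4\operatorname{Im}\tau/c\in\mathbb{Z}_{>0}$, $\Lambda_{\tau,c}=\langle(1,0),(\tau,0),(0,c)\rangle\subset\mathbb{H}$; here $\tau=\eta$, and $N=4\operatorname{Im}\eta/c=\#(Z(\Lambda_{\eta,c})/[\Lambda_{\eta,c},\Lambda_{\eta,c}])$. $L_\eta=\mathbb{Z}+\mathbb{Z}\eta$, and $L_\eta'=\{\zeta\in\mathbb{C} : \operatorname{Re}(\zeta\bar z)\in\mathbb{Z}\text{ for all }z\in L_\eta\}$ is its dual lattice. The CR structure on $\mathbb{H}$ is spanned by $Z=\partial_z+i\bar z\,\partial_t$, and $\theta_{\mathbb{H}}=dt+i(z\,d\bar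 z-\bar z\,dz)$; both are invariant under $\mathbb{H}\rtimes S^1$ and so descend to the quotient. Functions on $M'$ are identified with $\Gamma_c'$-invariant functions on $\mathbb{H}$. With respect to $r\theta_{\mathbb{H}}$, the sub-Laplacian is $\Delta_b=-\frac{1}{2r}(Z\bar Z+\bar ZZ)$ and the Reeb vector field is $T=\frac1r\partial_t$. The multiplicity of $(a,b)\in\mathbb{R}^2$ in the joint spectrum is the complex dimension of $\{f\in C^\infty(M';\mathbb{C}) : \Delta_bf=af,\ i^{-1}Tf=bf\}$ (zero if $(a,b)$ is not a joint eigenvalue). *)

(* Defs.v *)
(* Stdlib reals with Coquelicot, whose C is R * R. *)
From Stdlib Require Import Reals ZArith List.
From Coquelicot Require Import Coquelicot.
Open Scope R_scope.

Definition heis : Type := (C * R)%type.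
Definition heis_UniformSpace : UniformSpace :=
  prod_UniformSpace C_UniformSpace R_UniformSpace.

Definition heis_one : heis := (RtoC 0, 0).
Definition heis_mul (g h : heis) : heis :=
  (Cplus (fst g) (fst h),
   snd g + snd h + 2 * Im (Cmult (fst g) (Cconj (fst h)))).
Definition heis_inv (g : heis) : heis := (Copp (fst g), - snd g).

Definition mu (l : C) (g : heis) : heis :=
  (Cmult l (fst g), Cmod l ^ 2 * snd g).

(* Elements (g, l) of the semidirect product of [heis] with C^*. The carrier
   does not record l <> 0; this is imposed by [discrete_subgroup], through
   |l| = 1. *)
Definition sim : Type := (heis * C)%type.
Definition sim_UniformSpace : UniformSpace :=
  prod_UniformSpace heis_UniformSpace C_UniformSpace.

Definition sim_one : sim := (heis_one, RtoC 1).
Definition sim_mul (a b : sim) : sim :=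
  (heis_mul (fst a) (mu (snd a) (fst b)), Cmult (snd a) (snd b)).
Definition sim_inv (a : sim) : sim :=
  (mu (Cinv (snd a)) (heis_inv (fst a)), Cinv (snd a)).
Definition sim_pow (a : sim) (n : nat) : sim := Nat.iter n (sim_mul a) sim_one.
Definition sim_act (a : sim) (h : heis) : heis :=
  heis_mul (fst a) (mu (snd a) h).

Inductive generated {G : Type} (one : G) (mul : G -> G -> G) (inv : G -> G)
    (S : G -> Prop) : G -> Prop :=
| generated_in x : S x -> generated one mul inv S x
| generated_one : generated one mul inv S one
| generated_mul x y : generated one mul inv S x -> generated one mul inv S y ->
    generated one mul inv S (mul x y)
| generated_inv x : generated one mul inv S x -> generated one mul inv S (inv x).

Definition discrete_subgroup (Gam : sim -> Prop) : Prop :=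
  (forall a, Gam a -> Cmod (snd a) = 1) /\
  Gam sim_one /\
  (forall a b, Gam a -> Gam b -> Gam (sim_mul a b)) /\
  (forall a, Gam a -> Gam (sim_inv a)) /\
  (forall a, Gam a ->
     @locally sim_UniformSpace a (fun b : sim => Gam b -> b = a)).

Definition torsion_free (Gam : sim -> Prop) : Prop :=
  forall a n, Gam a -> (0 < n)%nat -> sim_pow a n = sim_one -> a = sim_one.

(* The open subsets of the quotient of [heis] by Gam are exactly the
   Gam-invariant open subsets of [heis]. *)
Definition compact_quotient (Gam : sim -> Prop) : Prop :=
  forall F : (heis -> Prop) -> Prop,
    (forall U, F U -> @open heis_UniformSpace U /\
       forall a p, Gam a -> U p -> U (sim_act a p)) ->
    (forall p, exists U, F U /\ U p) ->
    exists l : list (heis -> Prop),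
      (forall U, In U l -> F U) /\ forall p, exists U, In U l /\ U p.

Definition Heisenberg_Bieberbach (Gam : sim -> Prop) : Prop :=
  discrete_subgroup Gam /\ torsion_free Gam /\ compact_quotient Gam.

(* exp (PI i / 3) *)
Definition eta : C := (cos (PI / 3), sin (PI / 3)).

Definition Lambda (tau : C) (c : R) : heis -> Prop :=
  generated heis_one heis_mul heis_inv
    (fun g => g = (RtoC 1, 0) \/ g = (tau, 0) \/ g = (RtoC 0, c)).

Definition Gamma' (c : R) : sim -> Prop :=
  generated sim_one sim_mul sim_inv
    (fun a => (exists g, Lambda eta c g /\ a = (g, RtoC 1)) \/
              a = ((RtoC 0, 5 * c / 6), eta)).

Definition lattice (tau : C) (z : C) : Prop :=
  exists a b : Z, z = Cplus (RtoC (IZR a)) (Cmult (RtoC (IZR b)) tau).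

Definition dual_lattice (L : C -> Prop) (zeta : C) : Prop :=
  forall z, L z -> exists m : Z, Re (Cmult zeta (Cconj z)) = IZR m.

Definition has_card {A : Type} (E : A -> Prop) (n : nat) : Prop :=
  exists l : list A, NoDup l /\ (forall x, In x l <-> E x) /\ length l = n.

Definition CDerive (g : R -> C) (s : R) : C :=
  (Derive (fun u => Re (g u)) s, Derive (fun u => Im (g u)) s).
Definition ex_CDerive (g : R -> C) (s : R) : Prop :=
  @ex_derive R_AbsRing C_R_NormedModule g s.

(* Restrictions of f to the coordinate lines through p = (x + i y, t). *)
Definition line_x (f : heis -> C) (p : heis) : R -> C :=
  fun s => f ((s, Im (fst p)), snd p).
Definition line_y (f : heis -> C) (p : heis) : R -> C :=
  fun s => f ((Re (fst p), s), snd p).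
Definition line_t (f : heis -> C) (p : heis) : R -> C :=
  fun s => f (fst p, s).

Definition dx (f : heis -> C) (p : heis) : C :=
  CDerive (line_x f p) (Re (fst p)).
Definition dy (f : heis -> C) (p : heis) : C :=
  CDerive (line_y f p) (Im (fst p)).
Definition dt (f : heis -> C) (p : heis) : C := CDerive (line_t f p) (snd p).

Fixpoint Ck (k : nat) (f : heis -> C) : Prop :=
  (forall p : heis, @continuous heis_UniformSpace C_UniformSpace f p) /\
  match k with
  | O => True
  | S k' =>
      (forall p, ex_CDerive (line_x f p) (Re (fst p)) /\
                 ex_CDerive (line_y f p) (Im (fst p)) /\
                 ex_CDerive (line_t f p) (snd p)) /\
      Ck k' (dx f) /\ Ck k' (dy f) /\ Ck k' (dt f)
  end.

Definition smooth (f : heis -> C) : Prop := forall k, Ck k f.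

Definition dz (f : heis -> C) (p : heis) : C :=
  Cmult (RtoC (1 / 2)) (Cminus (dx f p) (Cmult Ci (dy f p))).
Definition dzbar (f : heis -> C) (p : heis) : C :=
  Cmult (RtoC (1 / 2)) (Cplus (dx f p) (Cmult Ci (dy f p))).

Definition Zop (f : heis -> C) (p : heis) : C :=
  Cplus (dz f p) (Cmult (Cmult Ci (Cconj (fst p))) (dt f p)).
Definition Zbarop (f : heis -> C) (p : heis) : C :=
  Cminus (dzbar f p) (Cmult (Cmult Ci (fst p)) (dt f p)).

(* Sub-Laplacian and Reeb vector field of the contact form r theta, where
   theta = dt + i (z dzbar - zbar dz). *)
Definition sublaplacian (r : R) (f : heis -> C) (p : heis) : C :=
  Cmult (RtoC (- (1 / (2 * r)))) (Cplus (Zop (Zbarop f) p) (Zbarop (Zop f) p)).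
Definition Reeb (r : R) (f : heis -> C) (p : heis) : C :=
  Cmult (RtoC (1 / r)) (dt f p).

(* [V] is meant to be a complex linear subspace of functions; the sums have
   the indices 1, ..., m, hence are empty for m = 0. *)
Definition has_dim {X : Type} (V : (X -> C) -> Prop) (m : nat) : Prop :=
  exists e : nat -> X -> C,
    (forall i, (1 <= i <= m)%nat -> V (e i)) /\
    (forall a : nat -> C,
       (forall x, @sum_n_m C_AbelianMonoid (fun i => Cmult (a i) (e i x)) 1 m
                  = RtoC 0) ->
       forall i, (1 <= i <= m)%nat -> a i = RtoC 0) /\
    (forall f, V f -> exists a : nat -> C, forall x,
       f x = @sum_n_m C_AbelianMonoid (fun i => Cmult (a i) (e i x)) 1 m).

(* Smooth functions on the quotient by Gam are the Gam-invariant smooth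
   functions on [heis]. *)
Definition joint_eigenspace (Gam : sim -> Prop) (r a b : R) (f : heis -> C)
    : Prop :=
  smooth f /\
  (forall g p, Gam g -> f (sim_act g p) = f p) /\
  (forall p, sublaplacian r f p = Cmult (RtoC a) (f p)) /\
  (forall p, Cmult (Cinv Ci) (Reeb r f p) = Cmult (RtoC b) (f p)).

Definition joint_multiplicity (Gam : sim -> Prop) (r a b : R) (m : nat) : Prop :=
  has_dim (joint_eigenspace Gam r a b) m.

(* Main.v *)
Require Import Defs.
From Stdlib Require Import Reals ZArith.
From Stdlib Require Import List Lra Lia FunctionalExtensionality Permutation Classical.
From Coquelicot Require Import Coquelicot.
Open Scope R_scope.

(** Why the theorem holds.

    A function with Reeb eigenvalue [b] has the form [phi z * cis (v * t)] with
    [v = r * b], so everything happens on the plane: [phi] is quasi-periodic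
    under the lattice spanned by 1 and [eta], an eigenfunction of the rotation by
    [eta], and an eigenfunction of [Dz Db + Db Dz], where [Dz] and [Db] are what
    the vector fields Z and its conjugate become on such functions
    ([joint_eigenspace_lift]). Conjugation changes the sign of [b]
    ([joint_multiplicity_opp]), so let [n > 0]; then [v = nu d] with [d = n N].

    The commutator of [Dz] and [Db] is the constant [2 v]. Hence [Dz] maps each
    Landau level isomorphically onto the next one, changing the rotation
    eigenvalue by a factor [eta] ([has_dim_level_S]), and the level [k] with
    rotation eigenvalue [eta ^ n] is as large as the bottom level with eigenvalue
    [eta ^ (n + k)]. The bottom level consists of the solutions of [Db phi = 0]
    ([level_bottom]): up to a Gaussian factor these are theta functions of degree
    [d], called sections here.

    It remains to diagonalise the rotation on the sections of degree [d].
    The Fourier coefficients of the holomorphic function attached to a section obey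
    a recursion of step [d], so that the dimension is at most [d]
    ([sect_determined]). Conversely, from the section [wsigma] of degree one, a
    Gaussian times the Weierstrass sigma function, one makes sections [wp2] and
    [wp3] of degrees two and three, essentially sigma^2 wp and sigma^3 wp', which are
    rotation invariant and nonzero at the origin. Products of these three give,
    for each [a] in {0, ..., d - 2, d}, a section of degree [d] vanishing to order
    [a] at the origin, with rotation eigenvalue [eta ^ a]. Having distinct orders,
    these [d] sections are independent, hence a basis ([eig_independent],
    [eig_spanning]), and the multiplicity is the number of [a] in
    {0, ..., d - 2, d} with [a = n + k] modulo 6. The stated formula is this number
    written with sixth roots of unity ([mult_count_formula]).

    When [b = 0] the functions [phi] are periodic, and the Fourier expansion over the
    dual lattice turns the eigenvalue equation into the equation of a circle. The
    rotation acts freely on the dual lattice points of the circle, and the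
    invariant eigenfunctions are the combinations of the orbit sums
    ([has_dim_shell]). *)


(** * Complex exponentials, and derivatives along the real line *)

Lemma C_eq (z w : C) : Re z = Re w -> Im z = Im w -> z = w.
Proof. destruct z, w; simpl; intros; subst; reflexivity. Qed.

Ltac cring := apply C_eq; unfold Re, Im; simpl; ring.
Ltac cfield := apply C_eq; unfold Re, Im; simpl; field.

Lemma Cmult_integral (a b : C) : (a * b = 0)%C -> a = 0 \/ b = 0.
Proof.
  intro H. destruct (Ceq_dec a 0) as [|Ha]; [now left|].
  destruct (Ceq_dec b 0) as [|Hb]; [now right|].
  now elim (Cmult_neq_0 _ _ Ha Hb).
Qed.

Lemma Cmult_cancel (a b c : C) : a <> 0 -> (a * b = a * c)%C -> b = c.
Proof.
  intros Ha H. assert (E : (a * (b - c) = 0)%C) by (ring_simplify; rewrite H; ring).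
  destruct (Cmult_integral _ _ E) as [|E']; [tauto|].
  now apply Ceq_minus.
Qed.

Definition cexp (z : C) : C := (exp (Re z) * cos (Im z), exp (Re z) * sin (Im z)).
Definition cis (x : R) : C := (cos x, sin x).

Lemma cis_cexp x : cis x = cexp (0, x).
Proof. unfold cexp, cis; simpl. rewrite exp_0, !Rmult_1_l. reflexivity. Qed.

Lemma cexp_plus z w : cexp (z + w) = (cexp z * cexp w)%C.
Proof.
  unfold cexp. rewrite re_plus, im_plus, exp_plus, cos_plus, sin_plus. cring.
Qed.

Lemma cexp_0 : cexp 0 = 1.
Proof. unfold cexp; simpl. rewrite exp_0, cos_0, sin_0. cring. Qed.

Lemma cexp_opp_l z : (cexp (- z) * cexp z = 1)%C.
Proof. rewrite <- cexp_plus. replace (- z + z)%C with (RtoC 0) by ring. apply cexp_0. Qed.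

Lemma cexp_neq_0 z : cexp z <> 0.
Proof.
  intro H. generalize (cexp_opp_l z). rewrite H, Cmult_0_r. intro E.
  apply C1_nz. now symmetry.
Qed.

Lemma cis_plus x y : cis (x + y) = (cis x * cis y)%C.
Proof. rewrite !cis_cexp, <- cexp_plus. f_equal. cring. Qed.

Lemma cis_0 : cis 0 = 1.
Proof. unfold cis. now rewrite cos_0, sin_0. Qed.

Lemma cis_opp_l x : (cis (- x) * cis x = 1)%C.
Proof. rewrite <- cis_plus, Rplus_opp_l. apply cis_0. Qed.

Lemma cis_neq_0 x : cis x <> 0.
Proof. rewrite cis_cexp. apply cexp_neq_0. Qed.

Lemma cis_conj x : Cconj (cis x) = cis (- x).
Proof. unfold cis, Cconj; simpl. now rewrite cos_neg, sin_neg. Qed.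

Lemma Cmod_cexp z : Cmod (cexp z) = exp (Re z).
Proof.
  unfold Cmod, cexp; simpl fst; simpl snd.
  replace ((exp (Re z) * cos (Im z)) ^ 2 + (exp (Re z) * sin (Im z)) ^ 2)
    with ((exp (Re z))²).
  - rewrite sqrt_Rsqr; [reflexivity | left; apply exp_pos].
  - unfold Rsqr. generalize (sin2_cos2 (Im z)). unfold Rsqr. intro H.
    replace (exp (Re z) * exp (Re z)) with (exp (Re z) * exp (Re z) * 1) by ring.
    rewrite <- H. ring.
Qed.

Lemma Cmod_cis x : Cmod (cis x) = 1.
Proof. rewrite cis_cexp, Cmod_cexp. simpl. apply exp_0. Qed.

Lemma cis_2PI_Z (n : Z) : cis (2 * PI * IZR n) = 1.
Proof.
  assert (H : forall m : nat, cis (2 * PI * INR m) = 1).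
  { induction m as [|m IH].
    - simpl. rewrite Rmult_0_r. apply cis_0.
    - rewrite S_INR. replace (2 * PI * (INR m + 1)) with (2 * PI * INR m + 2 * PI) by ring.
      rewrite cis_plus, IH. unfold cis. rewrite cos_2PI, sin_2PI. cring. }
  destruct (Z_le_gt_dec 0 n) as [Hn|Hn].
  - rewrite <- (Z2Nat.id n Hn), <- INR_IZR_INZ. apply H.
  - generalize (cis_opp_l (2 * PI * IZR n)).
    replace (- (2 * PI * IZR n)) with (2 * PI * INR (Z.to_nat (- n))).
    + rewrite H. intro E. rewrite Cmult_1_l in E. exact E.
    + rewrite INR_IZR_INZ, Z2Nat.id by lia. rewrite opp_IZR. ring.
Qed.

Lemma cis_PI : cis PI = (- (1))%C.
Proof. unfold cis. rewrite cos_PI, sin_PI. cring. Qed.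

Lemma cis_pow x n : (cis x ^ n)%C = cis (INR n * x).
Proof.
  induction n as [|n IH].
  - simpl. rewrite Rmult_0_l. symmetry; apply cis_0.
  - rewrite Cpow_S, IH, S_INR, <- cis_plus. f_equal. ring.
Qed.

(** Derivatives of complex-valued functions of a real variable are handled
    through their two coordinates, where the product and chain rules for real
    functions apply. *)
Definition cder (g : R -> C) (s : R) (l : C) : Prop :=
  is_derive (fun u => Re (g u)) s (Re l) /\ is_derive (fun u => Im (g u)) s (Im l).

Lemma cder_eq g s l l' : cder g s l -> l = l' -> cder g s l'.
Proof. now intros H <-. Qed.

Lemma cder_ext f g s l : (forall u, f u = g u) -> cder f s l -> cder g s l.
Proof.
  intros H [H1 H2]. split.
  - refine (is_derive_ext _ _ _ _ _ H1). intro t; now rewrite H.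
  - refine (is_derive_ext _ _ _ _ _ H2). intro t; now rewrite H.
Qed.

Lemma cder_const c s : cder (fun _ => c) s 0.
Proof. split; apply (is_derive_const (V := R_NormedModule)). Qed.

Lemma cder_id s : cder (fun u => RtoC u) s 1.
Proof.
  split; simpl.
  - apply (is_derive_id (K := R_AbsRing)).
  - apply (is_derive_const (V := R_NormedModule)).
Qed.

Lemma cder_plus f g s l m : cder f s l -> cder g s m ->
  cder (fun u => (f u + g u)%C) s (l + m).
Proof.
  intros [H1 H2] [H3 H4]. split.
  - rewrite re_plus. apply (is_derive_plus (V := R_NormedModule)); assumption.
  - rewrite im_plus. apply (is_derive_plus (V := R_NormedModule)); assumption.
Qed.

Lemma is_derive_Rmult (f g : R -> R) s l m : is_derive f s l -> is_derive g s m ->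
  is_derive (fun u => f u * g u) s (l * g s + f s * m).
Proof.
  intros H1 H2. apply (is_derive_mult (K := R_AbsRing)); auto. intros; apply Rmult_comm.
Qed.

Lemma cder_mult f g s l m : cder f s l -> cder g s m ->
  cder (fun u => (f u * g u)%C) s (l * g s + f s * m).
Proof.
  intros [H1 H2] [H3 H4]. split.
  - eapply is_derive_ext. { intro t. symmetry. apply re_mult. }
    replace (Re (l * g s + f s * m)) with
      ((Re l * Re (g s) + Re (f s) * Re m) - (Im l * Im (g s) + Im (f s) * Im m))
      by (unfold Re, Im; simpl; ring).
    apply (is_derive_minus (V := R_NormedModule)); apply is_derive_Rmult; assumption.
  - eapply is_derive_ext. { intro t. symmetry. apply im_mult. }
    replace (Im (l * g s + f s * m)) with
      ((Re l * Im (g s) + Re (f s) * Im m) + (Im l * Re (g s) + Im (f s) * Re m))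
      by (unfold Re, Im; simpl; ring).
    apply (is_derive_plus (V := R_NormedModule)); apply is_derive_Rmult; assumption.
Qed.

Lemma cder_scal c f s l : cder f s l -> cder (fun u => (c * f u)%C) s (c * l).
Proof.
  intro H. eapply cder_eq. { apply cder_mult; [apply cder_const | exact H]. } simpl; ring.
Qed.

Lemma cder_conj f s l : cder f s l -> cder (fun u => Cconj (f u)) s (Cconj l).
Proof.
  intros [H1 H2]. split; simpl; [exact H1|].
  apply (is_derive_opp (V := R_NormedModule)). exact H2.
Qed.

Lemma cder_affine f a b s l : cder f (a * s + b) l ->
  cder (fun u => f (a * u + b)) s (RtoC a * l).
Proof.
  assert (Hd : is_derive (fun u : R => a * u + b) s a).
  { auto_derive; [trivial | ring]. }
  intros [H1 H2]. split.
  - rewrite re_scal_l.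
    apply (is_derive_comp (V := R_NormedModule) (fun u => Re (f u)) _ s _ _ H1 Hd).
  - rewrite im_scal_l.
    apply (is_derive_comp (V := R_NormedModule) (fun u => Im (f u)) _ s _ _ H2 Hd).
Qed.

Lemma is_derive_Rcomp (f g : R -> R) s l m : is_derive f (g s) l -> is_derive g s m ->
  is_derive (fun u => f (g u)) s (m * l).
Proof. intros H1 H2. apply (is_derive_comp (V := R_NormedModule) f g s l m H1 H2). Qed.

Lemma is_derive_exp x : is_derive exp x (exp x).
Proof. apply is_derive_Reals, derivable_pt_lim_exp. Qed.
Lemma is_derive_cos x : is_derive cos x (- sin x).
Proof. apply is_derive_Reals, derivable_pt_lim_cos. Qed.
Lemma is_derive_sin x : is_derive sin x (cos x).
Proof. apply is_derive_Reals, derivable_pt_lim_sin. Qed.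

Lemma cder_cexp g s l : cder g s l -> cder (fun u => cexp (g u)) s (l * cexp (g s)).
Proof.
  intros [H1 H2]. split.
  - replace (Re (l * cexp (g s))) with
      (Re l * exp (Re (g s)) * cos (Im (g s))
       + exp (Re (g s)) * (Im l * - sin (Im (g s))))
      by (rewrite re_mult; unfold cexp; simpl; ring).
    apply (is_derive_Rmult (fun u => exp (Re (g u))) (fun u => cos (Im (g u))));
      apply is_derive_Rcomp; auto using is_derive_exp, is_derive_cos.
  - replace (Im (l * cexp (g s))) with
      (Re l * exp (Re (g s)) * sin (Im (g s))
       + exp (Re (g s)) * (Im l * cos (Im (g s))))
      by (rewrite im_mult; unfold cexp; simpl; ring).
    apply (is_derive_Rmult (fun u => exp (Re (g u))) (fun u => sin (Im (g u))));
      apply is_derive_Rcomp; auto using is_derive_exp, is_derive_sin.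
Qed.

Lemma cder_CDerive g s l : cder g s l -> CDerive g s = l.
Proof.
  intros [H1 H2]. apply C_eq; simpl; apply is_derive_unique; assumption.
Qed.

Lemma cder_unique g s l m : cder g s l -> cder g s m -> l = m.
Proof. intros H1 H2. now rewrite <- (cder_CDerive _ _ _ H1), (cder_CDerive _ _ _ H2). Qed.

Lemma cder_is_derive g s l : cder g s l -> @is_derive R_AbsRing C_R_NormedModule g s l.
Proof.
  intros [H1 H2].
  assert (E : forall z : C, @plus C_R_NormedModule
     (@scal R_Ring C_R_NormedModule (Re z) (1, 0))
     (@scal R_Ring C_R_NormedModule (Im z) (0, 1)) = z).
  { intro z. rewrite !scal_R_Cmult. change (Re z * (1, 0) + Im z * (0, 1) = z)%C. cring. }
  eapply (is_derive_ext (V := C_R_NormedModule)). { intro t. apply (E (g t)). }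
  rewrite <- (E l).
  apply (is_derive_plus (V := C_R_NormedModule));
    apply (is_derive_scal_l (K := R_AbsRing) (V := C_R_NormedModule)); assumption.
Qed.

Lemma is_derive_cder g s l : @is_derive R_AbsRing C_R_NormedModule g s l -> cder g s l.
Proof.
  intro H. split.
  - apply (filterdiff_comp' (K := R_AbsRing) (U := R_NormedModule) (V := C_R_NormedModule)
             (W := R_NormedModule) g Re s (fun y => scal y l) Re H).
    apply filterdiff_linear. apply (is_linear_fst (U := R_NormedModule) (V := R_NormedModule)).
  - apply (filterdiff_comp' (K := R_AbsRing) (U := R_NormedModule) (V := C_R_NormedModule)
             (W := R_NormedModule) g Im s (fun y => scal y l) Im H).
    apply filterdiff_linear. apply (is_linear_snd (U := R_NormedModule) (V := R_NormedModule)).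
Qed.

Lemma ex_CDerive_cder g s : ex_CDerive g s -> cder g s (CDerive g s).
Proof.
  intros [l H]. apply is_derive_cder in H. now rewrite (cder_CDerive _ _ _ H).
Qed.

Lemma cder_ex_CDerive g s l : cder g s l -> ex_CDerive g s.
Proof. intro H. exists l. now apply cder_is_derive. Qed.

Definition ccont {X : UniformSpace} (f : X -> C) (x : X) : Prop :=
  @continuous X C_UniformSpace f x.

Lemma ccont_intro {X : UniformSpace} (f : X -> C) (x : X) :
  continuous (fun y => Re (f y)) x -> continuous (fun y => Im (f y)) x -> ccont f x.
Proof.
  intros H1 H2 P HP. destruct HP as [eps He].
  assert (A := H1 (ball (Re (f x)) eps) (locally_ball _ eps)).
  assert (B := H2 (ball (Im (f x)) eps) (locally_ball _ eps)).
  unfold filtermap in *.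
  refine (filter_imp _ _ _ (filter_and _ _ A B)).
  intros y [Ha Hb]. apply He. split; assumption.
Qed.

Lemma ccont_Re {X : UniformSpace} (f : X -> C) (x : X) :
  ccont f x -> continuous (fun y => Re (f y)) x.
Proof.
  intro H. apply (continuous_comp f (fun z : C_UniformSpace => Re z) x H).
  destruct (f x) as [a b]. apply (continuous_fst (U := R_UniformSpace) (V := R_UniformSpace)).
Qed.

Lemma ccont_Im {X : UniformSpace} (f : X -> C) (x : X) :
  ccont f x -> continuous (fun y => Im (f y)) x.
Proof.
  intro H. apply (continuous_comp f (fun z : C_UniformSpace => Im z) x H).
  destruct (f x) as [a b]. apply (continuous_snd (U := R_UniformSpace) (V := R_UniformSpace)).
Qed.

Lemma continuous_Rplus {X : UniformSpace} (f g : X -> R) x :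
  continuous f x -> continuous g x -> continuous (fun y => f y + g y) x.
Proof. apply (continuous_plus (V := R_NormedModule)). Qed.

Lemma continuous_Rmult {X : UniformSpace} (f g : X -> R) x :
  continuous f x -> continuous g x -> continuous (fun y => f y * g y) x.
Proof. apply (continuous_mult (K := R_AbsRing)). Qed.

Lemma continuous_Ropp {X : UniformSpace} (f : X -> R) x :
  continuous f x -> continuous (fun y => - f y) x.
Proof. apply (continuous_opp (V := R_NormedModule)). Qed.

Lemma ccont_const {X : UniformSpace} (c : C) (x : X) : ccont (fun _ => c) x.
Proof. apply continuous_const. Qed.

Lemma ccont_plus {X : UniformSpace} (f g : X -> C) x :
  ccont f x -> ccont g x -> ccont (fun y => (f y + g y)%C) x.
Proof.
  intros Hf Hg. apply ccont_intro.
  - apply (continuous_Rplus (fun y => Re (f y)) (fun y => Re (g y)));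
      apply ccont_Re; assumption.
  - apply (continuous_Rplus (fun y => Im (f y)) (fun y => Im (g y)));
      apply ccont_Im; assumption.
Qed.

Lemma ccont_mult {X : UniformSpace} (f g : X -> C) x :
  ccont f x -> ccont g x -> ccont (fun y => (f y * g y)%C) x.
Proof.
  intros Hf Hg. generalize (ccont_Re _ _ Hf) (ccont_Im _ _ Hf) (ccont_Re _ _ Hg) (ccont_Im _ _ Hg).
  intros A B A' B'. apply ccont_intro; simpl.
  - apply continuous_Rplus; [|apply continuous_Ropp]; apply continuous_Rmult; assumption.
  - apply continuous_Rplus; apply continuous_Rmult; assumption.
Qed.

Lemma ccont_conj {X : UniformSpace} (f : X -> C) x :
  ccont f x -> ccont (fun y => Cconj (f y)) x.
Proof.
  intro H. apply ccont_intro; simpl; [now apply ccont_Re|].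
  apply continuous_Ropp. now apply ccont_Im.
Qed.

Lemma continuous_exp x : continuous exp x.
Proof. apply (ex_derive_continuous (V := R_NormedModule)). eexists; apply is_derive_exp. Qed.
Lemma continuous_cos x : continuous cos x.
Proof. apply (ex_derive_continuous (V := R_NormedModule)). eexists; apply is_derive_cos. Qed.
Lemma continuous_sin x : continuous sin x.
Proof. apply (ex_derive_continuous (V := R_NormedModule)). eexists; apply is_derive_sin. Qed.

Lemma ccont_cexp {X : UniformSpace} (f : X -> C) x :
  ccont f x -> ccont (fun y => cexp (f y)) x.
Proof.
  intro H. apply ccont_intro; unfold cexp; simpl;
    apply continuous_Rmult; apply continuous_comp;
    auto using ccont_Re, ccont_Im, continuous_exp, continuous_cos, continuous_sin.
Qed.

Lemma cder_ccont g s l : cder g s l -> ccont g s.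
Proof.
  intros [H1 H2]. apply ccont_intro;
    apply (ex_derive_continuous (V := R_NormedModule)); eexists; eassumption.
Qed.

(** * Smooth functions on the plane *)

Definition pdx (phi : C -> C) (z : C) : C := CDerive (fun s => phi (s, Im z)) (Re z).
Definition pdy (phi : C -> C) (z : C) : C := CDerive (fun s => phi (Re z, s)) (Im z).

Definition pgrad (phi phix phiy : C -> C) : Prop := forall z : C,
  cder (fun s => phi (s, Im z)) (Re z) (phix z) /\
  cder (fun s => phi (Re z, s)) (Im z) (phiy z).

(** On the plane, the analogue of the predicate [Ck] on the Heisenberg group. *)
Fixpoint PCk (k : nat) (phi : C -> C) : Prop :=
  (forall z : C, @ccont C_UniformSpace phi z) /\
  match k with
  | O => True
  | S k' => pgrad phi (pdx phi) (pdy phi) /\ PCk k' (pdx phi) /\ PCk k' (pdy phi)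
  end.

Definition psmooth (phi : C -> C) : Prop := forall k, PCk k phi.

Lemma pgrad_pdx phi phix phiy : pgrad phi phix phiy -> pdx phi = phix.
Proof. intro H. extensionality z. apply cder_CDerive, H. Qed.

Lemma pgrad_pdy phi phix phiy : pgrad phi phix phiy -> pdy phi = phiy.
Proof. intro H. extensionality z. apply cder_CDerive, H. Qed.

Ltac rewrite_pgrad G := rewrite (pgrad_pdx _ _ _ G), (pgrad_pdy _ _ _ G).

Lemma PCk_cont k phi z : PCk k phi -> @ccont C_UniformSpace phi z.
Proof. destruct k; intros [H _]; apply H. Qed.

Lemma PCk_intro k phi phix phiy : (forall z, @ccont C_UniformSpace phi z) ->
  pgrad phi phix phiy -> PCk k phix -> PCk k phiy -> PCk (S k) phi.
Proof.
  intros H G Hx Hy. simpl. rewrite_pgrad G. auto.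
Qed.

Lemma PCk_S k phi : PCk (S k) phi -> PCk k phi.
Proof.
  revert phi. induction k as [|k IH]; intros phi H.
  - split; [apply H | trivial].
  - destruct H as [H [G [Hx Hy]]]. split; [exact H|]. auto.
Qed.

Lemma psmooth_pgrad phi : psmooth phi -> pgrad phi (pdx phi) (pdy phi).
Proof. intro H. apply (H 1%nat). Qed.

Lemma psmooth_pdx phi : psmooth phi -> psmooth (pdx phi).
Proof. intros H k. apply (H (S k)). Qed.

Lemma psmooth_pdy phi : psmooth phi -> psmooth (pdy phi).
Proof. intros H k. apply (H (S k)). Qed.

Lemma psmooth_cont phi z : psmooth phi -> @ccont C_UniformSpace phi z.
Proof. intro H. apply (PCk_cont 0), H. Qed.

Lemma pgrad_const c : pgrad (fun _ => c) (fun _ => RtoC 0) (fun _ => RtoC 0).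
Proof. intro z. split; apply cder_const. Qed.

Lemma pgrad_plus f fx fy g gx gy : pgrad f fx fy -> pgrad g gx gy ->
  pgrad (fun z => (f z + g z)%C) (fun z => (fx z + gx z)%C) (fun z => (fy z + gy z)%C).
Proof.
  intros Hf Hg z. destruct (Hf z), (Hg z). split; apply (cder_plus (fun s => f _)); assumption.
Qed.

Lemma pgrad_mult f fx fy g gx gy : pgrad f fx fy -> pgrad g gx gy ->
  pgrad (fun z => (f z * g z)%C) (fun z => (fx z * g z + f z * gx z)%C)
    (fun z => (fy z * g z + f z * gy z)%C).
Proof.
  intros Hf Hg z. destruct (Hf z) as [A B], (Hg z) as [A' B']. destruct z as [x y]. split.
  - apply (cder_mult (fun s => f _)); assumption.
  - apply (cder_mult (fun s => f _)); assumption.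
Qed.

Lemma pgrad_conj f fx fy : pgrad f fx fy ->
  pgrad (fun z => Cconj (f z)) (fun z => Cconj (fx z)) (fun z => Cconj (fy z)).
Proof. intros Hf z. destruct (Hf z). split; apply (cder_conj (fun s => f _)); assumption. Qed.

Lemma pgrad_cexp f fx fy : pgrad f fx fy ->
  pgrad (fun z => cexp (f z)) (fun z => (fx z * cexp (f z))%C) (fun z => (fy z * cexp (f z))%C).
Proof.
  intros Hf z. destruct (Hf z). destruct z as [x y].
  split; apply (cder_cexp (fun s => f _)); assumption.
Qed.

Lemma pgrad_id : pgrad (fun z => z) (fun _ => RtoC 1) (fun _ => Ci).
Proof.
  intros [x y]. split; split; simpl;
    first [apply (is_derive_id (K := R_AbsRing)) | apply (is_derive_const (V := R_NormedModule))].
Qed.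

Lemma PCk_const k c : PCk k (fun _ => c).
Proof.
  revert c. induction k as [|k IH]; intro c.
  - split; [intro; apply ccont_const | trivial].
  - apply PCk_intro with (phix := fun _ => RtoC 0) (phiy := fun _ => RtoC 0); auto.
    + intro; apply ccont_const.
    + apply pgrad_const.
Qed.

Lemma PCk_plus k f g : PCk k f -> PCk k g -> PCk k (fun z => (f z + g z)%C).
Proof.
  revert f g. induction k as [|k IH]; intros f g [Cf Hf] [Cg Hg].
  - split; [intro z; apply ccont_plus; auto | trivial].
  - destruct Hf as [Gf [Hfx Hfy]], Hg as [Gg [Hgx Hgy]].
    eapply PCk_intro. { intro z; apply ccont_plus; auto. }
    { apply pgrad_plus; eassumption. } all: auto.
Qed.

Lemma PCk_mult k f g : PCk k f -> PCk k g -> PCk k (fun z => (f z * g z)%C).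
Proof.
  revert f g. induction k as [|k IH]; intros f g Hf Hg.
  - split; [intro z; apply ccont_mult; [apply Hf | apply Hg] | trivial].
  - assert (Hf' := PCk_S _ _ Hf). assert (Hg' := PCk_S _ _ Hg).
    destruct Hf as [Cf [Gf [Hfx Hfy]]], Hg as [Cg [Gg [Hgx Hgy]]].
    eapply PCk_intro. { intro z; apply ccont_mult; auto. }
    { apply pgrad_mult; eassumption. } all: apply PCk_plus; auto.
Qed.

Lemma PCk_conj k f : PCk k f -> PCk k (fun z => Cconj (f z)).
Proof.
  revert f. induction k as [|k IH]; intros f [Cf Hf].
  - split; [intro z; apply ccont_conj; auto | trivial].
  - destruct Hf as [Gf [Hfx Hfy]].
    eapply PCk_intro. { intro z; apply ccont_conj; auto. }
    { apply pgrad_conj; eassumption. } all: auto.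
Qed.

Lemma psmooth_const c : psmooth (fun _ => c).
Proof. intro k. apply PCk_const. Qed.

Lemma psmooth_plus f g : psmooth f -> psmooth g -> psmooth (fun z => (f z + g z)%C).
Proof. intros Hf Hg k. apply PCk_plus; auto. Qed.

Lemma psmooth_mult f g : psmooth f -> psmooth g -> psmooth (fun z => (f z * g z)%C).
Proof. intros Hf Hg k. apply PCk_mult; auto. Qed.

Lemma psmooth_scal c f : psmooth f -> psmooth (fun z => (c * f z)%C).
Proof. apply (psmooth_mult (fun _ => c)), psmooth_const. Qed.

Lemma psmooth_conj f : psmooth f -> psmooth (fun z => Cconj (f z)).
Proof. intros Hf k. apply PCk_conj; auto. Qed.

Lemma psmooth_id : psmooth (fun z => z).
Proof.
  intros [|k].
  - split; [|trivial]. intro z. apply continuous_id.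
  - eapply PCk_intro; [intro; apply continuous_id | apply pgrad_id | |]; apply PCk_const.
Qed.

Lemma psmooth_cexp f : psmooth f -> psmooth (fun z => cexp (f z)).
Proof.
  intros Hf k. induction k as [|k IH].
  - split; [intro z; apply ccont_cexp, psmooth_cont, Hf | trivial].
  - eapply PCk_intro. { intro z; apply ccont_cexp, psmooth_cont, Hf. }
    { apply pgrad_cexp, psmooth_pgrad, Hf. }
    all: apply PCk_mult; [|exact IH].
    + apply psmooth_pdx, Hf.
    + apply psmooth_pdy, Hf.
Qed.

(** Continuous partial derivatives give a total derivative, hence derivatives
    along all lines; this is what makes smoothness stable under the rotation. *)
Lemma real_directional (f fx : R -> R -> R) (a b c d s dfy : R) :
  (forall x y, is_derive (fun z => f z y) x (fx x y)) ->
  is_derive (fun z => f (a * s + b) z) (c * s + d) dfy ->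
  continuous (fun u : R * R => fx (fst u) (snd u)) (a * s + b, c * s + d) ->
  is_derive (fun u => f (a * u + b) (c * u + d)) s
    (a * fx (a * s + b) (c * s + d) + c * dfy).
Proof.
  intros Hx Hy Hc.
  assert (Hd : differentiable_pt_lim f (a * s + b) (c * s + d) (fx (a * s + b) (c * s + d)) dfy).
  { apply filterdiff_differentiable_pt_lim.
    apply (is_derive_filterdiff f (a * s + b) (c * s + d) fx dfy); auto.
    exists (mkposreal 1 Rlt_0_1). intros u _. apply Hx. }
  apply is_derive_Reals. rewrite (Rmult_comm a (fx _ _)), (Rmult_comm c dfy).
  apply (derivable_pt_lim_comp_2d f (fun u => a * u + b) (fun u => c * u + d)).
  - exact Hd.
  - apply is_derive_Reals. auto_derive; [trivial | ring].
  - apply is_derive_Reals. auto_derive; [trivial | ring].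
Qed.

Lemma cder_directional phi a b c d s : psmooth phi ->
  cder (fun u => phi ((a * u + b)%R, (c * u + d)%R)) s
    (a * pdx phi ((a * s + b)%R, (c * s + d)%R)
     + c * pdy phi ((a * s + b)%R, (c * s + d)%R))%C.
Proof.
  intro H. assert (G := psmooth_pgrad _ H).
  assert (Hc := psmooth_cont _ (a * s + b, c * s + d) (psmooth_pdx _ H)).
  split.
  - rewrite re_plus, !re_scal_l.
    apply (real_directional (fun x y => Re (phi (x, y))) (fun x y => Re (pdx phi (x, y)))).
    + intros x y. apply (G (x, y)).
    + apply (G (a * s + b, c * s + d)).
    + eapply continuous_ext; [|apply ccont_Re, Hc]. intros [x y]; reflexivity.
  - rewrite im_plus, !im_scal_l.
    apply (real_directional (fun x y => Im (phi (x, y))) (fun x y => Im (pdx phi (x, y)))).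
    + intros x y. apply (G (x, y)).
    + apply (G (a * s + b, c * s + d)).
    + eapply continuous_ext; [|apply ccont_Im, Hc]. intros [x y]; reflexivity.
Qed.

Definition affine (a b c d e f : R) (z : C) : C :=
  (a * Re z + b * Im z + e, c * Re z + d * Im z + f).

Lemma pgrad_affine phi a b c d e f : psmooth phi ->
  pgrad (fun z => phi (affine a b c d e f z))
    (fun z => a * pdx phi (affine a b c d e f z) + c * pdy phi (affine a b c d e f z))%C
    (fun z => b * pdx phi (affine a b c d e f z) + d * pdy phi (affine a b c d e f z))%C.
Proof.
  intros H [x y]. unfold affine. simpl. split.
  - eapply cder_ext; [|eapply cder_eq; [apply (cder_directional phi a (b * y + e) c (d * y + f) x H)|]].
    + intro u. simpl. do 2 f_equal; ring.
    + replace (a * x + (b * y + e)) with (a * x + b * y + e) by ring.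
      replace (c * x + (d * y + f)) with (c * x + d * y + f) by ring. reflexivity.
  - eapply cder_ext; [|eapply cder_eq; [apply (cder_directional phi b (a * x + e) d (c * x + f) y H)|]].
    + intro u. simpl. do 2 f_equal; ring.
    + replace (b * y + (a * x + e)) with (a * x + b * y + e) by ring.
      replace (d * y + (c * x + f)) with (c * x + d * y + f) by ring. reflexivity.
Qed.

Lemma ccont_affine phi a b c d e f z : (forall z, @ccont C_UniformSpace phi z) ->
  @ccont C_UniformSpace (fun z => phi (affine a b c d e f z)) z.
Proof.
  intro H. apply (continuous_comp (affine a b c d e f : C_UniformSpace -> C_UniformSpace) phi).
  - apply (ccont_intro (X := C_UniformSpace)); unfold affine; simpl;
      (apply continuous_Rplus; [|apply continuous_const]);
      apply continuous_Rplus; apply continuous_Rmult; try apply continuous_const;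
      first [apply (ccont_Re (X := C_UniformSpace) (fun z => z)) | apply (ccont_Im (X := C_UniformSpace) (fun z => z))];
      apply continuous_id.
  - apply H.
Qed.

Lemma psmooth_affine phi a b c d e f : psmooth phi ->
  psmooth (fun z => phi (affine a b c d e f z)).
Proof.
  intros H k. revert phi H. induction k as [|k IH]; intros phi H.
  - split; [|trivial]. intro z. apply ccont_affine. intro; now apply psmooth_cont.
  - eapply PCk_intro. { intro z. apply ccont_affine. intro; now apply psmooth_cont. }
    { now apply pgrad_affine. }
    all: apply PCk_plus; apply (PCk_mult k (fun _ => _)); try apply PCk_const;
      apply IH; first [exact (psmooth_pdx _ H) | exact (psmooth_pdy _ H)].
Qed.

Lemma psmooth_ext f g : (forall z, f z = g z) -> psmooth f -> psmooth g.
Proof. intros E. replace g with f; auto. now extensionality z. Qed.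

(** Schwarz's theorem for the two coordinates of [phi]; it makes the commutator
    of the operators [Dz] and [Db] below a constant. *)
Lemma pdx_pdy phi z : psmooth phi -> pdx (pdy phi) z = pdy (pdx phi) z.
Proof.
  intro H.
  assert (G := psmooth_pgrad _ H).
  assert (Gx := psmooth_pgrad _ (psmooth_pdx _ H)).
  assert (Gy := psmooth_pgrad _ (psmooth_pdy _ H)).
  assert (Cxy := fun z => psmooth_cont _ z (psmooth_pdy _ (psmooth_pdx _ H))).
  assert (Cyx := fun z => psmooth_cont _ z (psmooth_pdx _ (psmooth_pdy _ H))).
  destruct z as [x y].
  assert (S : forall pr : C -> R, (forall w : C, pr w = Re w) \/ (forall w : C, pr w = Im w) ->
    pr (pdx (pdy phi) (x, y)) = pr (pdy (pdx phi) (x, y))).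
  { intros pr Hpr.
    assert (D : forall g s l, cder g s l -> is_derive (fun u => pr (g u)) s (pr l)).
    { intros g s l [H1 H2]. destruct Hpr as [E|E].
      - rewrite E. eapply is_derive_ext; [|exact H1]. intro; now rewrite E.
      - rewrite E. eapply is_derive_ext; [|exact H2]. intro; now rewrite E. }
    assert (K : forall g : C -> C, (forall w, @ccont C_UniformSpace g w) -> forall u v,
        continuity_2d_pt (fun u v => pr (g (u, v))) u v).
    { intros g Hg u v. apply continuity_2d_pt_filterlim.
      destruct Hpr as [E|E]; rewrite E.
      - eapply filterlim_ext; [|apply (ccont_Re g (u, v) (Hg (u, v)))].
        intros [p q]; now rewrite E.
      - eapply filterlim_ext; [|apply (ccont_Im g (u, v) (Hg (u, v)))].
        intros [p q]; now rewrite E. }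
    set (f := fun u v => pr (phi (u, v))).
    assert (Ex : forall u v, Derive (fun t => f t v) u = pr (pdx phi (u, v))).
    { intros u v. apply is_derive_unique. exact (D _ _ _ (proj1 (G (u, v)))). }
    assert (Ey : forall u v, Derive (fun t => f u t) v = pr (pdy phi (u, v))).
    { intros u v. apply is_derive_unique. exact (D _ _ _ (proj2 (G (u, v)))). }
    assert (Dxy : forall u v, is_derive (fun w => Derive (fun t => f t w) u) v
                   (pr (pdy (pdx phi) (u, v)))).
    { intros u v. eapply is_derive_ext. { intro t; symmetry; apply Ex. }
      exact (D _ _ _ (proj2 (Gx (u, v)))). }
    assert (Dyx : forall u v, is_derive (fun w => Derive (fun t => f w t) v) u
                   (pr (pdx (pdy phi) (u, v)))).
    { intros u v. eapply is_derive_ext. { intro t; symmetry; apply Ey. }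
      exact (D _ _ _ (proj1 (Gy (u, v)))). }
    transitivity (Derive (fun w => Derive (fun t => f w t) y) x).
    { symmetry. apply is_derive_unique, Dyx. }
    transitivity (Derive (fun w => Derive (fun t => f t w) x) y).
    2: { apply is_derive_unique, Dxy. }
    apply Schwarz.
    - exists (mkposreal 1 Rlt_0_1). intros u v _ _. repeat split; eexists.
      + exact (D _ _ _ (proj1 (G (u, v)))).
      + exact (D _ _ _ (proj2 (G (u, v)))).
      + apply Dyx.
      + apply Dxy.
    - eapply continuity_2d_pt_ext; [|apply (K _ Cyx)].
      intros u v. symmetry. apply is_derive_unique, Dyx.
    - eapply continuity_2d_pt_ext; [|apply (K _ Cxy)].
      intros u v. symmetry. apply is_derive_unique, Dxy. }
  apply C_eq; apply S; auto.
Qed.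

(** * Fourier coefficients on the unit interval *)

Definition cont01 (g : R -> C) : Prop :=
  forall x, 0 <= x <= 1 -> @ccont R_UniformSpace g x.

Definition CInt (g : R -> C) : C :=
  (RInt (fun x => Re (g x)) 0 1, RInt (fun x => Im (g x)) 0 1).

Lemma cont01_ex_RInt (f : R -> R) :
  (forall x, 0 <= x <= 1 -> continuous f x) -> ex_RInt f 0 1.
Proof.
  intro H. apply (ex_RInt_continuous (V := R_CompleteNormedModule)).
  intros z Hz. apply H. rewrite Rmin_left, Rmax_right in Hz; lra.
Qed.

Lemma cont01_Re g : cont01 g -> ex_RInt (fun x => Re (g x)) 0 1.
Proof. intro H. apply cont01_ex_RInt. intros x Hx. apply (ccont_Re (X := R_UniformSpace)), H, Hx. Qed.

Lemma cont01_Im g : cont01 g -> ex_RInt (fun x => Im (g x)) 0 1.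
Proof. intro H. apply cont01_ex_RInt. intros x Hx. apply (ccont_Im (X := R_UniformSpace)), H, Hx. Qed.

Lemma cont01_mult f g : cont01 f -> cont01 g -> cont01 (fun x => (f x * g x)%C).
Proof. intros Hf Hg x Hx. apply ccont_mult; auto. Qed.

Lemma cont01_plus f g : cont01 f -> cont01 g -> cont01 (fun x => (f x + g x)%C).
Proof. intros Hf Hg x Hx. apply ccont_plus; auto. Qed.

Lemma cont01_const c : cont01 (fun _ => c).
Proof. intros x _. apply ccont_const. Qed.

Lemma cont01_conj f : cont01 f -> cont01 (fun x => Cconj (f x)).
Proof. intros Hf x Hx. apply ccont_conj; auto. Qed.

Lemma RInt_ext01 (f g : R -> R) : (forall x, 0 <= x <= 1 -> f x = g x) ->
  RInt f 0 1 = RInt g 0 1.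
Proof.
  intro H. apply RInt_ext. rewrite Rmin_left, Rmax_right by lra. intros; apply H; lra.
Qed.

Lemma CInt_ext f g : (forall x, 0 <= x <= 1 -> f x = g x) -> CInt f = CInt g.
Proof. intro H. unfold CInt. f_equal; apply RInt_ext01; intros x Hx; now rewrite H. Qed.

Lemma CInt_plus f g : cont01 f -> cont01 g ->
  CInt (fun x => (f x + g x)%C) = (CInt f + CInt g)%C.
Proof.
  intros Hf Hg. apply C_eq; simpl.
  - rewrite <- (RInt_plus (V := R_CompleteNormedModule)) by (apply cont01_Re; assumption).
    reflexivity.
  - rewrite <- (RInt_plus (V := R_CompleteNormedModule)) by (apply cont01_Im; assumption).
    reflexivity.
Qed.

Lemma CInt_scal c f : cont01 f -> CInt (fun x => (c * f x)%C) = (c * CInt f)%C.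
Proof.
  intros Hf. assert (A := cont01_Re _ Hf). assert (B := cont01_Im _ Hf).
  assert (S : forall (k : R) (h : R -> R), ex_RInt h 0 1 ->
    RInt (fun x => k * h x) 0 1 = k * RInt h 0 1).
  { intros k h Hh. apply (RInt_scal (V := R_CompleteNormedModule)), Hh. }
  assert (E : forall (k : R) (h : R -> R), ex_RInt h 0 1 -> ex_RInt (fun x => k * h x) 0 1).
  { intros k h Hh. apply (ex_RInt_scal (V := R_NormedModule)), Hh. }
  apply C_eq; simpl; change (fst c) with (Re c); change (snd c) with (Im c);
    change (fst (CInt f)) with (RInt (fun x => Re (f x)) 0 1);
    change (snd (CInt f)) with (RInt (fun x => Im (f x)) 0 1).
  - rewrite <- !S by assumption.
    rewrite <- (RInt_minus (V := R_CompleteNormedModule)) by auto. reflexivity.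
  - rewrite <- !S by assumption.
    rewrite <- (RInt_plus (V := R_CompleteNormedModule)) by auto. reflexivity.
Qed.

Lemma CInt_conj f : cont01 f -> CInt (fun x => Cconj (f x)) = Cconj (CInt f).
Proof.
  intro Hf. apply C_eq; simpl; [reflexivity|].
  apply (RInt_opp (V := R_CompleteNormedModule)). now apply cont01_Im.
Qed.

Lemma CInt_deriv G g : (forall x, cder G x (g x)) -> cont01 g -> CInt g = (G 1 - G 0)%C.
Proof.
  intros HG Hg. apply C_eq; simpl; apply is_RInt_unique.
  - apply (is_RInt_derive (V := R_CompleteNormedModule) (fun x => Re (G x))).
    + intros x _. apply HG.
    + intros x Hx. rewrite Rmin_left, Rmax_right in Hx by lra.
      now apply (ccont_Re (X := R_UniformSpace)), Hg.
  - apply (is_RInt_derive (V := R_CompleteNormedModule) (fun x => Im (G x))).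
    + intros x _. apply HG.
    + intros x Hx. rewrite Rmin_left, Rmax_right in Hx by lra.
      now apply (ccont_Im (X := R_UniformSpace)), Hg.
Qed.

Definition expn (m : Z) (x : R) : C := cis (2 * PI * IZR m * x).

Definition fcoef (g : R -> C) (m : Z) : C := CInt (fun x => (g x * expn (- m) x)%C).

Lemma cder_expn m x : cder (expn m) x (2 * PI * IZR m * Ci * expn m x).
Proof.
  assert (E : forall u, expn m u = cexp (2 * PI * IZR m * Ci * u)).
  { intro u. unfold expn. rewrite cis_cexp. f_equal. cring. }
  rewrite E. eapply cder_ext. { intro u. symmetry. apply E. }
  apply (cder_cexp (fun u => (2 * PI * IZR m * Ci * u)%C)).
  eapply cder_eq; [apply cder_scal, cder_id | ring].
Qed.

Lemma cont_expn m x : @ccont R_UniformSpace (expn m) x.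
Proof. eapply cder_ccont, cder_expn. Qed.

Lemma cont01_expn m : cont01 (expn m).
Proof. intros x _. apply cont_expn. Qed.

Lemma expn_plus m n x : expn (m + n) x = (expn m x * expn n x)%C.
Proof. unfold expn. rewrite <- cis_plus, plus_IZR. f_equal. ring. Qed.

Lemma expn_0 x : expn 0 x = 1.
Proof. unfold expn. rewrite Rmult_0_r, Rmult_0_l. apply cis_0. Qed.

Lemma expn_at_1 m : expn m 1 = 1.
Proof. unfold expn. rewrite Rmult_1_r. apply cis_2PI_Z. Qed.

Lemma expn_at_0 m : expn m 0 = 1.
Proof. unfold expn. rewrite Rmult_0_r. apply cis_0. Qed.

Lemma expn_shift m x y : expn m (x + y) = (expn m x * expn m y)%C.
Proof. unfold expn. rewrite <- cis_plus. f_equal. ring. Qed.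

Lemma expn_conj m x : Cconj (expn m x) = expn (- m) x.
Proof. unfold expn. rewrite cis_conj, opp_IZR. f_equal. ring. Qed.

Lemma CInt_const c : CInt (fun _ => c) = c.
Proof.
  rewrite (CInt_deriv (fun x => (c * RtoC x)%C)).
  - ring.
  - intro x. eapply cder_eq; [apply cder_scal, cder_id|]. ring.
  - apply cont01_const.
Qed.

Lemma CInt_expn m : m <> 0%Z -> CInt (expn m) = 0.
Proof.
  intro Hm.
  assert (H : (2 * PI * IZR m * Ci)%C <> 0).
  { repeat apply Cmult_neq_0; try apply Ci_nz; intro E; apply RtoC_inj in E.
    - lra. - now apply PI_neq0. - now apply (eq_IZR m 0) in E. }
  apply (Cmult_cancel _ _ _ H). rewrite <- CInt_scal by apply cont01_expn.
  rewrite (CInt_deriv (expn m)).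
  - rewrite expn_at_0, expn_at_1. ring.
  - apply cder_expn.
  - apply cont01_mult; [apply cont01_const | apply cont01_expn].
Qed.

Lemma fcoef_ext f g m : (forall x, 0 <= x <= 1 -> f x = g x) -> fcoef f m = fcoef g m.
Proof. intro H. apply CInt_ext. intros x Hx. now rewrite H. Qed.

Lemma fcoef_plus f g m : cont01 f -> cont01 g ->
  fcoef (fun x => (f x + g x)%C) m = (fcoef f m + fcoef g m)%C.
Proof.
  intros Hf Hg. unfold fcoef. rewrite <- CInt_plus by (apply cont01_mult; auto using cont01_expn).
  apply CInt_ext. intros; ring.
Qed.

Lemma fcoef_scal c f m : cont01 f -> fcoef (fun x => (c * f x)%C) m = (c * fcoef f m)%C.
Proof.
  intros Hf. unfold fcoef. rewrite <- CInt_scal by (apply cont01_mult; auto using cont01_expn).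
  apply CInt_ext. intros; ring.
Qed.

Lemma fcoef_expn_shift g m k : fcoef (fun x => (expn k x * g x)%C) m = fcoef g (m - k).
Proof.
  apply CInt_ext. intros x _. replace (- (m - k))%Z with (k + - m)%Z by ring.
  rewrite expn_plus. ring.
Qed.

Lemma fcoef_expn k m : fcoef (expn k) m = if Z.eq_dec k m then 1 else 0.
Proof.
  unfold fcoef. rewrite (CInt_ext _ (expn (k - m))).
  - destruct (Z.eq_dec k m) as [->|H].
    + rewrite Z.sub_diag, (CInt_ext _ (fun _ => 1)); [apply CInt_const|].
      intros; apply expn_0.
    + apply CInt_expn. lia.
  - intros x _. now rewrite <- expn_plus.
Qed.

Lemma fcoef_deriv g g' m : (forall x, cder g x (g' x)) -> cont01 g' -> g 1 = g 0 ->
  fcoef g' m = (2 * PI * IZR m * Ci * fcoef g m)%C.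
Proof.
  intros Hg Cg' Hper.
  assert (Cg : cont01 g) by (intros x _; eapply cder_ccont, Hg).
  assert (H := CInt_deriv (fun x => (g x * expn (- m) x)%C)
    (fun x => (g' x * expn (- m) x + g x * (2 * PI * IZR (- m) * Ci * expn (- m) x))%C)).
  cbv beta in H. rewrite expn_at_0, expn_at_1, Hper in H.
  unfold fcoef. apply Ceq_minus. transitivity (g 0 * 1 - g 0 * 1)%C; [|ring].
  rewrite <- H.
  - rewrite CInt_plus.
    + unfold Cminus. f_equal. rewrite <- CInt_scal, opp_IZR by
        (apply cont01_mult; auto using cont01_expn).
      replace (- CInt (fun x => 2 * PI * IZR m * Ci * (g x * expn (- m) x)))%C
        with ((- (1)) * CInt (fun x => 2 * PI * IZR m * Ci * (g x * expn (- m) x)))%C by ring.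
      rewrite <- CInt_scal.
      * apply CInt_ext. intros x _. rewrite RtoC_opp. ring.
      * apply cont01_mult; [apply cont01_const | apply cont01_mult; auto using cont01_expn].
    + apply cont01_mult; auto using cont01_expn.
    + apply cont01_mult; auto. apply cont01_mult; [apply cont01_const | apply cont01_expn].
  - intro x. apply cder_mult; [apply Hg | apply cder_expn].
  - apply cont01_plus; apply cont01_mult; auto using cont01_expn.
    apply cont01_mult; [apply cont01_const | apply cont01_expn].
Qed.

Lemma Re_CInt_norm_ge_0 w : cont01 w -> 0 <= Re (CInt (fun x => (w x * Cconj (w x))%C)).
Proof.
  intro Hw. simpl. apply RInt_ge_0; [lra | | ].
  - apply (cont01_Re (fun x => (w x * Cconj (w x))%C)).
    apply cont01_mult; [|apply cont01_conj]; exact Hw.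
  - intros x _. nra.
Qed.

(** Bessel's inequality: the components of [h] along the characters are removed
    one at a time, and each removal lowers the squared norm by at least [K ^ 2]. *)
Lemma Bessel_lower_bound h (f : nat -> Z) K : cont01 h -> 0 <= K ->
  (forall i j, f i = f j -> i = j) -> (forall i, K <= Cmod (fcoef h (f i))) -> K = 0.
Proof.
  intros Hh HK0 Hf HK.
  (* [w M] is [h] without its components along [f 0], ..., [f (M - 1)]. *)
  set (w := fix w (M : nat) (x : R) : C :=
    match M with O => h x | S M' => (w M' x + (- fcoef h (f M')) * expn (f M') x)%C end).
  assert (Cw : forall M, cont01 (w M)).
  { induction M as [|M IH]; [exact Hh|]. simpl.
    apply cont01_plus; [exact IH|]. apply cont01_mult; [apply cont01_const | apply cont01_expn]. }
  assert (Fw : forall M i, (M <= i)%nat -> fcoef (w M) (f i) = fcoef h (f i)).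
  { induction M as [|M IH]; intros i Hi; [reflexivity|]. simpl.
    rewrite fcoef_plus; auto.
    2: apply cont01_mult; [apply cont01_const | apply cont01_expn].
    rewrite fcoef_scal, fcoef_expn by apply cont01_expn.
    destruct (Z.eq_dec (f M) (f i)) as [E|E]; [apply Hf in E; lia|].
    rewrite IH by lia. ring. }
  set (N := fun M => CInt (fun x => (w M x * Cconj (w M x))%C)).
  assert (HN : forall M, Re (N M) <= Re (N O) - INR M * K ^ 2).
  { induction M as [|M IH].
    - simpl INR. lra.
    - assert (E : N (S M) = (N M - RtoC (Cmod (fcoef h (f M)) ^ 2))%C).
      2: { rewrite E, S_INR. unfold Cminus. rewrite re_plus, re_opp, re_RtoC.
           assert (K ^ 2 <= Cmod (fcoef h (f M)) ^ 2) by (apply pow_incr; auto). lra. }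
      set (a := fcoef h (f M)). set (e := expn (f M)).
      assert (Ce : cont01 e) by apply cont01_expn.
      assert (Cwe : cont01 (fun x => (w M x * Cconj (e x))%C)).
      { apply cont01_mult; auto using cont01_conj. }
      assert (Ewe : CInt (fun x => (w M x * Cconj (e x))%C) = a).
      { unfold a. rewrite <- (Fw M M) by lia. apply CInt_ext. intros x _.
        unfold e. now rewrite expn_conj. }
      unfold N. rewrite (CInt_ext _ (fun x => (w M x * Cconj (w M x)
          + ((- Cconj a) * (w M x * Cconj (e x))
          + ((- a) * Cconj (w M x * Cconj (e x)) + a * Cconj a)))%C)).
      + rewrite CInt_plus, CInt_plus, CInt_plus, CInt_scal, CInt_scal, CInt_conj, CInt_const, Ewe;
          auto using cont01_conj, cont01_plus, cont01_mult, cont01_const.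
        fold (N M). unfold a. rewrite Cmod2_conj. ring.
      + intros x _. simpl. fold a. fold (e x).
        assert (Ee : (e x * Cconj (e x) = 1)%C).
        { unfold e. rewrite expn_conj, <- expn_plus, Z.add_opp_diag_r. apply expn_0. }
        rewrite Cplus_conj, !Cmult_conj, Copp_conj, Cconj_conj.
        transitivity (w M x * Cconj (w M x) + (- Cconj a * (w M x * Cconj (e x)) +
          (- a * (Cconj (w M x) * e x) + a * Cconj a * (e x * Cconj (e x)))))%C; [ring|].
        rewrite Ee. ring. }
  destruct (Rle_lt_or_eq_dec _ _ HK0) as [Hpos|]; [exfalso|easy].
  destruct (INR_archimed (K ^ 2) (Re (N O))) as [M HM]; [nra|].
  assert (P := Re_CInt_norm_ge_0 _ (Cw M)). fold (N M) in P.
  specialize (HN M). lra.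
Qed.

(** * Completeness of the Fourier system *)

Definition slope (f : R -> C) (l : C) (c x : R) : C :=
  if Req_EM_T x c then l else (/ (x - c) * (f x - f c))%C.

Lemma real_slope_cont (f : R -> R) l c : is_derive f c l ->
  continuous (fun x => if Req_EM_T x c then l else / (x - c) * (f x - f c)) c.
Proof.
  intro H. apply is_derive_Reals in H. apply filterlim_locally. intro eps.
  destruct (H eps (cond_pos eps)) as [d Hd]. exists d. intros y Hy.
  destruct (Req_EM_T c c) as [_|n]; [|now elim n].
  destruct (Req_EM_T y c) as [E|E]; [apply ball_center|].
  change (Rabs (y - c) < d) in Hy.
  change (Rabs (/ (y - c) * (f y - f c) - l) < eps).
  assert (Hne : y - c <> 0) by lra.
  specialize (Hd (y - c) Hne Hy). replace (c + (y - c)) with y in Hd by (symmetry; apply Rplus_minus).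
  unfold Rdiv in Hd. now rewrite Rmult_comm.
Qed.

Lemma continuous_Rinv_shift c x : x <> c -> continuous (fun y : R => / (y - c)) x.
Proof.
  intro H. apply (ex_derive_continuous (V := R_NormedModule)). auto_derive. lra.
Qed.

Lemma ccont_slope f f' c x : (forall y, cder f y (f' y)) ->
  @ccont R_UniformSpace (slope f (f' c) c) x.
Proof.
  intro H. destruct (Req_EM_T x c) as [->|Hx].
  - destruct (H c) as [H1 H2]. apply ccont_intro.
    + eapply continuous_ext; [|apply (real_slope_cont _ _ _ H1)]. intro y. cbv beta. unfold slope.
      destruct (Req_EM_T y c); [reflexivity|].
      rewrite <- RtoC_minus, <- RtoC_inv, re_scal_l by lra.
      unfold Cminus. now rewrite re_plus, re_opp.
    + eapply continuous_ext; [|apply (real_slope_cont _ _ _ H2)]. intro y. cbv beta. unfold slope.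
      destruct (Req_EM_T y c); [reflexivity|].
      rewrite <- RtoC_minus, <- RtoC_inv, im_scal_l by lra.
      unfold Cminus. now rewrite im_plus, im_opp.
  - assert (L : @locally R_UniformSpace x (fun y => y <> c)).
    { assert (P : 0 < Rabs (x - c)) by (apply Rabs_pos_lt; lra).
      exists (mkposreal _ P). intros y Hy E. subst y.
      change (Rabs (c - x) < Rabs (x - c)) in Hy. rewrite Rabs_minus_sym in Hy. lra. }
    apply (continuous_ext_loc (T := R_UniformSpace) (U := C_UniformSpace) _ (fun y : R => (RtoC (/ (y - c)) * (f y + - f c))%C)).
    + refine (filter_imp _ _ _ L). intros y Hy. unfold slope.
      destruct (Req_EM_T y c); [easy|]. rewrite RtoC_inv, RtoC_minus by lra. reflexivity.
    + apply ccont_mult.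
      * apply ccont_intro; simpl; [now apply continuous_Rinv_shift | apply continuous_const].
      * apply ccont_plus; [eapply cder_ccont, H | apply ccont_const].
Qed.

Lemma slope_mult f l c x : (RtoC (x - c) * slope f l c x = f x - f c)%C.
Proof.
  unfold slope. destruct (Req_EM_T x c) as [->|H].
  - rewrite RtoC_minus. ring.
  - rewrite RtoC_minus, Cmult_assoc, Cinv_r; [ring|].
    rewrite <- RtoC_minus. intro E. apply RtoC_inj in E. lra.
Qed.

Lemma expn_1_eq_m1 x : 0 <= x <= 1 -> expn 1 x = (- (1))%C -> x = / 2.
Proof.
  intros Hx E. apply (f_equal Re) in E. unfold expn, cis in E. simpl in E.
  replace (2 * PI * 1 * x) with (2 * (PI * x)) in E by ring.
  rewrite cos_2a_cos in E.
  assert (H : cos (PI * x) = 0) by nra.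
  assert (PP := PI_RGT_0).
  destruct (Rtotal_order x (/ 2)) as [L|[L|L]]; [|exact L|].
  - assert (0 < cos (PI * x)); [|lra]. apply cos_gt_0; nra.
  - assert (cos (PI * x) < 0); [|lra]. apply cos_lt_0; nra.
Qed.

(** Chernoff's argument: since [expn 1] takes the value [-1] on the unit
    interval only at [1/2], and with nonzero derivative, the quotient
    [h = (g - g (1/2)) / (expn 1 + 1)] is continuous. Comparing coefficients in
    [(expn 1 + 1) h = g - g (1/2)] shows that those of [h] have constant modulus
    on each side of the index [0], which Bessel's inequality only allows if
    they vanish; the index [0] then gives [g (1/2) = 0]. *)
Lemma fourier_zero_at_half g g' : (forall x, cder g x (g' x)) ->
  (forall m, fcoef g m = 0) -> g (/ 2) = 0.
Proof.
  intros Hg H0.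
  set (e' := fun x => (2 * PI * IZR 1 * Ci * expn 1 x)%C).
  assert (He : forall x, cder (expn 1) x (e' x)) by apply cder_expn.
  assert (Eh : expn 1 (/ 2) = (- (1))%C).
  { unfold expn. replace (2 * PI * 1 * / 2) with PI by field. apply cis_PI. }
  set (qg := slope g (g' (/ 2)) (/ 2)). set (qe := slope (expn 1) (e' (/ 2)) (/ 2)).
  assert (Nz : forall x, 0 <= x <= 1 -> qe x <> 0).
  { intros x Hx E. destruct (Req_EM_T x (/ 2)) as [->|Hn].
    - unfold qe, slope in E. destruct (Req_EM_T (/ 2) (/ 2)) as [_|n]; [|now elim n].
      unfold e' in E. revert E. repeat apply Cmult_neq_0.
      + intro E; apply RtoC_inj in E; lra.
      + intro E; apply RtoC_inj in E; now apply PI_neq0.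
      + apply C1_nz.
      + apply Ci_nz.
      + rewrite Eh. intro E. apply C1_nz. transitivity (- - (1))%C; [ring|]. rewrite E. ring.
    - apply Hn, expn_1_eq_m1; [exact Hx|].
      assert (S := slope_mult (expn 1) (e' (/ 2)) (/ 2) x). fold qe in S. rewrite E, Eh in S.
      apply Ceq_minus. rewrite <- S. ring. }
  (* The quotient of [qg] by [qe], in a form where continuity is apparent. *)
  set (h := fun x => (qg x * (Cconj (qe x) * RtoC (/ (Re (qe x * Cconj (qe x))%C))))%C).
  assert (Ch : cont01 h).
  { intros x Hx. assert (Cq : @ccont R_UniformSpace qe x) by (apply (ccont_slope (expn 1) e'); exact He).
    unfold h. apply ccont_mult; [apply (ccont_slope g g'); exact Hg|].
    apply ccont_mult; [now apply ccont_conj|].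
    apply ccont_intro; simpl; [|apply continuous_const].
    apply (continuous_comp (fun x => Re (qe x * Cconj (qe x))%C) Rinv).
    - apply (ccont_Re (fun x => (qe x * Cconj (qe x))%C)). apply ccont_mult; [|apply ccont_conj]; exact Cq.
    - apply (ex_derive_continuous (V := R_NormedModule)).
      assert (Z : Re (qe x * Cconj (qe x)) <> 0).
      { rewrite <- Cmod2_conj, re_RtoC. apply pow_nonzero. intro E. now apply Cmod_eq_0 in E; elim (Nz x Hx). }
      auto_derive. exact Z. }
  assert (Hh : forall x, 0 <= x <= 1 -> (expn 1 x * h x + h x = g x + (- g (/ 2)%R))%C).
  { intros x Hx. assert (S1 := slope_mult g (g' (/ 2)) (/ 2) x).
    assert (S2 := slope_mult (expn 1) (e' (/ 2)) (/ 2) x).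
    fold qg in S1. fold qe in S2. rewrite Eh in S2.
    assert (Z : Cmod (qe x) <> 0) by (intro E; now apply Cmod_eq_0 in E; elim (Nz x Hx)).
    assert (I : (qe x * (Cconj (qe x) * RtoC (/ Re (qe x * Cconj (qe x)))) = 1)%C).
    { rewrite Cmult_assoc, <- Cmod2_conj, re_RtoC, <- RtoC_mult, Rinv_r; [easy|].
      now apply pow_nonzero. }
    transitivity (RtoC (x - / 2)%R * qe x * h x)%C.
    - rewrite S2. ring.
    - unfold h. transitivity (RtoC (x - / 2)%R * qg x *
        (qe x * (Cconj (qe x) * RtoC (/ Re (qe x * Cconj (qe x))))))%C; [ring|].
      rewrite I, Cmult_1_r, S1. reflexivity. }
  assert (Cg : cont01 g) by (intros x _; eapply cder_ccont, Hg).
  assert (Rec : forall m, (fcoef h (m - 1) + fcoef h m = - g (/ 2)%R * (if Z.eq_dec 0 m then 1 else 0))%C).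
  { intro m. rewrite <- fcoef_expn_shift, <- fcoef_plus by
      (auto; apply cont01_mult; auto using cont01_expn).
    rewrite (fcoef_ext _ (fun x => (g x + (- g (/ 2)%R) * expn 0 x)%C)).
    - rewrite fcoef_plus, fcoef_scal, fcoef_expn, H0; auto using cont01_expn.
      + ring.
      + apply cont01_mult; [apply cont01_const | apply cont01_expn].
    - intros x Hx. rewrite expn_0, Cmult_1_r. now apply Hh. }
  assert (Opp : forall a b : C, (a + b = 0)%C -> Cmod a = Cmod b).
  { intros a b E. replace a with (- b)%C; [apply Cmod_opp|].
    transitivity ((a + b) - b)%C; [rewrite E|]; ring. }
  assert (P : forall n : nat, Cmod (fcoef h (Z.of_nat n)) = Cmod (fcoef h 0)).
  { induction n as [|n IH]; [reflexivity|]. rewrite <- IH. symmetry. apply Opp.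
    replace (Z.of_nat n) with (Z.of_nat (S n) - 1)%Z by lia. rewrite Rec.
    destruct (Z.eq_dec 0 (Z.of_nat (S n))); [lia|ring]. }
  assert (Q : forall n : nat, Cmod (fcoef h (- 1 - Z.of_nat n)) = Cmod (fcoef h (-1))).
  { induction n as [|n IH]; [reflexivity|]. rewrite <- IH. apply Opp.
    replace (-1 - Z.of_nat (S n))%Z with (-1 - Z.of_nat n - 1)%Z by lia. rewrite Rec.
    destruct (Z.eq_dec 0 (-1 - Z.of_nat n)); [lia|ring]. }
  assert (A0 : fcoef h 0 = 0).
  { apply Cmod_eq_0. apply (Bessel_lower_bound h Z.of_nat); auto using Cmod_ge_0, Req_le_sym.
    intros; lia. }
  assert (A1 : fcoef h (-1) = 0).
  { apply Cmod_eq_0. apply (Bessel_lower_bound h (fun n => (-1 - Z.of_nat n)%Z)); auto using Cmod_ge_0, Req_le_sym.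
    intros; lia. }
  assert (R0 := Rec 0%Z). simpl in R0. change (0 - 1)%Z with (-1)%Z in R0.
  rewrite A0, A1 in R0. transitivity (- (- g (/ 2)%R * 1))%C; [ring|]. rewrite <- R0. ring.
Qed.

Lemma RInt_shift_periodic (f : R -> R) a : (forall x, continuous f x) ->
  (forall x, f (x + 1) = f x) -> RInt (fun x => f (x + a)) 0 1 = RInt f 0 1.
Proof.
  intros Hf Hp.
  assert (E : forall u v, ex_RInt f u v).
  { intros u v. apply (ex_RInt_continuous (V := R_CompleteNormedModule)). auto. }
  assert (S : forall b u v, RInt (fun x => f (x + b)) u v = RInt f (u + b) (v + b)).
  { intros b u v.
    assert (Q := RInt_comp_lin (V := R_CompleteNormedModule) f 1 b u v).
    rewrite !Rmult_1_l in Q. rewrite <- Q by apply E. apply RInt_ext. intros x _.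
    change (f (x + b) = 1 * f (1 * x + b)). now rewrite !Rmult_1_l. }
  rewrite S, Rplus_0_l.
  assert (A : RInt f a (1 + a) = RInt f a 1 + RInt f 1 (1 + a)).
  { symmetry. apply (RInt_Chasles (V := R_CompleteNormedModule)); apply E. }
  assert (B : RInt f 0 1 = RInt f 0 a + RInt f a 1).
  { symmetry. apply (RInt_Chasles (V := R_CompleteNormedModule)); apply E. }
  assert (D : RInt f 1 (1 + a) = RInt f 0 a).
  { transitivity (RInt (fun x => f (x + 1)) 0 a).
    - now rewrite S, Rplus_0_l, (Rplus_comm a 1).
    - apply RInt_ext. intros; apply Hp. }
  rewrite A, B, D. apply Rplus_comm.
Qed.

Lemma CInt_shift_periodic g a : (forall x, @ccont R_UniformSpace g x) ->
  (forall x, g (x + 1) = g x) -> CInt (fun x => g (x + a)) = CInt g.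
Proof.
  intros Hg Hp. unfold CInt. f_equal.
  - apply (RInt_shift_periodic (fun x => Re (g x))); intro x.
    + apply (ccont_Re (X := R_UniformSpace)), Hg.
    + now rewrite Hp.
  - apply (RInt_shift_periodic (fun x => Im (g x))); intro x.
    + apply (ccont_Im (X := R_UniformSpace)), Hg.
    + now rewrite Hp.
Qed.

Lemma fcoef_shift g a m : (forall x, @ccont R_UniformSpace g x) ->
  (forall x, g (x + 1) = g x) -> fcoef (fun x => g (x + a)) m = (expn m a * fcoef g m)%C.
Proof.
  intros Hg Hp. unfold fcoef.
  set (G := fun x : R => (g x * expn (- m) x)%C).
  assert (CG : forall x, @ccont R_UniformSpace G x).
  { intro x. apply (ccont_mult (X := R_UniformSpace)); [apply Hg | apply cont_expn]. }
  rewrite <- (CInt_shift_periodic G a).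
  - rewrite <- CInt_scal.
    + apply CInt_ext. intros x _. unfold G. rewrite expn_shift.
      transitivity (g (x + a)%R * expn (- m) x * (expn m a * expn (- m) a))%C; [|ring].
      rewrite <- expn_plus, Z.add_opp_diag_r, expn_0. ring.
    + intros x _.
      apply (continuous_comp (U := R_UniformSpace) (V := R_UniformSpace) (fun x => x + a) G).
      * apply continuous_Rplus; [apply continuous_id | apply continuous_const].
      * apply CG.
  - exact CG.
  - intro x. unfold G. rewrite Hp, expn_shift, expn_at_1. now rewrite Cmult_1_r.
Qed.

(** A translation moves the point [1/2] to any other point. *)
Lemma fourier_unique g g' : (forall x, cder g x (g' x)) -> (forall x, g (x + 1) = g x) ->
  (forall m, fcoef g m = 0) -> forall x, g x = 0.
Proof.
  intros Hg Hp H0 x. set (a := x - / 2). replace x with (/ 2 + a) by (unfold a; ring).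
  apply (fourier_zero_at_half (fun y => g (y + a)) (fun y => g' (y + a))).
  - intro y. apply (cder_ext (fun u => g (1 * u + a))). { intro u. now rewrite Rmult_1_l. }
    eapply cder_eq; [apply (cder_affine g 1 a y), Hg|]. rewrite Rmult_1_l. ring.
  - intro m. rewrite fcoef_shift, H0; auto. { ring. } intro y; eapply cder_ccont, Hg.
Qed.

(** * Fourier coefficients along horizontal lines *)

Lemma is_derive_0_const (f : R -> R) : (forall x, is_derive f x 0) -> forall x, f x = f 0.
Proof.
  intros H x. destruct (Rtotal_order x 0) as [L|[->|L]]; [|easy|].
  - apply (eq_is_derive (V := R_NormedModule)); [intros; apply H | exact L].
  - symmetry. apply (eq_is_derive (V := R_NormedModule)); [intros; apply H | exact L].
Qed.

Lemma cder_0_const f : (forall x, cder f x 0) -> forall x, f x = f 0.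
Proof.
  intros H x. apply C_eq.
  - apply (is_derive_0_const (fun u => Re (f u))). intro; apply H.
  - apply (is_derive_0_const (fun u => Im (f u))). intro; apply H.
Qed.

Lemma cder_linear_ode f l : (forall x, cder f x (l * f x)%C) ->
  forall x, f x = (cexp (l * x) * f 0)%C.
Proof.
  intros H x.
  assert (K := cder_0_const (fun u => (cexp (- l * u) * f u)%C)). cbv beta in K.
  assert (E : (cexp (- l * x) * f x = f 0)%C).
  { rewrite K.
    - replace (- l * 0)%C with (RtoC 0) by ring. rewrite cexp_0. ring.
    - intro u. eapply cder_eq.
      + apply (cder_mult (fun u => cexp (- l * u))); [|apply H].
        apply (cder_cexp (fun u => (- l * u)%C)). apply cder_scal, cder_id.
      + ring. }
  rewrite <- E, Cmult_assoc, <- cexp_plus. replace (l * x + - l * x)%C with (RtoC 0) by ring.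
  rewrite cexp_0. ring.
Qed.

Lemma psmooth_Re : psmooth (fun z => RtoC (Re z)).
Proof.
  apply (psmooth_ext (fun z => / 2 * (z + Cconj z))%C).
  - intro z. cfield.
  - apply psmooth_scal, psmooth_plus; [apply psmooth_id | apply psmooth_conj, psmooth_id].
Qed.

Lemma psmooth_Im : psmooth (fun z => RtoC (Im z)).
Proof.
  apply (psmooth_ext (fun z => - Ci / 2 * (z + (- (1)) * Cconj z))%C).
  - intro z. cfield.
  - apply psmooth_scal, psmooth_plus; [apply psmooth_id | apply psmooth_scal, psmooth_conj, psmooth_id].
Qed.

Lemma continuous_slice (phi : C -> C) (y x : R) : (forall z, @ccont C_UniformSpace phi z) ->
  @ccont R_UniformSpace (fun x => phi (x, y)) x.
Proof.
  intro H.
  apply (continuous_comp (U := R_UniformSpace) (V := C_UniformSpace) (fun x : R => (x, y) : C) phi).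
  - apply (ccont_intro (X := R_UniformSpace)); simpl; [apply continuous_id | apply continuous_const].
  - apply H.
Qed.

Lemma cont01_slice phi y : psmooth phi -> cont01 (fun x => phi (x, y)).
Proof. intros H x _. apply continuous_slice. intro; now apply psmooth_cont. Qed.

Lemma RInt_param_real (f g : R -> R -> R) y :
  (forall x y, is_derive (fun u => f u x) y (g y x)) ->
  (forall x y, continuity_2d_pt g y x) -> (forall x y, continuity_2d_pt f y x) ->
  is_derive (fun u => RInt (fun x => f u x) 0 1) y (RInt (fun x => g y x) 0 1).
Proof.
  intros Hd Hg Hf.
  assert (E : forall y x, Derive (fun u => f u x) y = g y x).
  { intros; apply is_derive_unique, Hd. }
  replace (RInt (fun x => g y x) 0 1) with (RInt (fun t => Derive (fun u => f u t) y) 0 1).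
  2: { apply RInt_ext. intros; apply E. }
  apply (is_derive_RInt_param f 0 1 y).
  - exists (mkposreal 1 Rlt_0_1). intros u _ t _. eexists; apply Hd.
  - intros t _. eapply continuity_2d_pt_ext; [|apply Hg]. intros; symmetry; apply E.
  - exists (mkposreal 1 Rlt_0_1). intros u _. apply cont01_ex_RInt. intros x _.
    assert (H := Hf x u). apply continuity_2d_pt_filterlim in H.
    apply (continuous_comp_2 (fun _ : R => u) (fun x : R => x) (fun u x => f u x)).
    + apply continuous_const.
    + apply continuous_id.
    + exact H.
Qed.

Lemma continuity_2d_swap (f : R -> R -> R) x y :
  continuity_2d_pt f x y -> continuity_2d_pt (fun u v => f v u) y x.
Proof.
  intros H eps. destruct (H eps) as [d Hd]. exists d. intros u v Hu Hv. now apply Hd.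
Qed.

Lemma continuity_2d_Re phi x y : (forall z, @ccont C_UniformSpace phi z) ->
  continuity_2d_pt (fun u v => Re (phi (u, v))) x y.
Proof.
  intro H. apply continuity_2d_pt_filterlim.
  eapply filterlim_ext; [|apply (ccont_Re phi (x, y) (H (x, y)))]. intros [p q]; reflexivity.
Qed.

Lemma continuity_2d_Im phi x y : (forall z, @ccont C_UniformSpace phi z) ->
  continuity_2d_pt (fun u v => Im (phi (u, v))) x y.
Proof.
  intro H. apply continuity_2d_pt_filterlim.
  eapply filterlim_ext; [|apply (ccont_Im phi (x, y) (H (x, y)))]. intros [p q]; reflexivity.
Qed.

Lemma cder_CInt_param G y : psmooth G ->
  cder (fun v => CInt (fun x => G (x, v))) y (CInt (fun x => pdy G (x, y))).
Proof.
  intro H. assert (HG := psmooth_pgrad _ H).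
  assert (C0 := fun z => psmooth_cont _ z H).
  assert (C1 := fun z => psmooth_cont _ z (psmooth_pdy _ H)).
  split; simpl.
  - apply (RInt_param_real (fun v x => Re (G (x, v))) (fun v x => Re (pdy G (x, v)))).
    + intros u v. apply (HG (u, v)).
    + intros. apply (continuity_2d_swap (fun u v => Re (pdy G (u, v)))). now apply continuity_2d_Re.
    + intros. apply (continuity_2d_swap (fun u v => Re (G (u, v)))). now apply continuity_2d_Re.
  - apply (RInt_param_real (fun v x => Im (G (x, v))) (fun v x => Im (pdy G (x, v)))).
    + intros u v. apply (HG (u, v)).
    + intros. apply (continuity_2d_swap (fun u v => Im (pdy G (u, v)))). now apply continuity_2d_Im.
    + intros. apply (continuity_2d_swap (fun u v => Im (G (u, v)))). now apply continuity_2d_Im.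
Qed.

Definition coef (phi : C -> C) (m : Z) (y : R) : C := fcoef (fun x => phi (x, y)) m.

Definition xperiodic (phi : C -> C) : Prop := forall x y, phi (x + 1, y) = phi (x, y).

Lemma coef_dy phi m y : psmooth phi -> cder (coef phi m) y (coef (pdy phi) m y).
Proof.
  intro H. assert (HG := psmooth_pgrad _ H).
  assert (Pe : forall n, psmooth (fun z : C => expn n (Re z))).
  { intro n. apply (psmooth_ext (fun z => cexp (2 * PI * IZR n * Ci * RtoC (Re z)))).
    - intro z. unfold expn. rewrite cis_cexp. f_equal. cring.
    - apply psmooth_cexp, psmooth_scal, psmooth_Re. }
  assert (HP := psmooth_mult _ _ H (Pe (- m)%Z)).
  assert (K := cder_CInt_param _ y HP).
  eapply cder_eq; [exact K|]. unfold coef, fcoef. apply CInt_ext. intros x _.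
  transitivity (pdy phi (x, y) * expn (- m) x + phi (x, y) * 0)%C; [|ring].
  apply cder_CDerive. simpl.
  apply (cder_mult (fun s => phi (x, s)) (fun _ => expn (- m) x) y).
  - apply (HG (x, y)).
  - apply cder_const.
Qed.

Lemma coef_dx phi m y : psmooth phi -> xperiodic phi ->
  coef (pdx phi) m y = (2 * PI * IZR m * Ci * coef phi m y)%C.
Proof.
  intros H Hp. apply fcoef_deriv.
  - intro x. apply (psmooth_pgrad _ H (x, y)).
  - now apply cont01_slice, psmooth_pdx.
  - replace 1 with (0 + 1) by ring. apply Hp.
Qed.

Lemma coef_scal c phi m y : psmooth phi ->
  coef (fun z => (c * phi z)%C) m y = (c * coef phi m y)%C.
Proof. intro H. apply (fcoef_scal c (fun x => phi (x, y))). now apply cont01_slice. Qed.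

Lemma coef_plus f g m y : psmooth f -> psmooth g ->
  coef (fun z => (f z + g z)%C) m y = (coef f m y + coef g m y)%C.
Proof.
  intros Hf Hg. apply (fcoef_plus (fun x => f (x, y)) (fun x => g (x, y))); now apply cont01_slice.
Qed.

Lemma coef_unique phi y : psmooth phi -> xperiodic phi ->
  (forall m, coef phi m y = 0) -> forall x, phi (x, y) = 0.
Proof.
  intros H Hp H0. apply (fourier_unique (fun x => phi (x, y)) (fun x => pdx phi (x, y))).
  - intro x. apply (psmooth_pgrad _ H (x, y)).
  - intro x. apply Hp.
  - exact H0.
Qed.

(** The Cauchy-Riemann equation becomes a linear differential equation for each
    coefficient. *)
Lemma coef_holomorphic h m y : psmooth h -> xperiodic h ->
  (forall z, pdy h z = Ci * pdx h z)%C ->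
  coef h m y = (cexp (- (2 * PI * IZR m) * y) * coef h m 0)%C.
Proof.
  intros H Hp Hh. apply cder_linear_ode. intro v. eapply cder_eq; [now apply coef_dy|].
  transitivity (Ci * coef (pdx h) m v)%C.
  - rewrite <- coef_scal by now apply psmooth_pdx. apply fcoef_ext. intros; apply Hh.
  - rewrite coef_dx by assumption. cring.
Qed.

(** * Creation and annihilation operators *)

(** The vector field Z and its conjugate, acting on functions of the form
    [phi z * cis (v * t)]. *)
Definition Dz (v : R) (phi : C -> C) (z : C) : C :=
  (1 / 2 * (pdx phi z - Ci * pdy phi z) - v * Cconj z * phi z)%C.
Definition Db (v : R) (phi : C -> C) (z : C) : C :=
  (1 / 2 * (pdx phi z + Ci * pdy phi z) + v * z * phi z)%C.

Lemma pgrad_ext f g fx fy : (forall z, f z = g z) -> pgrad f fx fy -> pgrad g fx fy.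
Proof. intro E. replace g with f; auto. now extensionality z. Qed.

Lemma pgrad_eq f fx fy gx gy : (forall z, fx z = gx z) -> (forall z, fy z = gy z) ->
  pgrad f fx fy -> pgrad f gx gy.
Proof. intros E1 E2 H z. rewrite <- E1, <- E2. apply H. Qed.

Lemma pgrad_unique f fx fy gx gy : pgrad f fx fy -> pgrad f gx gy ->
  forall z, fx z = gx z /\ fy z = gy z.
Proof.
  intros H1 H2 z. split; eapply cder_unique; first [apply H1 | apply H2].
Qed.

Lemma pgrad_scal c f fx fy : pgrad f fx fy ->
  pgrad (fun z => (c * f z)%C) (fun z => (c * fx z)%C) (fun z => (c * fy z)%C).
Proof.
  intro H. eapply pgrad_eq. 3: apply (pgrad_mult (fun _ => c)); [apply pgrad_const | exact H].
  all: intro z; simpl; ring.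
Qed.

Lemma pgrad_Re : pgrad (fun z => RtoC (Re z)) (fun _ => RtoC 1) (fun _ => RtoC 0).
Proof. intros [x y]. split; simpl; [apply cder_id | apply cder_const]. Qed.

Lemma pgrad_Im : pgrad (fun z => RtoC (Im z)) (fun _ => RtoC 0) (fun _ => RtoC 1).
Proof. intros [x y]. split; simpl; [apply cder_const | apply cder_id]. Qed.

Lemma psmooth_Dz v phi : psmooth phi -> psmooth (Dz v phi).
Proof.
  intro H. apply (psmooth_ext (fun z => (1 / 2) * (pdx phi z + (- Ci) * pdy phi z)
    + (- v) * (Cconj z * phi z))%C).
  - intro z. unfold Dz. ring.
  - apply psmooth_plus; apply psmooth_scal.
    + apply psmooth_plus; [|apply psmooth_scal]; [now apply psmooth_pdx | now apply psmooth_pdy].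
    + apply psmooth_mult; [apply psmooth_conj, psmooth_id | exact H].
Qed.

Lemma psmooth_Db v phi : psmooth phi -> psmooth (Db v phi).
Proof.
  intro H. apply (psmooth_ext (fun z => (1 / 2) * (pdx phi z + Ci * pdy phi z)
    + v * (z * phi z))%C).
  - intro z. unfold Db. ring.
  - apply psmooth_plus; apply psmooth_scal.
    + apply psmooth_plus; [|apply psmooth_scal]; [now apply psmooth_pdx | now apply psmooth_pdy].
    + apply psmooth_mult; [apply psmooth_id | exact H].
Qed.

Lemma pgrad_Dz v phi : psmooth phi -> pgrad (Dz v phi)
  (fun z => 1 / 2 * (pdx (pdx phi) z - Ci * pdx (pdy phi) z)
            - v * (phi z + Cconj z * pdx phi z))%C
  (fun z => 1 / 2 * (pdy (pdx phi) z - Ci * pdy (pdy phi) z)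
            - v * (- Ci * phi z + Cconj z * pdy phi z))%C.
Proof.
  intro H. assert (G := psmooth_pgrad _ H).
  assert (Gx := psmooth_pgrad _ (psmooth_pdx _ H)).
  assert (Gy := psmooth_pgrad _ (psmooth_pdy _ H)).
  apply (pgrad_ext (fun z => (1 / 2) * (pdx phi z + (- Ci) * pdy phi z)
    + (- v) * (Cconj z * phi z))%C).
  { intro z. unfold Dz. ring. }
  eapply pgrad_eq.
  3: { apply pgrad_plus; apply pgrad_scal.
       - apply pgrad_plus; [exact Gx | apply pgrad_scal, Gy].
       - apply pgrad_mult; [apply pgrad_conj, pgrad_id | exact G]. }
  all: intro z; cring.
Qed.

Lemma pgrad_Db v phi : psmooth phi -> pgrad (Db v phi)
  (fun z => 1 / 2 * (pdx (pdx phi) z + Ci * pdx (pdy phi) z)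
            + v * (phi z + z * pdx phi z))%C
  (fun z => 1 / 2 * (pdy (pdx phi) z + Ci * pdy (pdy phi) z)
            + v * (Ci * phi z + z * pdy phi z))%C.
Proof.
  intro H. assert (G := psmooth_pgrad _ H).
  assert (Gx := psmooth_pgrad _ (psmooth_pdx _ H)).
  assert (Gy := psmooth_pgrad _ (psmooth_pdy _ H)).
  apply (pgrad_ext (fun z => (1 / 2) * (pdx phi z + Ci * pdy phi z)
    + v * (z * phi z))%C).
  { intro z. unfold Db. ring. }
  eapply pgrad_eq.
  3: { apply pgrad_plus; apply pgrad_scal.
       - apply pgrad_plus; [exact Gx | apply pgrad_scal, Gy].
       - apply pgrad_mult; [apply pgrad_id | exact G]. }
  all: intro z; cring.
Qed.

Lemma commutator v phi z : psmooth phi ->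
  (Dz v (Db v phi) z = Db v (Dz v phi) z + 2 * v * phi z)%C.
Proof.
  intro H.
  assert (UD : forall f, Dz v f z = (1 / 2 * (pdx f z - Ci * pdy f z) - v * Cconj z * f z)%C)
    by reflexivity.
  assert (UB : forall f, Db v f z = (1 / 2 * (pdx f z + Ci * pdy f z) + v * z * f z)%C)
    by reflexivity.
  rewrite (UD (Db v phi)), (UB (Dz v phi)).
  rewrite_pgrad (pgrad_Db v phi H).
  rewrite_pgrad (pgrad_Dz v phi H).
  rewrite UD, UB, (pdx_pdy phi z H). cfield.
Qed.

Lemma pgrad_comb a b f g : psmooth f -> psmooth g ->
  pgrad (fun z => a * f z + b * g z)%C (fun z => a * pdx f z + b * pdx g z)%C
    (fun z => a * pdy f z + b * pdy g z)%C.
Proof.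
  intros Hf Hg. apply pgrad_plus; apply pgrad_scal; now apply psmooth_pgrad.
Qed.

Lemma psmooth_comb a b f g : psmooth f -> psmooth g ->
  psmooth (fun z => a * f z + b * g z)%C.
Proof. intros Hf Hg. apply psmooth_plus; now apply psmooth_scal. Qed.

Lemma Dz_zero v z : Dz v (fun _ => RtoC 0) z = 0.
Proof. unfold Dz. rewrite_pgrad (pgrad_const 0). ring. Qed.

Lemma Db_zero v z : Db v (fun _ => RtoC 0) z = 0.
Proof. unfold Db. rewrite_pgrad (pgrad_const 0). ring. Qed.

Lemma Dz_comb v a b f g z : psmooth f -> psmooth g ->
  Dz v (fun z => a * f z + b * g z)%C z = (a * Dz v f z + b * Dz v g z)%C.
Proof.
  intros Hf Hg. assert (G := pgrad_comb a b f g Hf Hg).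
  unfold Dz. rewrite_pgrad G. ring.
Qed.

Lemma Db_comb v a b f g z : psmooth f -> psmooth g ->
  Db v (fun z => a * f z + b * g z)%C z = (a * Db v f z + b * Db v g z)%C.
Proof.
  intros Hf Hg. assert (G := pgrad_comb a b f g Hf Hg).
  unfold Db. rewrite_pgrad G. ring.
Qed.

Lemma Dz_scal v a f z : psmooth f -> Dz v (fun z => a * f z)%C z = (a * Dz v f z)%C.
Proof.
  intro Hf. assert (G := pgrad_scal a _ _ _ (psmooth_pgrad _ Hf)).
  unfold Dz. rewrite_pgrad G. ring.
Qed.

Lemma Db_scal v a f z : psmooth f -> Db v (fun z => a * f z)%C z = (a * Db v f z)%C.
Proof.
  intro Hf. assert (G := pgrad_scal a _ _ _ (psmooth_pgrad _ Hf)).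
  unfold Db. rewrite_pgrad G. ring.
Qed.

Lemma Db_mult u v f g z : psmooth f -> psmooth g ->
  Db (u + v) (fun z => f z * g z)%C z = (Db u f z * g z + f z * Db v g z)%C.
Proof.
  intros Hf Hg. assert (G := pgrad_mult _ _ _ _ _ _ (psmooth_pgrad _ Hf) (psmooth_pgrad _ Hg)).
  unfold Db. rewrite_pgrad G; rewrite RtoC_plus. ring.
Qed.

(** Conjugation makes a section of degree [- d] out of a function of degree [d]
    killed by [Dz]. *)
Lemma Db_conj v f z : psmooth f -> Db (- v) (fun z => Cconj (f z)) z = Cconj (Dz v f z).
Proof.
  intro Hf. assert (G := pgrad_conj _ _ _ (psmooth_pgrad _ Hf)).
  unfold Dz, Db. rewrite_pgrad G. cfield.
Qed.

(** For [e = 0] this says that [phi z * cis (v * t)] is invariant under left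
    translation by [(w, 0)]. The phase [e] leaves room for a sign. *)
Definition translates (v e : R) (w : C) (phi : C -> C) : Prop :=
  forall z, phi (z + w)%C = (cis (e - 2 * v * Im (w * Cconj z)) * phi z)%C.

Lemma pgrad_translate phi w : psmooth phi ->
  pgrad (fun z => phi (z + w)%C) (fun z => pdx phi (z + w)%C) (fun z => pdy phi (z + w)%C).
Proof.
  intro H.
  assert (E : forall z, affine 1 0 0 1 (Re w) (Im w) z = (z + w)%C).
  { intro z. unfold affine. cring. }
  apply (pgrad_ext (fun z => phi (affine 1 0 0 1 (Re w) (Im w) z))).
  { intro z. now rewrite E. }
  eapply pgrad_eq; [| |apply pgrad_affine, H]; intro z; cbv beta; rewrite E; ring.
Qed.

Lemma pgrad_phase v e w :
  pgrad (fun z => cis (e - 2 * v * Im (w * Cconj z)))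
    (fun z => (- (2 * v * Im w) * Ci) * cis (e - 2 * v * Im (w * Cconj z)))%C
    (fun z => (2 * v * Re w * Ci) * cis (e - 2 * v * Im (w * Cconj z)))%C.
Proof.
  assert (E : forall z, cexp (e * Ci + ((- (2 * v * Im w) * Ci) * RtoC (Re z)
      + (2 * v * Re w * Ci) * RtoC (Im z)))%C = cis (e - 2 * v * Im (w * Cconj z))).
  { intro z. rewrite cis_cexp. f_equal. cring. }
  apply (pgrad_ext _ _ _ _ E).
  eapply pgrad_eq.
  3: { apply pgrad_cexp, pgrad_plus; [apply pgrad_const|].
       apply pgrad_plus; apply pgrad_scal; [apply pgrad_Re | apply pgrad_Im]. }
  all: intro z; cbv beta; rewrite E; ring.
Qed.

Lemma translates_grad v e w phi z : psmooth phi -> translates v e w phi ->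
  pdx phi (z + w)%C = (cis (e - 2 * v * Im (w * Cconj z))
                       * (pdx phi z - 2 * v * Im w * Ci * phi z))%C /\
  pdy phi (z + w)%C = (cis (e - 2 * v * Im (w * Cconj z))
                       * (pdy phi z + 2 * v * Re w * Ci * phi z))%C.
Proof.
  intros H T. assert (A := pgrad_translate phi w H).
  apply (pgrad_ext _ _ _ _ T) in A.
  assert (B := pgrad_mult _ _ _ _ _ _ (pgrad_phase v e w) (psmooth_pgrad _ H)).
  destruct (pgrad_unique _ _ _ _ _ A B z) as [E1 E2]. rewrite E1, E2. split; ring.
Qed.

(** Z and its conjugate are left invariant, so they commute with translations. *)
Lemma translates_Dz v e w phi : psmooth phi -> translates v e w phi ->
  translates v e w (Dz v phi).
Proof.
  intros H T z. unfold Dz. destruct (translates_grad v e w phi z H T) as [E1 E2].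
  rewrite E1, E2, T, Cplus_conj. generalize (cis (e - 2 * v * Im (w * Cconj z))). intro k.
  cfield.
Qed.

Lemma translates_Db v e w phi : psmooth phi -> translates v e w phi ->
  translates v e w (Db v phi).
Proof.
  intros H T z. unfold Db. destruct (translates_grad v e w phi z H T) as [E1 E2].
  rewrite E1, E2, T. generalize (cis (e - 2 * v * Im (w * Cconj z))). intro k.
  cfield.
Qed.

Lemma translates_mult u v d e w f g : translates u d w f -> translates v e w g ->
  translates (u + v) (d + e) w (fun z => f z * g z)%C.
Proof.
  intros Hf Hg z. rewrite Hf, Hg.
  replace (d + e - 2 * (u + v) * Im (w * Cconj z)) with
    ((d - 2 * u * Im (w * Cconj z)) + (e - 2 * v * Im (w * Cconj z))) by ring.
  rewrite cis_plus. ring.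
Qed.

Lemma translates_conj v e w f : translates v e w f ->
  translates (- v) (- e) w (fun z => Cconj (f z)).
Proof. intros H z. rewrite H, Cmult_conj, cis_conj. do 2 f_equal. ring. Qed.

Lemma translates_comb v e w a b f g : translates v e w f -> translates v e w g ->
  translates v e w (fun z => a * f z + b * g z)%C.
Proof. intros Hf Hg z. rewrite Hf, Hg. ring. Qed.

Lemma translates_scal v e w a f : translates v e w f -> translates v e w (fun z => a * f z)%C.
Proof. intros Hf z. rewrite Hf. ring. Qed.

(** * The rotation of order six *)

Lemma sqrt3_sq : sqrt 3 * sqrt 3 = 3.
Proof. apply sqrt_sqrt. lra. Qed.

Lemma sqrt3_pos : 0 < sqrt 3.
Proof. apply sqrt_lt_R0. lra. Qed.

Lemma eta_val : eta = (1 / 2, sqrt 3 / 2).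
Proof. unfold eta. now rewrite cos_PI3, sin_PI3. Qed.

Lemma eta_cis : eta = cis (PI / 3).
Proof. reflexivity. Qed.

Lemma eta_neq_0 : eta <> 0.
Proof. rewrite eta_cis. apply cis_neq_0. Qed.

Lemma pgrad_rotate phi : psmooth phi ->
  pgrad (fun z => phi (eta * z)%C)
    (fun z => 1 / 2 * pdx phi (eta * z) + (sqrt 3 / 2)%R * pdy phi (eta * z))%C
    (fun z => (- (sqrt 3 / 2))%R * pdx phi (eta * z) + 1 / 2 * pdy phi (eta * z))%C.
Proof.
  intro H.
  assert (E : forall z, affine (1 / 2) (- (sqrt 3 / 2)) (sqrt 3 / 2) (1 / 2) 0 0 z = (eta * z)%C).
  { intro z. unfold affine. rewrite eta_val. cring. }
  apply (pgrad_ext (fun z => phi (affine (1 / 2) (- (sqrt 3 / 2)) (sqrt 3 / 2) (1 / 2) 0 0 z))).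
  { intro z. now rewrite E. }
  eapply pgrad_eq; [| |apply pgrad_affine, H]; intro z; cbv beta; rewrite E; cfield.
Qed.

Lemma psmooth_rotate phi : psmooth phi -> psmooth (fun z => phi (eta * z)%C).
Proof.
  intro H.
  apply (psmooth_ext (fun z => phi (affine (1 / 2) (- (sqrt 3 / 2)) (sqrt 3 / 2) (1 / 2) 0 0 z))).
  - intro z. f_equal. unfold affine. rewrite eta_val. cring.
  - now apply psmooth_affine.
Qed.

Lemma Dz_rotate v phi z : psmooth phi ->
  Dz v (fun z => phi (eta * z)%C) z = (eta * Dz v phi (eta * z))%C.
Proof.
  intro H. assert (G := pgrad_rotate phi H). unfold Dz.
  rewrite_pgrad G.
  generalize (pdx phi (eta * z)) (pdy phi (eta * z)) (phi (eta * z)%C). intros a b c.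
  rewrite Cmult_conj. transitivity (1 / 2 * (eta * (a - Ci * b)) - v * (eta * Cconj eta) * Cconj z * c)%C.
  2: ring.
  replace (eta * Cconj eta)%C with (RtoC 1).
  - rewrite eta_val. cfield.
  - rewrite <- Cmod2_conj, eta_cis, Cmod_cis. f_equal; ring.
Qed.

Lemma Db_rotate v phi z : psmooth phi ->
  (eta * Db v (fun z => phi (eta * z)%C) z)%C = Db v phi (eta * z).
Proof.
  intro H. assert (G := pgrad_rotate phi H). unfold Db.
  rewrite_pgrad G.
  generalize (pdx phi (eta * z)) (pdy phi (eta * z)) (phi (eta * z)%C). intros a b c.
  transitivity (1 / 2 * (eta * Cconj eta) * (a + Ci * b) + v * (eta * z) * c)%C.
  - rewrite eta_val. cfield.
  - replace (eta * Cconj eta)%C with (RtoC 1); [ring|].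
    rewrite <- Cmod2_conj, eta_cis, Cmod_cis. f_equal; ring.
Qed.

Definition rotates (c : C) (phi : C -> C) : Prop :=
  forall z, phi (eta * z)%C = (c * phi z)%C.

Lemma rotates_Dz v c phi : psmooth phi -> rotates c phi -> rotates (c / eta) (Dz v phi).
Proof.
  intros H T z. apply (Cmult_cancel eta _ _ eta_neq_0).
  rewrite <- Dz_rotate by exact H.
  replace (fun z => phi (eta * z)%C) with (fun z => c * phi z)%C
    by (extensionality u; now rewrite T).
  rewrite Dz_scal by exact H. field. apply eta_neq_0.
Qed.

Lemma rotates_Db v c phi : psmooth phi -> rotates c phi -> rotates (c * eta) (Db v phi).
Proof.
  intros H T z. rewrite <- Db_rotate by exact H.
  replace (fun z => phi (eta * z)%C) with (fun z => c * phi z)%C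
    by (extensionality u; now rewrite T).
  rewrite Db_scal by exact H. ring.
Qed.

Lemma rotates_mult b c f g : rotates b f -> rotates c g -> rotates (b * c) (fun z => f z * g z)%C.
Proof. intros Hf Hg z. rewrite Hf, Hg. ring. Qed.

Lemma rotates_comb c a b f g : rotates c f -> rotates c g ->
  rotates c (fun z => a * f z + b * g z)%C.
Proof. intros Hf Hg z. rewrite Hf, Hg. ring. Qed.

Lemma rotates_scal c a f : rotates c f -> rotates c (fun z => a * f z)%C.
Proof. intros Hf z. rewrite Hf. ring. Qed.

(** * Quasi-periodic functions of degree d *)

(** The values for which the translations by 1 and [eta] with the phases of [quasi]
    commute. The sign [(-1)^d] in those phases is that of sigma^d. *)
Definition nu (d : Z) : R := IZR d * PI / sqrt 3.

Definition quasi (d : Z) (phi : C -> C) : Prop :=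
  translates (nu d) (PI * IZR d) 1 phi /\ translates (nu d) (PI * IZR d) eta phi.

Lemma nu_plus d e : nu (d + e) = nu d + nu e.
Proof. unfold nu. rewrite plus_IZR. field. generalize sqrt3_pos; lra. Qed.

Lemma nu_opp d : nu (- d) = - nu d.
Proof. unfold nu. rewrite opp_IZR. field. generalize sqrt3_pos; lra. Qed.

(* The area of the fundamental domain is sqrt 3 / 2. *)
Lemma nu_area d : 2 * nu d * (sqrt 3 / 2) = PI * IZR d.
Proof. unfold nu. field. generalize sqrt3_pos; lra. Qed.

Lemma quasi_mult d e f g : quasi d f -> quasi e g -> quasi (d + e) (fun z => f z * g z)%C.
Proof.
  intros [H1 H2] [H3 H4].
  split; rewrite nu_plus, plus_IZR, Rmult_plus_distr_l; now apply translates_mult.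
Qed.

Lemma quasi_comb d a b f g : quasi d f -> quasi d g -> quasi d (fun z => a * f z + b * g z)%C.
Proof. intros [H1 H2] [H3 H4]. split; now apply translates_comb. Qed.

Lemma quasi_scal d a f : quasi d f -> quasi d (fun z => a * f z)%C.
Proof. intros [H1 H2]. split; now apply translates_scal. Qed.

Lemma quasi_conj d f : quasi d f -> quasi (- d) (fun z => Cconj (f z)).
Proof.
  intros [H1 H2]. split; rewrite nu_opp, opp_IZR, Ropp_mult_distr_r_reverse;
    now apply translates_conj.
Qed.

Lemma quasi_Dz d f : psmooth f -> quasi d f -> quasi d (Dz (nu d) f).
Proof. intros H [H1 H2]. split; now apply translates_Dz. Qed.

Lemma quasi_Db d f : psmooth f -> quasi d f -> quasi d (Db (nu d) f).
Proof. intros H [H1 H2]. split; now apply translates_Db. Qed.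

(** The rotation maps the generators 1 and [eta] of the lattice to [eta] and
    [eta - 1]. The phase picked up along [eta - 1] is the right one because of
    [nu_area]. *)
Lemma quasi_rotate d f : quasi d f -> quasi d (fun z => f (eta * z)%C).
Proof.
  intros [H1 H2].
  set (v := nu d) in *. set (e := PI * IZR d) in *.
  assert (A : 2 * v * (sqrt 3 / 2) = e) by apply nu_area.
  assert (S := sqrt3_sq).
  split; intro z; fold v e.
  - replace (eta * (z + 1))%C with (eta * z + eta)%C by ring. rewrite H2.
    replace (Im (eta * Cconj (eta * z))) with (Im (1 * Cconj z)); [reflexivity|].
    rewrite eta_val. unfold Re, Im; simpl. field [S].
  - set (u := (eta * z)%C).
    assert (E : (eta * (z + eta) = (u - 1) + eta)%C).
    { unfold u. rewrite eta_val. apply C_eq; unfold Re, Im; simpl; field [S]. }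
    assert (B : f u = (cis (e - 2 * v * Im (1 * Cconj (u - 1))) * f (u - 1))%C).
    { rewrite <- H1. f_equal. ring. }
    rewrite E, H2, B, Cmult_assoc, <- cis_plus. do 2 f_equal.
    replace (e - 2 * v * Im (eta * Cconj z) + (e - 2 * v * Im (1 * Cconj (u - 1)))) with
      (e - 2 * v * Im (eta * Cconj (u - 1)) +
       (e + 2 * v * (Im (eta * Cconj (u - 1)) - Im (eta * Cconj z) - Im (1 * Cconj (u - 1))))) by ring.
    replace (Im (eta * Cconj (u - 1)) - Im (eta * Cconj z) - Im (1 * Cconj (u - 1)))
      with (- (sqrt 3 / 2)).
    + lra.
    + unfold u. rewrite eta_val. unfold Re, Im; simpl. field [S].
Qed.

(** ** The associated holomorphic function *)

(** The exponent is chosen so that the Gaussian factor turns [Db] into the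
    Cauchy-Riemann operator and makes the function periodic in direction 1. *)
Definition gauge (d : Z) (z : C) : C :=
  (nu d * (z * Cconj z) + ((- nu d) * (z * z) + (- (PI * IZR d) * Ci) * z))%C.

Definition holo (d : Z) (phi : C -> C) (z : C) : C := (cexp (gauge d z) * phi z)%C.

Lemma psmooth_gauge d : psmooth (gauge d).
Proof.
  unfold gauge. repeat apply psmooth_plus; apply psmooth_scal;
    repeat apply psmooth_mult; try apply psmooth_conj; apply psmooth_id.
Qed.

Lemma pgrad_gauge d : pgrad (gauge d)
  (fun z => nu d * (Cconj z - z) - PI * IZR d * Ci)%C
  (fun z => nu d * (Ci * Cconj z - 3 * Ci * z) + PI * IZR d)%C.
Proof.
  unfold gauge. eapply pgrad_eq.
  3: { apply pgrad_plus; [|apply pgrad_plus]; apply pgrad_scal.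
       - apply pgrad_mult; [apply pgrad_id | apply pgrad_conj, pgrad_id].
       - apply pgrad_mult; apply pgrad_id.
       - apply pgrad_id. }
  all: intro z; cring.
Qed.

Lemma psmooth_holo d phi : psmooth phi -> psmooth (holo d phi).
Proof. intro H. apply psmooth_mult; [apply psmooth_cexp, psmooth_gauge | exact H]. Qed.

Lemma holo_CR d phi z : psmooth phi ->
  (pdy (holo d phi) z - Ci * pdx (holo d phi) z =
   - 2 * Ci * (cexp (gauge d z) * Db (nu d) phi z))%C.
Proof.
  intro H.
  assert (G := pgrad_mult _ _ _ _ _ _ (pgrad_cexp _ _ _ (pgrad_gauge d)) (psmooth_pgrad _ H)).
  unfold holo. rewrite_pgrad G. unfold Db.
  generalize (cexp (gauge d z)). intro k. cfield.
Qed.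

Lemma holo_period d phi : quasi d phi -> xperiodic (holo d phi).
Proof.
  intros [H1 _] x y.
  replace ((x + 1, y) : C) with ((x, y) + 1)%C by cring.
  unfold holo. rewrite H1, Cmult_assoc, cis_cexp, <- cexp_plus. do 2 f_equal.
  unfold gauge. cring.
Qed.

Lemma holo_eta d phi z : quasi d phi ->
  holo d phi (z + eta)%C =
  (cis (PI * IZR d) * cexp (- (2 * PI * IZR d) * Ci * (z + eta)) * holo d phi z)%C.
Proof.
  intros [_ H2].
  assert (A : PI * IZR d = nu d * sqrt 3) by (rewrite <- nu_area; field).
  assert (S := sqrt3_sq).
  unfold holo. rewrite H2, !Cmult_assoc, !cis_cexp, <- !cexp_plus. do 2 f_equal.
  unfold gauge. rewrite eta_val. apply C_eq; unfold Re, Im; simpl; field [S A].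
Qed.

Definition tcoef (d : Z) (phi : C -> C) (m : Z) : C := coef (holo d phi) m 0.

(** Sections of a line bundle of degree [d] over the torus, in a unitary gauge. *)
Definition sect (d : Z) (phi : C -> C) : Prop :=
  psmooth phi /\ quasi d phi /\ forall z, Db (nu d) phi z = 0.

Lemma sect_holo_coef d phi m y : sect d phi ->
  coef (holo d phi) m y = (cexp (- (2 * PI * IZR m) * y) * tcoef d phi m)%C.
Proof.
  intros [H [Q B]]. apply coef_holomorphic.
  - now apply psmooth_holo.
  - now apply holo_period.
  - intro z. apply Ceq_minus. rewrite holo_CR by exact H. rewrite B. ring.
Qed.

Lemma sect_zero d phi : sect d phi -> (forall m, tcoef d phi m = 0) -> forall z, phi z = 0.
Proof.
  intros HS H0 [x y]. assert (HS' := HS). destruct HS' as [H [Q B]].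
  assert (E : holo d phi (x, y) = 0).
  { apply coef_unique; [now apply psmooth_holo | now apply holo_period |].
    intro m. rewrite (sect_holo_coef d phi m y HS), H0. ring. }
  unfold holo in E. apply Cmult_integral in E. destruct E as [E|E]; [|exact E].
  now apply cexp_neq_0 in E.
Qed.

(** Comparing the coefficients of the two sides of [holo_eta]. *)
Lemma tcoef_step d phi m : sect d phi ->
  Cmod (tcoef d phi (m + d)) =
  exp (- (PI * sqrt 3 * IZR (m + d))) * Cmod (tcoef d phi m).
Proof.
  intro HS. assert (HS' := HS). destruct HS' as [H [Q B]].
  set (h := holo d phi).
  assert (Hh : psmooth h) by now apply psmooth_holo.
  assert (Hp : xperiodic h) by now apply holo_period.
  assert (E : coef (fun z => h (z + eta)%C) m 0 =
    (cis (PI * IZR d) * cexp (- (2 * PI * IZR d) * Ci * eta) * tcoef d phi (m + d))%C).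
  { unfold coef. transitivity (fcoef (fun x => cis (PI * IZR d) * cexp (- (2 * PI * IZR d) * Ci * eta) *
      (expn (- d) x * h (x, 0%R)))%C m).
    - apply fcoef_ext. intros x _. unfold h. rewrite (holo_eta _ _ _ Q).
      rewrite !Cmult_assoc. f_equal. rewrite <- !Cmult_assoc. f_equal.
      unfold expn. rewrite cis_cexp, <- cexp_plus. f_equal. rewrite opp_IZR. cring.
    - rewrite fcoef_scal, fcoef_expn_shift.
      + now replace (m - - d)%Z with (m + d)%Z by ring.
      + apply cont01_mult; [apply cont01_expn | now apply cont01_slice]. }
  assert (F : coef (fun z => h (z + eta)%C) m 0 =
    (expn m (1 / 2) * (cexp (- (2 * PI * IZR m) * (sqrt 3 / 2)%R) * tcoef d phi m))%C).
  { rewrite <- sect_holo_coef by exact HS. unfold coef.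
    rewrite <- (fcoef_shift (fun x => h (x, sqrt 3 / 2)%R)).
    - apply fcoef_ext. intros x _. f_equal. rewrite eta_val. cring.
    - intro x. apply continuous_slice. intro; now apply psmooth_cont.
    - intro x. apply Hp. }
  rewrite E in F. apply (f_equal Cmod) in F. unfold expn in F.
  rewrite !Cmod_mult, !Cmod_cis, !Cmod_cexp, !Rmult_1_l in F.
  replace (Re (- (2 * PI * IZR d) * Ci * eta)) with (PI * sqrt 3 * IZR d) in F
    by (rewrite eta_val; simpl; field).
  replace (Re (- (2 * PI * IZR m) * (sqrt 3 / 2)%R)) with (- (PI * sqrt 3 * IZR m)) in F
    by (simpl; field).
  apply (Rmult_eq_reg_l (exp (PI * sqrt 3 * IZR d))).
  2: generalize (exp_pos (PI * sqrt 3 * IZR d)); lra.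
  rewrite F, <- Rmult_assoc, <- exp_plus. f_equal. f_equal. rewrite plus_IZR. ring.
Qed.

Lemma tcoef_step_0 d phi m : sect d phi -> tcoef d phi (m + d) = 0 <-> tcoef d phi m = 0.
Proof.
  intro HS. assert (E := tcoef_step d phi m HS).
  split; intro H0; apply Cmod_eq_0; rewrite H0, Cmod_0 in E.
  - symmetry in E. apply Rmult_integral in E. destruct E as [E|E]; [|exact E].
    generalize (exp_pos (- (PI * sqrt 3 * IZR (m + d)))); lra.
  - rewrite E. ring.
Qed.

(** By the recursion of step [d], all coefficients vanish as soon as [d]
    consecutive ones do. *)
Lemma sect_determined d phi : (0 < d)%Z -> sect d phi ->
  (forall m, (0 <= m < d)%Z -> tcoef d phi m = 0) -> forall z, phi z = 0.
Proof.
  intros Hd HS H0. apply (sect_zero d); [exact HS|]. intro m.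
  rewrite (Z.div_mod m d) by lia.
  assert (P : forall n : nat, forall r, tcoef d phi r = 0 -> tcoef d phi (d * Z.of_nat n + r) = 0).
  { induction n as [|n IH]; intros r Hr.
    - now replace (d * Z.of_nat 0 + r)%Z with r by lia.
    - replace (d * Z.of_nat (S n) + r)%Z with ((d * Z.of_nat n + r) + d)%Z by lia.
      apply (proj2 (tcoef_step_0 d phi _ HS)). auto. }
  assert (Q : forall n : nat, forall r, tcoef d phi r = 0 -> tcoef d phi (- (d * Z.of_nat n) + r) = 0).
  { induction n as [|n IH]; intros r Hr.
    - now replace (- (d * Z.of_nat 0) + r)%Z with r by lia.
    - apply (proj1 (tcoef_step_0 d phi _ HS)).
      replace (- (d * Z.of_nat (S n)) + r + d)%Z with (- (d * Z.of_nat n) + r)%Z by lia. auto. }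
  assert (R0 : tcoef d phi (m mod d) = 0) by (apply H0, Z.mod_pos_bound, Hd).
  destruct (Z_le_gt_dec 0 (m / d)) as [L|L].
  - rewrite <- (Z2Nat.id (m / d)) by exact L. auto.
  - replace (d * (m / d))%Z with (- (d * Z.of_nat (Z.to_nat (- (m / d)))))%Z by lia. auto.
Qed.

(** In negative degree the recursion makes the coefficients grow, against
    Bessel's inequality. *)
Lemma sect_negative d phi : (d < 0)%Z -> sect d phi -> forall z, phi z = 0.
Proof.
  intros Hd HS. apply (sect_zero d); [exact HS|].
  assert (Neg : forall m, (m <= 0)%Z -> tcoef d phi m = 0).
  { intros m Hm. apply Cmod_eq_0.
    assert (HS' := HS). destruct HS' as [H _].
    apply (Bessel_lower_bound (fun x => holo d phi (x, 0)) (fun n => (m + d * Z.of_nat n)%Z)).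
    - now apply cont01_slice, psmooth_holo.
    - apply Cmod_ge_0.
    - intros i j E. nia.
    - intro n. change (Cmod (tcoef d phi m) <= Cmod (tcoef d phi (m + d * Z.of_nat n))).
      induction n as [|n IH].
      + replace (m + d * Z.of_nat 0)%Z with m by lia. lra.
      + replace (m + d * Z.of_nat (S n))%Z with ((m + d * Z.of_nat n) + d)%Z by lia.
        rewrite tcoef_step by exact HS. eapply Rle_trans; [exact IH|].
        rewrite <- (Rmult_1_l (Cmod _)) at 1. apply Rmult_le_compat_r; [apply Cmod_ge_0|].
        rewrite <- exp_0. apply Rlt_le, exp_increasing.
        assert (IZR (m + d * Z.of_nat n + d) < 0) by (apply IZR_lt; nia).
        assert (0 < PI * sqrt 3) by (apply Rmult_lt_0_compat; [apply PI_RGT_0 | apply sqrt3_pos]).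
        nra. }
  intro m. destruct (Z_le_gt_dec m 0) as [L|L]; [auto|].
  assert (P : forall n : nat, tcoef d phi (m + d * Z.of_nat n) = 0 -> tcoef d phi m = 0).
  { induction n as [|n IH]; intro E.
    - now replace (m + d * Z.of_nat 0)%Z with m in E by lia.
    - apply IH. apply (proj1 (tcoef_step_0 d phi _ HS)).
      replace (m + d * Z.of_nat n + d)%Z with (m + d * Z.of_nat (S n))%Z by lia. exact E. }
  apply (P (Z.to_nat m)), Neg. rewrite Z2Nat.id by lia. nia.
Qed.

Lemma tcoef_comb d a b f g m : psmooth f -> psmooth g ->
  tcoef d (fun z => a * f z + b * g z)%C m = (a * tcoef d f m + b * tcoef d g m)%C.
Proof.
  intros Hf Hg. unfold tcoef.
  rewrite <- !coef_scal, <- coef_plus by (try apply psmooth_scal; now apply psmooth_holo).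
  apply fcoef_ext. intros x _. unfold holo. ring.
Qed.

Lemma sect_comb d a b f g : sect d f -> sect d g -> sect d (fun z => a * f z + b * g z)%C.
Proof.
  intros [H1 [H2 H3]] [H4 [H5 H6]]. split; [|split].
  - now apply psmooth_comb.
  - now apply quasi_comb.
  - intro z. rewrite Db_comb, H3, H6 by assumption. ring.
Qed.

Lemma sect_mult d e f g : sect d f -> sect e g -> sect (d + e) (fun z => f z * g z)%C.
Proof.
  intros [H1 [H2 H3]] [H4 [H5 H6]]. split; [|split].
  - now apply psmooth_mult.
  - now apply quasi_mult.
  - intro z. rewrite nu_plus, Db_mult, H3, H6 by assumption. ring.
Qed.

Lemma sect_rotate d f : sect d f -> sect d (fun z => f (eta * z)%C).
Proof.
  intros [H1 [H2 H3]]. split; [|split].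
  - now apply psmooth_rotate.
  - now apply quasi_rotate.
  - intro z. apply (Cmult_cancel eta _ _ eta_neq_0). rewrite Db_rotate, H3 by assumption. ring.
Qed.

Lemma Dz_kernel d f : (0 < d)%Z -> psmooth f -> quasi d f ->
  (forall z, Dz (nu d) f z = 0) -> forall z, f z = 0.
Proof.
  intros Hd H Q HD z.
  assert (S : sect (- d) (fun z => Cconj (f z))).
  { split; [|split].
    - now apply psmooth_conj.
    - now apply quasi_conj.
    - intro u. rewrite nu_opp, Db_conj, HD by exact H. cring. }
  assert (E := sect_negative (- d) _ ltac:(lia) S z). cbv beta in E.
  rewrite <- (Cconj_conj (f z)), E. cring.
Qed.

(** * Entire exponential series *)

Definition CSeries (a : nat -> C) : C :=
  (Series (fun n => Re (a n)), Series (fun n => Im (a n))).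

Definition summable (a : nat -> C) : Prop := ex_series (fun n => Cmod (a n)).

Lemma Im_le_Cmod (z : C) : Rabs (Im z) <= Cmod z.
Proof.
  eapply Rle_trans; [|apply Rmax_Cmod]. apply Rmax_r.
Qed.

Lemma Cmod_le_sum (z : C) : Cmod z <= Rabs (Re z) + Rabs (Im z).
Proof.
  replace z with (RtoC (Re z) + Ci * RtoC (Im z))%C at 1 by cring.
  eapply Rle_trans; [apply Cmod_triangle|]. rewrite Cmod_mult, Cmod_Ci, !Cmod_R. lra.
Qed.

Lemma summable_Re a : summable a -> ex_series (fun n => Re (a n)).
Proof.
  intro H. apply ex_series_Rabs. apply (ex_series_le (V := R_CompleteNormedModule)) with (2 := H).
  intro n. change (Rabs (Rabs (Re (a n))) <= Cmod (a n)). rewrite Rabs_Rabsolu. apply re_le_Cmod.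
Qed.

Lemma summable_Im a : summable a -> ex_series (fun n => Im (a n)).
Proof.
  intro H. apply ex_series_Rabs. apply (ex_series_le (V := R_CompleteNormedModule)) with (2 := H).
  intro n. change (Rabs (Rabs (Im (a n))) <= Cmod (a n)). rewrite Rabs_Rabsolu. apply Im_le_Cmod.
Qed.

Lemma summable_le a b : (forall n, Cmod (a n) <= b n) -> ex_series b -> summable a.
Proof.
  intros H Hb. apply (ex_series_le (V := R_CompleteNormedModule)) with (2 := Hb).
  intro n. change (Rabs (Cmod (a n)) <= b n). rewrite Rabs_pos_eq by apply Cmod_ge_0. apply H.
Qed.

Lemma CSeries_ext a b : (forall n, a n = b n) -> CSeries a = CSeries b.
Proof. intro H. replace a with b; [easy|]. now extensionality n. Qed.

Lemma CSeries_plus a b : summable a -> summable b ->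
  CSeries (fun n => (a n + b n)%C) = (CSeries a + CSeries b)%C.
Proof.
  intros Ha Hb. apply C_eq; simpl; symmetry.
  - symmetry; apply Series_plus; now apply summable_Re.
  - symmetry; apply Series_plus; now apply summable_Im.
Qed.

Lemma CSeries_scal c a : summable a -> CSeries (fun n => (c * a n)%C) = (c * CSeries a)%C.
Proof.
  intro Ha. assert (A := summable_Re _ Ha). assert (B := summable_Im _ Ha).
  assert (E : forall k u, ex_series u -> ex_series (fun n : nat => k * u n)).
  { intros k u Hu. apply (ex_series_scal (V := R_NormedModule) k), Hu. }
  apply C_eq; simpl; change (fst c) with (Re c); change (snd c) with (Im c).
  - rewrite <- !Series_scal_l, <- Series_minus by auto. reflexivity.
  - rewrite <- !Series_scal_l, <- Series_plus by auto. reflexivity.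
Qed.

Lemma CSeries_S a : summable a -> CSeries a = (a O + CSeries (fun n => a (S n)))%C.
Proof.
  intro Ha. apply C_eq; simpl; apply Series_incr_1; [now apply summable_Re | now apply summable_Im].
Qed.

Lemma Cmod_CSeries a b : (forall n, Cmod (a n) <= b n) -> ex_series b ->
  Cmod (CSeries a) <= 2 * Series b.
Proof.
  intros H Hb. eapply Rle_trans; [apply Cmod_le_sum|].
  assert (K : forall u : nat -> R, (forall n, Rabs (u n) <= b n) -> Rabs (Series u) <= Series b).
  { intros u Hu.
    assert (Eu : ex_series (fun n => Rabs (u n))).
    { apply (ex_series_le (V := R_CompleteNormedModule)) with (2 := Hb).
      intro n. change (Rabs (Rabs (u n)) <= b n). now rewrite Rabs_Rabsolu. }
    eapply Rle_trans; [apply Series_Rabs, Eu|]. apply Series_le; [|exact Hb].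
    intro n. split; [apply Rabs_pos | apply Hu]. }
  replace (2 * Series b) with (Series b + Series b) by ring.
  apply Rplus_le_compat; apply K; intro n; eapply Rle_trans; try apply H.
  - apply re_le_Cmod.
  - apply Im_le_Cmod.
Qed.

(** ** A second order bound for the exponential *)

Lemma exp_le_mono x y : x <= y -> exp x <= exp y.
Proof. intros [H| ->]; [left; now apply exp_increasing | right; reflexivity]. Qed.

Lemma Cmod_CInt g B : cont01 g -> (forall x, 0 <= x <= 1 -> Cmod (g x) <= B) ->
  Cmod (CInt g) <= 2 * B.
Proof.
  intros Hg HB. eapply Rle_trans; [apply Cmod_le_sum|].
  assert (K : forall u : R -> R, ex_RInt u 0 1 -> (forall x, 0 <= x <= 1 -> Rabs (u x) <= B) ->
    Rabs (RInt u 0 1) <= B).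
  { intros u Hu HuB. replace B with ((1 - 0) * B) by ring. apply abs_RInt_le_const; [lra | exact Hu | exact HuB]. }
  replace (2 * B) with (B + B) by ring. apply Rplus_le_compat; apply K.
  - now apply cont01_Re.
  - intros x Hx. eapply Rle_trans; [apply re_le_Cmod | now apply HB].
  - now apply cont01_Im.
  - intros x Hx. eapply Rle_trans; [apply Im_le_Cmod | now apply HB].
Qed.

(** Both bounds integrate the derivative of [cexp (s w)] along the segment from 0
    to [w]. *)
Lemma cexp_first_order w : Cmod (cexp w - 1) <= 2 * (Cmod w * exp (Cmod w)).
Proof.
  assert (G : forall s : R, cder (fun s => cexp (w * s)) s (w * cexp (w * s))).
  { intro s. apply (cder_cexp (fun s => (w * s)%C)).
    eapply cder_eq; [apply cder_scal, cder_id | ring]. }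
  assert (Cg : cont01 (fun s => w * cexp (w * s))%C).
  { apply cont01_mult; [apply cont01_const|]. intros s _. eapply cder_ccont, G. }
  assert (E := CInt_deriv _ _ G Cg). cbv beta in E. rewrite Cmult_1_r, Cmult_0_r, cexp_0 in E.
  rewrite <- E. apply (Cmod_CInt _ _ Cg). intros s Hs. rewrite Cmod_mult, Cmod_cexp.
  apply Rmult_le_compat_l; [apply Cmod_ge_0|]. apply exp_le_mono.
  eapply Rle_trans; [apply Rle_abs|]. eapply Rle_trans; [apply re_le_Cmod|].
  rewrite Cmod_mult, Cmod_R, Rabs_pos_eq by lra. generalize (Cmod_ge_0 w). nra.
Qed.

Lemma cexp_second_order w :
  Cmod (cexp w - 1 - w) <= 4 * Cmod w ^ 2 * exp (Cmod w).
Proof.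
  assert (G : forall s : R, cder (fun s => cexp (w * s) + (- w) * s)%C s (w * (cexp (w * s) - 1))).
  { intro s. eapply cder_eq.
    - apply (cder_plus (fun s => cexp (w * s))).
      + apply (cder_cexp (fun s => (w * s)%C)), cder_scal, cder_id.
      + apply cder_scal, cder_id.
    - ring. }
  assert (Cg : cont01 (fun s => w * (cexp (w * s) - 1))%C).
  { apply cont01_mult; [apply cont01_const|]. apply cont01_plus; [|apply cont01_const].
    intros s _. apply (ccont_cexp (X := R_UniformSpace)).
    eapply cder_ccont, cder_scal, cder_id. }
  assert (E := CInt_deriv _ _ G Cg). cbv beta in E. rewrite Cmult_1_r, Cmult_0_r, cexp_0 in E.
  replace (cexp w - 1 - w)%C with (cexp w + - w * 1 - (1 + - w * 0))%C by ring.
  rewrite <- E.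
  replace (4 * Cmod w ^ 2 * exp (Cmod w)) with (2 * (Cmod w * (2 * (Cmod w * exp (Cmod w))))) by ring.
  apply (Cmod_CInt _ _ Cg). intros s Hs. rewrite Cmod_mult.
  assert (W := Cmod_ge_0 w). assert (Ws : Cmod (w * s) <= Cmod w).
  { rewrite Cmod_mult, Cmod_R, Rabs_pos_eq by lra. nra. }
  apply Rmult_le_compat_l; [exact W|].
  eapply Rle_trans; [apply cexp_first_order|]. apply Rmult_le_compat_l; [lra|].
  apply Rmult_le_compat; [apply Cmod_ge_0 | left; apply exp_pos | exact Ws | now apply exp_le_mono].
Qed.

(** ** Exponential series with rapidly decreasing coefficients *)

(** Summable against every geometric sequence: the series below then converges
    everywhere, and so do its derivatives. *)
Definition entire (a : nat -> C) : Prop :=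
  forall K, 0 <= K -> ex_series (fun m => Cmod (a m) * K ^ m).

Definition exp_char (m : nat) (z : C) : C := cexp (2 * PI * Ci * (INR m * z)).

Definition exp_series (a : nat -> C) (z : C) : C := CSeries (fun m => a m * exp_char m z)%C.

Definition diff_coef (a : nat -> C) (m : nat) : C := (2 * PI * Ci * INR m * a m)%C.

Lemma pow_exp_INR x m : exp x ^ m = exp (INR m * x).
Proof.
  induction m as [|m IH].
  - simpl. rewrite Rmult_0_l. symmetry; apply exp_0.
  - rewrite S_INR. simpl. rewrite IH, <- exp_plus. f_equal. ring.
Qed.

Lemma Cmod_exp_char m z : Cmod (exp_char m z) = exp (- (2 * PI * Im z)) ^ m.
Proof.
  unfold exp_char. rewrite Cmod_cexp, pow_exp_INR. f_equal. unfold Re, Im; simpl; ring.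
Qed.

Lemma entire_summable a z : entire a -> summable (fun m => a m * exp_char m z)%C.
Proof.
  intro H. apply (summable_le _ (fun m => Cmod (a m) * exp (- (2 * PI * Im z)) ^ m)).
  - intro n. rewrite Cmod_mult, Cmod_exp_char. lra.
  - apply H. left; apply exp_pos.
Qed.

Lemma INR_le_pow2 m : INR m <= 2 ^ m.
Proof.
  induction m as [|m IH]; [simpl; lra|]. rewrite S_INR. simpl.
  assert (1 <= 2 ^ m) by (apply pow_R1_Rle; lra). lra.
Qed.

Lemma ex_series_Rscal (c : R) (u : nat -> R) : ex_series u -> ex_series (fun n => c * u n).
Proof. apply (ex_series_scal (V := R_NormedModule)). Qed.

Lemma ex_series_Rle (u v : nat -> R) : (forall n, 0 <= u n <= v n) -> ex_series v -> ex_series u.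
Proof.
  intros H Hv. apply (ex_series_le (V := R_CompleteNormedModule)) with (2 := Hv).
  intro n. change (Rabs (u n) <= v n). rewrite Rabs_pos_eq; apply H.
Qed.

Lemma entire_diff_coef a : entire a -> entire (diff_coef a).
Proof.
  intros H K HK. apply (ex_series_Rle _ (fun m => 2 * PI * (Cmod (a m) * (2 * K) ^ m))).
  - intro m. split; [apply Rmult_le_pos; [apply Cmod_ge_0 | now apply pow_le]|].
    unfold diff_coef. rewrite !Cmod_mult, Cmod_Ci, !Cmod_R, Rpow_mult_distr.
    rewrite (Rabs_pos_eq (INR m)) by apply pos_INR.
    rewrite (Rabs_pos_eq 2) by lra. rewrite (Rabs_pos_eq PI) by (generalize PI_RGT_0; lra).
    assert (P := PI_RGT_0).
    replace (2 * PI * 1 * INR m * Cmod (a m) * K ^ m)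
      with ((2 * PI * (Cmod (a m) * K ^ m)) * INR m) by ring.
    replace (2 * PI * (Cmod (a m) * (2 ^ m * K ^ m)))
      with ((2 * PI * (Cmod (a m) * K ^ m)) * 2 ^ m) by ring.
    apply Rmult_le_compat_l; [|apply INR_le_pow2].
    apply Rmult_le_pos; [lra|]. apply Rmult_le_pos; [apply Cmod_ge_0 | now apply pow_le].
  - apply ex_series_Rscal, H. lra.
Qed.

Lemma entire_scal c a : entire a -> entire (fun m => c * a m)%C.
Proof.
  intros H K HK. eapply ex_series_ext; [|apply (ex_series_Rscal (Cmod c)), (H K HK)].
  intro n. simpl. rewrite Cmod_mult. ring.
Qed.

Lemma exp_series_scal c a z : entire a -> exp_series (fun m => c * a m)%C z = (c * exp_series a z)%C.
Proof.
  intro H. unfold exp_series. rewrite <- CSeries_scal by now apply entire_summable.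
  apply CSeries_ext. intro n. ring.
Qed.

(** The second order bound for a single exponential, summed over the series: the
    extra factor 4 in [K] absorbs the square of the frequency. *)
Lemma exp_series_second_order a z : entire a -> exists M, 0 <= M /\ forall d : C, Cmod d <= 1 ->
  Cmod (exp_series a (z + d) - exp_series a z - d * exp_series (diff_coef a) z) <= M * Cmod d ^ 2.
Proof.
  intro H. assert (H' := entire_diff_coef a H). assert (Pp := PI_RGT_0).
  set (rho := exp (- (2 * PI * Im z))). set (K := rho * exp (2 * PI) * 4).
  assert (Pr : 0 < rho) by apply exp_pos.
  assert (HK : 0 <= K) by (unfold K; generalize (exp_pos (2 * PI)); intro; nra).
  exists (2 * (4 * (2 * PI) ^ 2 * Series (fun m => Cmod (a m) * K ^ m))).
  assert (S0 : 0 <= Series (fun m => Cmod (a m) * K ^ m)).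
  { replace 0 with (Series (fun n : nat => 0 * 0)) by (rewrite Series_scal_l; ring).
    apply Series_le; [|now apply H]. intro n. split; [lra|].
    rewrite Rmult_0_l. apply Rmult_le_pos; [apply Cmod_ge_0 | now apply pow_le]. }
  split. { apply Rmult_le_pos; [lra|]. apply Rmult_le_pos; [|exact S0]. nra. }
  intros d Hd.
  set (t := fun m => (a m * exp_char m (z + d) + ((- (1)) * (a m * exp_char m z) + (- d) * (diff_coef a m * exp_char m z)))%C).
  assert (E : (exp_series a (z + d) - exp_series a z - d * exp_series (diff_coef a) z)%C = CSeries t).
  { unfold t, exp_series. symmetry.
    assert (A1 := entire_summable a (z + d)%C H). assert (A2 := entire_summable a z H).
    assert (A3 := entire_summable _ z H').
    assert (Sc : forall c u, summable u -> summable (fun n => c * u n)%C).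
    { intros c u Hu. apply (ex_series_ext (fun n => Cmod c * Cmod (u n))).
      - intro n. symmetry; apply Cmod_mult.
      - now apply ex_series_Rscal. }
    assert (Ad : forall u v, summable u -> summable v -> summable (fun n => u n + v n)%C).
    { intros u v Hu Hv. apply (summable_le _ (fun n => Cmod (u n) + Cmod (v n))).
      - intro n; apply Cmod_triangle.
      - now apply (ex_series_plus (V := R_NormedModule)). }
    rewrite CSeries_plus, CSeries_plus, !CSeries_scal; auto. ring. }
  rewrite E.
  eapply Rle_trans; [apply (Cmod_CSeries _ (fun m => (4 * (2 * PI) ^ 2 * Cmod d ^ 2) * (Cmod (a m) * K ^ m)))|].
  - intro m.
    assert (Et : t m = (a m * exp_char m z * (cexp (2 * PI * Ci * (INR m * d)) - 1 - 2 * PI * Ci * (INR m * d)))%C).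
    { unfold t, diff_coef. unfold exp_char at 1.
      replace (2 * PI * Ci * (INR m * (z + d)))%C with
        (2 * PI * Ci * (INR m * z) + 2 * PI * Ci * (INR m * d))%C by ring.
      rewrite cexp_plus. fold (exp_char m z). ring. }
    rewrite Et, !Cmod_mult, Cmod_exp_char. fold rho.
    assert (B := cexp_second_order (2 * PI * Ci * (INR m * d))).
    set (w := (2 * PI * Ci * (INR m * d))%C) in *.
    assert (Ew : Cmod w = 2 * PI * INR m * Cmod d).
    { unfold w. rewrite !Cmod_mult, Cmod_Ci, !Cmod_R.
      rewrite (Rabs_pos_eq (INR m)), (Rabs_pos_eq 2), (Rabs_pos_eq PI) by (try apply pos_INR; lra). ring. }
    assert (Pm := pos_INR m). assert (Dd := Cmod_ge_0 d).
    assert (Xe : exp (Cmod w) <= exp (2 * PI) ^ m).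
    { rewrite pow_exp_INR. apply exp_le_mono. rewrite Ew.
      replace (2 * PI * INR m * Cmod d) with ((INR m * (2 * PI)) * Cmod d) by ring.
      rewrite <- (Rmult_1_r (INR m * (2 * PI))) at 2. apply Rmult_le_compat_l; [nra | exact Hd]. }
    assert (X2 : INR m ^ 2 <= 4 ^ m).
    { replace 4 with (2 ^ 2) by ring. rewrite <- pow_mult, Nat.mul_comm, pow_mult.
      apply pow_incr. split; [exact Pm | apply INR_le_pow2]. }
    apply Rle_trans with (Cmod (a m) * rho ^ m * (4 * Cmod w ^ 2 * exp (Cmod w))).
    + apply Rmult_le_compat_l; [|exact B].
      apply Rmult_le_pos; [apply Cmod_ge_0 | apply pow_le; lra].
    + rewrite Ew. unfold K. rewrite !Rpow_mult_distr.
      replace (Cmod (a m) * rho ^ m * (4 * (2 ^ 2 * PI ^ 2 * INR m ^ 2 * Cmod d ^ 2) * exp (2 * PI * INR m * Cmod d)))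
        with ((4 * (2 ^ 2 * PI ^ 2) * Cmod d ^ 2 * (Cmod (a m) * rho ^ m)) * (INR m ^ 2 * exp (2 * PI * INR m * Cmod d))) by ring.
      replace (4 * (2 ^ 2 * PI ^ 2) * Cmod d ^ 2 * (Cmod (a m) * (rho ^ m * exp (2 * PI) ^ m * 4 ^ m)))
        with ((4 * (2 ^ 2 * PI ^ 2) * Cmod d ^ 2 * (Cmod (a m) * rho ^ m)) * (4 ^ m * exp (2 * PI) ^ m)) by ring.
      apply Rmult_le_compat_l.
      * assert (0 <= Cmod (a m) * rho ^ m) by (apply Rmult_le_pos; [apply Cmod_ge_0 | apply pow_le; lra]).
        assert (0 <= Cmod d ^ 2) by nra. assert (0 <= PI ^ 2) by nra.
        apply Rmult_le_pos; [|assumption]. apply Rmult_le_pos; nra.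
      * apply Rmult_le_compat; [nra | left; apply exp_pos | exact X2 | rewrite <- Ew; exact Xe].
  - apply ex_series_Rscal. now apply H.
  - rewrite Series_scal_l. right. ring.
Qed.

Lemma small_radius L eps : 0 <= L -> 0 < eps ->
  exists d : posreal, d <= 1 /\ L * d < eps.
Proof.
  intros HL He. assert (Q : 0 < eps / (L + 1)) by (apply Rdiv_lt_0_compat; lra).
  assert (Q1 : 0 < Rmin 1 (eps / (L + 1))) by (apply Rmin_pos; lra).
  exists (mkposreal _ Q1). simpl. split; [apply Rmin_l|].
  assert (H := Rmin_r 1 (eps / (L + 1))).
  assert (E : (L + 1) * (eps / (L + 1)) = eps) by (field; lra). nra.
Qed.

Lemma is_derive_quadratic (f : R -> R) x l M :
  (forall h, Rabs h <= 1 -> Rabs (f (x + h) - f x - h * l) <= M * h ^ 2) -> is_derive f x l.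
Proof.
  intro H. apply is_derive_Reals. intros eps He.
  destruct (small_radius (Rabs M) eps (Rabs_pos M) He) as [d [D1 D2]].
  exists d. intros h Hh Hd. assert (Hp : 0 < Rabs h) by now apply Rabs_pos_lt.
  replace ((f (x + h) - f x) / h - l) with ((f (x + h) - f x - h * l) / h) by (field; exact Hh).
  unfold Rdiv. rewrite Rabs_mult, Rabs_inv.
  apply (Rmult_lt_reg_r (Rabs h)); [exact Hp|].
  rewrite Rmult_assoc, Rinv_l, Rmult_1_r by lra.
  eapply Rle_lt_trans; [apply H; lra|].
  replace (h ^ 2) with (Rabs h * Rabs h) by (rewrite <- Rabs_mult, Rabs_pos_eq; nra).
  rewrite <- Rmult_assoc. apply Rmult_lt_compat_r; [exact Hp|].
  assert (M <= Rabs M) by apply Rle_abs. assert (P := Rabs_pos M). nra.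
Qed.

Lemma cder_quadratic (g : R -> C) x l M :
  (forall h : R, Rabs h <= 1 -> Cmod (g (x + h)%R - g x - h * l) <= M * h ^ 2) -> cder g x l.
Proof.
  intro H. split; apply (is_derive_quadratic _ _ _ M); intros h Hh;
    (eapply Rle_trans; [|apply (H h Hh)]).
  - eapply Rle_trans; [|apply re_le_Cmod]. right. f_equal. unfold Re, Im; simpl; ring.
  - eapply Rle_trans; [|apply Im_le_Cmod]. right. f_equal. unfold Re, Im; simpl; ring.
Qed.

Lemma pgrad_exp_series a : entire a -> pgrad (exp_series a) (exp_series (diff_coef a)) (exp_series (fun m => Ci * diff_coef a m)%C).
Proof.
  intros H [x y]. destruct (exp_series_second_order a (x, y) H) as [M [M0 HM]]. split; simpl.
  - apply (cder_quadratic _ _ _ M). intros h Hh.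
    specialize (HM (RtoC h)). rewrite Cmod_R in HM. specialize (HM Hh).
    replace (Rabs h ^ 2) with (h ^ 2) in HM by (symmetry; apply pow2_abs).
    replace ((x, y) + h)%C with ((x + h, y) : C) in HM by cring. exact HM.
  - apply (cder_quadratic _ _ _ M). intros h Hh.
    rewrite exp_series_scal by now apply entire_diff_coef.
    specialize (HM (Ci * RtoC h)%C). rewrite Cmod_mult, Cmod_Ci, Cmod_R, Rmult_1_l in HM.
    specialize (HM Hh). replace (Rabs h ^ 2) with (h ^ 2) in HM by (symmetry; apply pow2_abs).
    replace ((x, y) + Ci * h)%C with ((x, y + h) : C) in HM by cring.
    replace (h * (Ci * exp_series (diff_coef a) (x, y)))%C with (Ci * h * exp_series (diff_coef a) (x, y))%C by ring.
    exact HM.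
Qed.

Lemma ccont_quadratic (f : C -> C) (z l : C) (M : R) :
  (forall d : C, Cmod d <= 1 -> Cmod (f (z + d)%C - f z - d * l) <= M * Cmod d ^ 2) ->
  @ccont C_UniformSpace f z.
Proof.
  intros H P [eps He].
  assert (L0 : 0 <= 2 * (Cmod l + Rabs M)) by (generalize (Rabs_pos M) (Cmod_ge_0 l); lra).
  destruct (small_radius _ eps L0 (cond_pos eps)) as [r [R1 R2]].
  exists (mkposreal (r / 2) ltac:(generalize (cond_pos r); lra)). intros w0 [H1 H2]. apply He.
  assert (Ew : exists w : C, w = w0) by (eexists; reflexivity). destruct Ew as [w <-].
  change (Rabs (Re w - Re z) < r / 2) in H1. change (Rabs (Im w - Im z) < r / 2) in H2.
  set (d := (w - z)%C).
  assert (Dw : Cmod d < r).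
  { eapply Rle_lt_trans; [apply Cmod_le_sum|].
    replace (Re d) with (Re w - Re z) by (unfold d, Re; simpl; ring).
    replace (Im d) with (Im w - Im z) by (unfold d, Im; simpl; ring). lra. }
  specialize (H d ltac:(lra)). replace (z + d)%C with w in H by (unfold d; ring).
  assert (F : Cmod (f w - f z) < eps).
  { replace (f w - f z)%C with (f w - f z - d * l + d * l)%C by ring.
    eapply Rle_lt_trans; [apply Cmod_triangle|]. rewrite Cmod_mult.
    assert (D0 := Cmod_ge_0 d). assert (M <= Rabs M) by apply Rle_abs.
    assert (Pm := Rabs_pos M). assert (Pl := Cmod_ge_0 l).
    assert (Cmod d ^ 2 <= Cmod d) by nra. assert (0 <= Cmod d ^ 2) by nra. nra. }
  split; (eapply Rle_lt_trans; [|exact F]).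
  - change (Rabs (Re (f w) - Re (f z)) <= Cmod (f w - f z)).
    replace (Re (f w) - Re (f z)) with (Re (f w - f z)) by (unfold Re; simpl; ring).
    apply re_le_Cmod.
  - change (Rabs (Im (f w) - Im (f z)) <= Cmod (f w - f z)).
    replace (Im (f w) - Im (f z)) with (Im (f w - f z)) by (unfold Im; simpl; ring).
    apply Im_le_Cmod.
Qed.

Lemma psmooth_exp_series a : entire a -> psmooth (exp_series a).
Proof.
  intros H k. revert a H. induction k as [|k IH]; intros a H.
  - split; [|trivial]. intro z. destruct (exp_series_second_order a z H) as [M [_ HM]].
    eapply ccont_quadratic; exact HM.
  - eapply PCk_intro.
    + intro z. destruct (exp_series_second_order a z H) as [M [_ HM]]. eapply ccont_quadratic; exact HM.
    + now apply pgrad_exp_series.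
    + now apply IH, entire_diff_coef.
    + now apply IH, entire_scal, entire_diff_coef.
Qed.

(** * The sigma section *)

(** The coefficient [(-1)^m q^(m (m + 1))] of the theta series, for
    [q = cexp (PI * Ci * eta)]. *)
Definition theta_coef (m : nat) : C := cexp (PI * Ci * (INR m * (INR m + 1) * eta + INR m)).

Lemma Cmod_theta_coef m : Cmod (theta_coef m) = exp (- (PI * sqrt 3 / 2 * INR m * (INR m + 1))).
Proof.
  unfold theta_coef. rewrite Cmod_cexp. f_equal. rewrite eta_val. unfold Re, Im; simpl; field.
Qed.

Lemma PI_sqrt3_lower : 5 < PI * sqrt 3.
Proof.
  assert (A : 3 < PI) by (generalize PI2_3_2; lra).
  assert (B : 17 / 10 < sqrt 3).
  { apply Rsqr_incrst_0; [|lra|left; apply sqrt3_pos]. unfold Rsqr. rewrite sqrt3_sq. lra. }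
  nra.
Qed.

Lemma entire_theta_coef : entire theta_coef.
Proof.
  intros K HK. assert (Hc := PI_sqrt3_lower). set (c := PI * sqrt 3 / 2).
  destruct (INR_archimed c (2 * K)) as [M HM]; [unfold c; lra|].
  apply (ex_series_incr_n _ M).
  apply (ex_series_Rle _ (fun n => / 2 ^ M * (/ 2) ^ n)).
  - intro n. assert (P := exp_pos (- (c * INR (M + n) * (INR (M + n) + 1)))). split.
    + rewrite Cmod_theta_coef. fold c. apply Rmult_le_pos; [lra | now apply pow_le].
    + rewrite Cmod_theta_coef. fold c. set (m := (M + n)%nat).
      replace (- (c * INR m * (INR m + 1))) with (INR m * (- (c * (INR m + 1)))) by ring.
      rewrite <- pow_exp_INR, <- Rpow_mult_distr.
      replace (/ 2 ^ M * (/ 2) ^ n) with ((/ 2) ^ m)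
        by (unfold m; rewrite pow_add, pow_inv; reflexivity).
      apply pow_incr. split; [apply Rmult_le_pos; [left; apply exp_pos | exact HK]|].
      rewrite exp_Ropp. set (E := exp (c * (INR m + 1))).
      assert (HE : 2 * K <= E).
      { unfold E. eapply Rle_trans; [|apply exp_ineq1_le].
        assert (INR M <= INR m) by (apply le_INR; unfold m; lia).
        assert (0 <= INR M) by apply pos_INR. unfold c in *. nra. }
      assert (PE : 0 < E) by apply exp_pos.
      apply (Rmult_le_reg_l E); [exact PE|]. rewrite <- Rmult_assoc, Rinv_r by lra. lra.
  - apply ex_series_Rscal, ex_series_geom. rewrite Rabs_pos_eq; lra.
Qed.

(** A partial theta function, with the exponents of nonnegative index only: its
    functional equation has an elementary correction term. *)
Definition ptheta : C -> C := exp_series theta_coef.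

Lemma ptheta_shift_1 z : ptheta (z + 1) = ptheta z.
Proof.
  apply CSeries_ext. intro m. f_equal. unfold exp_char.
  replace (2 * PI * Ci * (INR m * (z + 1)))%C with
    (2 * PI * Ci * (INR m * z) + 2 * PI * INR m * Ci)%C by ring.
  rewrite cexp_plus.
  replace (cexp (2 * PI * INR m * Ci)) with (RtoC 1); [ring|].
  rewrite <- (cis_2PI_Z (Z.of_nat m)), cis_cexp. f_equal. rewrite <- INR_IZR_INZ. cring.
Qed.

Lemma ptheta_shift_eta z :
  ptheta (z + eta) = (- cexp (- (2 * PI * Ci * (z + eta))) * (ptheta z - 1))%C.
Proof.
  assert (S0 := entire_summable theta_coef z entire_theta_coef).
  unfold ptheta at 2, exp_series. rewrite CSeries_S by exact S0.
  assert (E0 : (theta_coef 0 * exp_char 0 z = 1)%C).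
  { unfold theta_coef, exp_char. rewrite <- cexp_plus, <- cexp_0. f_equal. simpl. ring. }
  rewrite E0.
  assert (S1 : summable (fun n => theta_coef (S n) * exp_char (S n) z)%C).
  { apply (ex_series_incr_1 (fun n => Cmod (theta_coef n * exp_char n z)%C)). exact S0. }
  replace (1 + CSeries (fun n => theta_coef (S n) * exp_char (S n) z) - 1)%C
    with (CSeries (fun n => theta_coef (S n) * exp_char (S n) z)%C) by ring.
  rewrite <- CSeries_scal by exact S1. apply CSeries_ext. intro m.
  replace (- cexp (- (2 * PI * Ci * (z + eta))))%C
    with (cexp (- (PI * Ci)) * cexp (- (2 * PI * Ci * (z + eta))))%C.
  - unfold theta_coef, exp_char. rewrite <- !cexp_plus. f_equal. rewrite S_INR, RtoC_plus. ring.
  - replace (cexp (- (PI * Ci))) with (- (1))%C; [ring|].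
    rewrite <- cis_PI. transitivity (cis (- PI)).
    + unfold cis. rewrite cos_neg, sin_neg, sin_PI. cring.
    + rewrite cis_cexp. f_equal. cring.
Qed.

(** The second term supplies the exponents of negative index in the theta
    series. *)
Definition theta (z : C) : C := (ptheta z - cexp (- (2 * PI * Ci) * z) * ptheta (- z))%C.

Definition theta' (z : C) : C :=
  (exp_series (diff_coef theta_coef) z + cexp (- (2 * PI * Ci) * z)
     * (exp_series (diff_coef theta_coef) (- z) + 2 * PI * Ci * ptheta (- z)))%C.

Lemma psmooth_neg phi : psmooth phi -> psmooth (fun z => phi (- z)%C).
Proof.
  intro H. apply (psmooth_ext (fun z => phi (affine (-1) 0 0 (-1) 0 0 z))).
  - intro z. f_equal. unfold affine. cring.
  - now apply psmooth_affine.
Qed.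

Lemma pgrad_neg phi : psmooth phi ->
  pgrad (fun z => phi (- z)%C) (fun z => - pdx phi (- z))%C (fun z => - pdy phi (- z))%C.
Proof.
  intro H.
  assert (E : forall z, affine (-1) 0 0 (-1) 0 0 z = (- z)%C) by (intro z; unfold affine; cring).
  apply (pgrad_ext (fun z => phi (affine (-1) 0 0 (-1) 0 0 z))).
  { intro z. now rewrite E. }
  eapply pgrad_eq; [| |apply pgrad_affine, H]; intro z; cbv beta; rewrite E; cring.
Qed.

Lemma psmooth_theta : psmooth theta.
Proof.
  apply (psmooth_ext (fun z => ptheta z + (- (1)) * (cexp (- (2 * PI * Ci) * z) * ptheta (- z)))%C).
  - intro z. unfold theta. ring.
  - apply psmooth_plus; [apply psmooth_exp_series, entire_theta_coef|]. apply psmooth_scal, psmooth_mult.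
    + apply psmooth_cexp, psmooth_scal, psmooth_id.
    + apply psmooth_neg, psmooth_exp_series, entire_theta_coef.
Qed.

Lemma pgrad_theta : pgrad theta theta' (fun z => Ci * theta' z)%C.
Proof.
  assert (G := pgrad_exp_series theta_coef entire_theta_coef).
  assert (Gn := pgrad_neg _ (psmooth_exp_series _ entire_theta_coef)).
  rewrite (pgrad_pdx _ _ _ G), (pgrad_pdy _ _ _ G) in Gn.
  apply (pgrad_ext (fun z => ptheta z + (- (1)) * (cexp (- (2 * PI * Ci) * z) * ptheta (- z)))%C).
  { intro z. unfold theta. ring. }
  eapply pgrad_eq.
  3: { apply pgrad_plus; [exact G|]. apply pgrad_scal, pgrad_mult; [|exact Gn].
       apply pgrad_cexp, pgrad_scal, pgrad_id. }
  all: intro z; cbv beta; unfold theta'; rewrite ?exp_series_scal by apply entire_diff_coef, entire_theta_coef;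
    fold ptheta; ring.
Qed.

Lemma theta_shift_1 z : theta (z + 1) = theta z.
Proof.
  unfold theta. rewrite ptheta_shift_1.
  assert (E : ptheta (- z) = ptheta (- (z + 1))).
  { rewrite <- (ptheta_shift_1 (- (z + 1))). f_equal. ring. }
  rewrite <- E.
  replace (- (2 * PI * Ci) * (z + 1))%C with (- (2 * PI * Ci) * z + - (2 * PI * Ci))%C by ring.
  rewrite cexp_plus. replace (cexp (- (2 * PI * Ci))) with (RtoC 1); [ring|].
  rewrite <- (cis_2PI_Z (-1)), cis_cexp. f_equal. cring.
Qed.

Lemma theta_shift_eta z :
  theta (z + eta) = (- cexp (- (2 * PI * Ci) * (z + eta)) * theta z)%C.
Proof.
  unfold theta. rewrite ptheta_shift_eta.
  assert (E : ptheta (- (z + eta)) = (1 - cexp (- (2 * PI * Ci) * z) * ptheta (- z))%C).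
  { assert (F := ptheta_shift_eta (- (z + eta))).
    replace (- (z + eta) + eta)%C with (- z)%C in F by ring. rewrite F.
    replace (- (2 * PI * Ci * - z))%C with (- (- (2 * PI * Ci) * z))%C by ring.
    assert (I := cexp_opp_l (- (2 * PI * Ci) * z)).
    transitivity (1 + (cexp (- (- (2 * PI * Ci) * z)) * cexp (- (2 * PI * Ci) * z))
       * (ptheta (- (z + eta)) - 1))%C; [rewrite I|]; ring. }
  rewrite E. replace (- (2 * PI * Ci * (z + eta)))%C with (- (2 * PI * Ci) * (z + eta))%C by ring.
  ring.
Qed.

(** The derivative of theta at the origin is [2 pi i] times the alternating
    series with general term [(2 m + 1) theta_coef m], whose first term dominates. *)
Lemma theta'_0 : theta' 0 <> 0.
Proof.
  set (u := fun m => (1 * (INR (2 * m + 1) * theta_coef m))%C).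
  (* 2 m + 1 is at most 3 ^ m, the modulus of [theta_coef m] is at most exp (-5) ^ m,
     and 3 exp (-5) < 1 / 4. *)
  assert (Hb : forall n, Cmod (u (S n)) <= (/ 4) ^ (S n)).
  { intro n. set (m := S n). unfold u. rewrite !Cmod_mult, !Cmod_R, Rabs_R1, Rmult_1_l.
    rewrite (Rabs_pos_eq (INR (2 * m + 1))) by apply pos_INR. rewrite Cmod_theta_coef.
    assert (Hc := PI_sqrt3_lower).
    assert (M1 : 1 <= INR m) by (unfold m; rewrite S_INR; generalize (pos_INR n); lra).
    apply Rle_trans with (3 ^ m * exp (Ropp 5) ^ m).
    - apply Rmult_le_compat; [apply pos_INR | left; apply exp_pos | |].
      + clear. induction m as [|m IH]; [simpl; lra|].
        replace (2 * S m + 1)%nat with ((2 * m + 1) + 2)%nat by lia. rewrite plus_INR.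
        simpl pow. assert (1 <= 3 ^ m) by (apply pow_R1_Rle; lra). simpl (INR 2). lra.
      + rewrite pow_exp_INR. apply exp_le_mono.
        replace (PI * sqrt 3 / 2 * INR m * (INR m + 1))
          with ((PI * sqrt 3) * (INR m * ((INR m + 1) / 2))) by field.
        assert (Q : INR m <= INR m * ((INR m + 1) / 2)) by nra.
        assert (Q' : 5 * INR m <= PI * sqrt 3 * (INR m * ((INR m + 1) / 2)))
          by (apply Rmult_le_compat; lra).
        lra.
    - rewrite <- Rpow_mult_distr. apply pow_incr. split.
      + apply Rmult_le_pos; [lra | left; apply exp_pos].
      + rewrite exp_Ropp. assert (E1 := exp_ineq1_le 1).
        assert (E5 : 32 <= exp 5).
        { replace 5 with (INR 5 * 1) by (simpl; ring). rewrite <- pow_exp_INR.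
          replace 32 with ((1 + 1) ^ 5) by ring. apply pow_incr. lra. }
        apply (Rmult_le_reg_l (exp 5)); [lra|].
        replace (exp 5 * (3 * / exp 5)) with 3 by (field; lra). lra. }
  assert (G : is_series (fun n => (/ 4) ^ (S n)) (/ 3)).
  { assert (G0 := is_series_geom (/ 4)). rewrite Rabs_pos_eq in G0 by lra.
    specialize (G0 ltac:(lra)). replace (/ (1 - / 4)) with (4 / 3) in G0 by field.
    apply (is_series_ext (fun n => / 4 * (/ 4) ^ n)); [reflexivity|].
    replace (/ 3) with (/ 4 * (4 / 3)) by field.
    apply (is_series_scal (V := R_NormedModule) (/ 4)), G0. }
  assert (GE : ex_series (fun n => (/ 4) ^ (S n))) by (eexists; exact G).
  assert (Su : summable u).
  { apply (ex_series_incr_1 (fun n => Cmod (u n))). apply (summable_le (fun n => u (S n)) _ Hb GE). }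
  assert (Nz : CSeries u <> 0).
  { intro E. rewrite CSeries_S in E by exact Su.
    assert (U0 : u O = 1).
    { unfold u, theta_coef. simpl. replace (PI * Ci * (0 * (0 + 1) * eta + 0))%C with (RtoC 0) by ring.
      rewrite cexp_0. ring. }
    rewrite U0 in E. apply (f_equal Re) in E. rewrite re_plus, !re_RtoC in E.
    change (1 + Series (fun n => Re (u (S n))) = 0) in E.
    assert (SR : Rabs (Series (fun n => Re (u (S n)))) <= / 3).
    { assert (Ex : ex_series (fun n => Rabs (Re (u (S n))))).
      { apply (ex_series_Rle _ (fun n => (/ 4) ^ (S n))); [|exact GE]. intro n. split; [apply Rabs_pos|].
        eapply Rle_trans; [apply re_le_Cmod | apply Hb]. }
      eapply Rle_trans; [apply Series_Rabs, Ex|]. rewrite <- (is_series_unique _ _ G).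
      apply Series_le; [|exact GE]. intro n. split; [apply Rabs_pos|].
      eapply Rle_trans; [apply re_le_Cmod | apply Hb]. }
    apply Rabs_le_between in SR. lra. }
  assert (E : theta' 0 = (2 * PI * Ci * CSeries u)%C).
  { unfold theta'. replace (- (2 * PI * Ci) * 0)%C with (RtoC 0) by ring.
    replace (- (0))%C with (RtoC 0) by ring. rewrite cexp_0.
    transitivity (2 * exp_series (diff_coef theta_coef) 0 + 2 * PI * Ci * ptheta 0)%C; [ring|].
    unfold ptheta, exp_series.
    assert (S1 := entire_summable _ 0 (entire_diff_coef _ entire_theta_coef)).
    assert (S2 := entire_summable _ 0 entire_theta_coef).
    assert (Sc : forall c v, summable v -> summable (fun n => c * v n)%C).
    { intros c v Hv. apply (ex_series_ext (fun n => Cmod c * Cmod (v n))).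
      - intro n. symmetry; apply Cmod_mult.
      - now apply ex_series_Rscal. }
    rewrite <- !CSeries_scal by assumption. rewrite <- CSeries_plus by auto.
    apply CSeries_ext. intro m. unfold u, diff_coef, exp_char.
    replace (2 * PI * Ci * (INR m * 0))%C with (RtoC 0) by ring. rewrite cexp_0.
    replace (INR (2 * m + 1)) with (2 * INR m + 1) by (rewrite plus_INR, mult_INR; simpl; ring).
    rewrite RtoC_plus, RtoC_mult. ring. }
  rewrite E. repeat apply Cmult_neq_0; try apply Ci_nz; try exact Nz; intro F; apply RtoC_inj in F.
  - lra.
  - now apply PI_neq0.
Qed.

(** Multiplying by the inverse gauge turns theta into a section of degree one. *)
Definition wsigma (z : C) : C := (cexp ((- (1)) * gauge 1 z) * theta z)%C.

Lemma holo_wsigma z : holo 1 wsigma z = theta z.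
Proof.
  unfold holo, wsigma. rewrite Cmult_assoc, <- cexp_plus.
  replace (gauge 1 z + - (1) * gauge 1 z)%C with (RtoC 0) by ring. rewrite cexp_0. ring.
Qed.

Lemma psmooth_wsigma : psmooth wsigma.
Proof.
  apply psmooth_mult; [|apply psmooth_theta]. apply psmooth_cexp, psmooth_scal, psmooth_gauge.
Qed.

Lemma sect_wsigma : sect 1 wsigma.
Proof.
  split; [apply psmooth_wsigma | split].
  - split; intro z; unfold wsigma.
    + rewrite theta_shift_1, Cmult_assoc, cis_cexp, <- cexp_plus. do 2 f_equal. unfold gauge. cring.
    + rewrite theta_shift_eta. 
      replace (- cexp (- (2 * PI * Ci) * (z + eta)))%C
        with (cis (PI * 1) * cexp (- (2 * PI * Ci) * (z + eta)))%C
        by (rewrite Rmult_1_r, cis_PI; ring).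
      rewrite !Cmult_assoc, !cis_cexp, <- !cexp_plus. do 2 f_equal.
      assert (A : PI = nu 1 * sqrt 3) by (generalize (nu_area 1); lra).
      assert (S := sqrt3_sq).
      unfold gauge. rewrite eta_val. apply C_eq; unfold Re, Im; simpl; field [S A].
  - intro z. assert (E := holo_CR 1 wsigma z psmooth_wsigma).
    replace (holo 1 wsigma) with theta in E by (extensionality u; now rewrite holo_wsigma).
    rewrite (pgrad_pdx _ _ _ pgrad_theta), (pgrad_pdy _ _ _ pgrad_theta) in E.
    assert (F : ((- 2 * Ci * cexp (gauge 1 z)) * Db (nu 1) wsigma z = 0)%C).
    { rewrite <- Cmult_assoc, <- E. ring. }
    apply Cmult_integral in F. destruct F as [F|F]; [exfalso|exact F].
    revert F. repeat apply Cmult_neq_0.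
    + intro F. apply (f_equal Re) in F. simpl in F. lra.
    + apply Ci_nz.
    + apply cexp_neq_0.
Qed.

Lemma theta_0 : theta 0 = 0.
Proof.
  unfold theta. replace (- (2 * PI * Ci) * 0)%C with (RtoC 0) by ring.
  replace (- (0))%C with (RtoC 0) by ring. rewrite cexp_0. ring.
Qed.

Lemma wsigma_0 : wsigma 0 = 0.
Proof. unfold wsigma. rewrite theta_0. ring. Qed.

Lemma pdx_wsigma_0 : pdx wsigma 0 <> 0.
Proof.
  assert (G := pgrad_mult _ _ _ _ _ _
     (pgrad_cexp _ _ _ (pgrad_scal (- (1)) _ _ _ (pgrad_gauge 1))) pgrad_theta).
  unfold wsigma. rewrite (pgrad_pdx _ _ _ G), theta_0, Cmult_0_r, Cplus_0_l.
  apply Cmult_neq_0; [apply cexp_neq_0 | apply theta'_0].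
Qed.

Lemma pdy_sect_0 d f : sect d f -> pdy f 0 = (Ci * pdx f 0)%C.
Proof.
  intros [_ [_ B]]. specialize (B 0). unfold Db in B.
  replace (nu d * 0 * f 0)%C with (RtoC 0) in B by ring. rewrite Cplus_0_r in B.
  apply Cmult_integral in B. destruct B as [B|B].
  - apply (f_equal Re) in B. simpl in B. lra.
  - transitivity (Ci * pdx f 0 - Ci * (pdx f 0 + Ci * pdy f 0))%C; [cring|]. rewrite B. ring.
Qed.

Lemma Dz_wsigma_0 : Dz (nu 1) wsigma 0 <> 0.
Proof.
  unfold Dz. rewrite (pdy_sect_0 1 wsigma sect_wsigma), wsigma_0.
  replace (1 / 2 * (pdx wsigma 0 - Ci * (Ci * pdx wsigma 0)) - nu 1 * Cconj 0 * 0)%C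
    with (pdx wsigma 0) by cfield.
  apply pdx_wsigma_0.
Qed.

(** Sections of degree one form a line, so the rotation multiplies [wsigma] by a
    constant; the derivative at the origin identifies the constant. *)
Lemma rotates_wsigma : rotates eta wsigma.
Proof.
  assert (S1 := sect_wsigma). assert (S2 := sect_rotate 1 wsigma S1).
  set (sr := fun z => wsigma (eta * z)%C) in *.
  set (a := tcoef 1 wsigma 0). set (b := tcoef 1 sr 0).
  assert (L : forall z, (a * sr z + - b * wsigma z = 0)%C).
  { apply (sect_determined 1); [lia | now apply sect_comb |].
    intros m Hm. replace m with 0%Z by lia.
    rewrite tcoef_comb by (apply psmooth_wsigma || apply psmooth_rotate, psmooth_wsigma).
    unfold a, b. ring. }
  assert (Ha : a <> 0).
  { intro E. apply pdx_wsigma_0.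
    assert (Z : forall z, wsigma z = 0).
    { apply (sect_determined 1); [lia | exact S1 |]. intros m Hm. now replace m with 0%Z by lia. }
    replace wsigma with (fun _ : C => RtoC 0) by (extensionality z; now rewrite Z).
    now rewrite (pgrad_pdx _ _ _ (pgrad_const 0)). }
  assert (Hr : rotates (b / a) wsigma).
  { intro z. apply (Cmult_cancel a _ _ Ha). change (wsigma (eta * z)) with (sr z).
    transitivity (b * wsigma z)%C; [|field; exact Ha].
    apply Ceq_minus. rewrite <- (L z). ring. }
  replace eta with (b / a)%C; [exact Hr|].
  apply (Cmult_cancel (pdx wsigma 0) _ _ pdx_wsigma_0).
  assert (G1 := pgrad_rotate wsigma psmooth_wsigma).
  assert (G2 := pgrad_scal (b / a) _ _ _ (psmooth_pgrad _ psmooth_wsigma)).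
  apply (pgrad_ext _ _ _ _ Hr) in G1.
  destruct (pgrad_unique _ _ _ _ _ G1 G2 0) as [E _]. rewrite Cmult_0_r in E.
  rewrite (pdy_sect_0 1 wsigma sect_wsigma) in E.
  rewrite (Cmult_comm _ (b / a)), <- E, eta_val. cfield.
Qed.

(** * Finite linear combinations and dimension *)

Definition lsum {I : Type} (l : list I) (F : I -> C) : C :=
  fold_right (fun i s => (F i + s)%C) (RtoC 0) l.

Lemma lsum_cons {I} (i : I) l F : lsum (i :: l) F = (F i + lsum l F)%C.
Proof. reflexivity. Qed.

Lemma lsum_ext {I} (l : list I) F G : (forall i, In i l -> F i = G i) -> lsum l F = lsum l G.
Proof.
  induction l as [|i l IH]; intro H; [reflexivity|]. simpl.
  rewrite H by now left. rewrite IH; [reflexivity|]. intros; apply H; now right.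
Qed.

Lemma lsum_0 {I} (l : list I) (F : I -> C) : (forall i, In i l -> F i = 0) -> lsum l F = 0.
Proof.
  induction l as [|i l IH]; intro H; [reflexivity|]. simpl.
  rewrite H by now left. rewrite IH; [ring|]. intros; apply H; now right.
Qed.

Lemma lsum_plus {I} (l : list I) F G :
  lsum l (fun i => F i + G i)%C = (lsum l F + lsum l G)%C.
Proof. induction l as [|i l IH]; simpl; [ring|]. rewrite IH. ring. Qed.

Lemma lsum_scal {I} (l : list I) c F : lsum l (fun i => c * F i)%C = (c * lsum l F)%C.
Proof. induction l as [|i l IH]; simpl; [ring|]. rewrite IH. ring. Qed.

Lemma lsum_app {I} (l m : list I) F : lsum (l ++ m) F = (lsum l F + lsum m F)%C.
Proof. induction l as [|i l IH]; simpl; [ring|]. rewrite IH. ring. Qed.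

Lemma lsum_map {I J} (g : J -> I) (l : list J) F : lsum (map g l) F = lsum l (fun j => F (g j)).
Proof. induction l as [|i l IH]; simpl; [reflexivity|]. now rewrite IH. Qed.

Lemma lsum_perm {I} (l m : list I) F : Permutation l m -> lsum l F = lsum m F.
Proof. intro P. induction P; simpl; try congruence; ring. Qed.

Lemma lsum_filter {I} (p : I -> bool) (l : list I) (F : I -> C) :
  (forall i, In i l -> p i = false -> F i = 0) -> lsum l F = lsum (filter p l) F.
Proof.
  induction l as [|i l IH]; intro H; [reflexivity|]. simpl.
  rewrite IH by (intros; apply H; auto; now right).
  destruct (p i) eqn:E; [reflexivity|]. rewrite (H i) by (auto; now left). ring.
Qed.

Lemma lsum_single {I} (l : list I) (F : I -> C) i : NoDup l -> In i l ->
  (forall j, In j l -> j <> i -> F j = 0) -> lsum l F = F i.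
Proof.
  intros ND Hi H. apply in_split in Hi. destruct Hi as [l1 [l2 ->]].
  assert (P : Permutation (l1 ++ i :: l2) (i :: l1 ++ l2)).
  { symmetry. apply Permutation_middle. }
  rewrite (lsum_perm _ _ _ P). simpl. rewrite lsum_0; [ring|].
  apply (Permutation_NoDup P) in ND. inversion_clear ND.
  intros j Hj. apply H.
  - apply in_app_iff in Hj. apply in_app_iff. simpl. tauto.
  - intros ->. tauto.
Qed.

(** Elimination of the last coordinate. *)
Lemma linear_dependence (I : Type) (dec : forall i j : I, {i = j} + {i <> j}) (n : nat) :
  forall (l : list I) (M : I -> nat -> C), NoDup l -> length l = S n ->
  exists c : I -> C, (exists i, In i l /\ c i <> 0) /\
    forall k, (k < n)%nat -> lsum l (fun i => c i * M i k)%C = 0.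
Proof.
  induction n as [|n IH]; intros l M ND Hl.
  - destruct l as [|i l]; [easy|]. exists (fun _ => RtoC 1). split.
    + exists i. split; [now left | apply C1_nz].
    + intros; lia.
  - destruct (classic (exists i, In i l /\ M i n <> 0)) as [[i0 [Hi0 Hne]]|Hall].
    + apply in_split in Hi0. destruct Hi0 as [l1 [l2 ->]].
      assert (P : Permutation (l1 ++ i0 :: l2) (i0 :: l1 ++ l2)).
      { symmetry. apply Permutation_middle. }
      set (r := l1 ++ l2) in *.
      assert (ND' := Permutation_NoDup P ND). apply Permutation_length in P as PL.
      rewrite Hl in PL. simpl in PL. injection PL as PL.
      inversion_clear ND' as [|? ? Hnin NDr].
      destruct (IH r (fun i k => M i k - M i n / M i0 n * M i0 k)%C NDr (eq_sym PL))
        as [c [[i [Hi Hci]] Hc]].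
      exists (fun i => if dec i i0 then (- / M i0 n * lsum r (fun i => c i * M i n))%C else c i).
      assert (Er : forall k, lsum r (fun i => (if dec i i0 then (- / M i0 n * lsum r (fun i => c i * M i n))%C else c i) * M i k)%C
                   = lsum r (fun i => c i * M i k)%C).
      { intro k. apply lsum_ext. intros j Hj. destruct (dec j i0) as [->|]; [tauto|reflexivity]. }
      split.
      * exists i. split.
        { apply in_app_iff. apply in_app_iff in Hi. simpl. tauto. }
        destruct (dec i i0) as [->|]; [tauto | exact Hci].
      * intros k Hk. rewrite (lsum_perm _ _ _ P). simpl. rewrite Er.
        destruct (dec i0 i0) as [_|]; [|tauto].
        destruct (Nat.eq_dec k n) as [->|Hkn].
        { field. exact Hne. }
        assert (E := Hc k ltac:(lia)).
        transitivity (lsum r (fun i => c i * M i k + (- / M i0 n * M i0 k) * (c i * M i n))%C).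
        { rewrite (lsum_plus r (fun i => c i * M i k)%C), lsum_scal. ring. }
        rewrite <- E. apply lsum_ext. intros j _. field. exact Hne.
    + destruct l as [|i0 l]; [easy|]. inversion_clear ND as [|? ? Hnin ND'].
      destruct (IH l M ND') as [c [[i [Hi Hci]] Hc]]. { now injection Hl. }
      exists (fun i => if dec i i0 then RtoC 0 else c i). split.
      * exists i. split; [now right|]. destruct (dec i i0) as [->|]; [tauto | exact Hci].
      * intros k Hk. rewrite lsum_cons. destruct (dec i0 i0) as [_|]; [|tauto].
        destruct (Nat.eq_dec k n) as [->|Hkn].
        { rewrite lsum_0; [ring|]. intros j Hj.
          replace (M j n) with (RtoC 0); [ring|]. symmetry. apply NNPP. intro E. apply Hall.
          exists j. split; [now right | exact E]. }
        rewrite (lsum_ext _ _ (fun i => c i * M i k))%C.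
        { rewrite Hc by lia. ring. }
        intros j Hj. destruct (dec j i0) as [->|]; [tauto|reflexivity].
Qed.

Lemma sum_n_m_lsum (F : nat -> C) m :
  @sum_n_m C_AbelianMonoid F 1 m = lsum (seq 1 m) F.
Proof.
  induction m as [|m IH].
  - rewrite sum_n_m_zero by lia. reflexivity.
  - rewrite sum_n_Sm by lia. rewrite IH, seq_S, lsum_app. simpl.
    change (lsum (seq 1 m) F + F (S m) = lsum (seq 1 m) F + (F (S m) + 0))%C. ring.
Qed.

Lemma lsum_nth {I} (d0 : I) (l : list I) F :
  lsum l F = lsum (seq 1 (length l)) (fun k => F (nth (k - 1) l d0)).
Proof.
  induction l as [|i l IH]; [reflexivity|]. simpl length. simpl seq. simpl.
  f_equal. rewrite IH, <- (seq_shift (length l) 1), lsum_map. apply lsum_ext. intros k Hk.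
  apply in_seq in Hk. destruct k; [lia|]. simpl. now rewrite Nat.sub_0_r.
Qed.

Lemma has_dim_list {X I : Type} (dec : forall i j : I, {i = j} + {i <> j})
  (l : list I) (u : I -> X -> C) (V : (X -> C) -> Prop) :
  NoDup l -> (forall i, In i l -> V (u i)) ->
  (forall c : I -> C, (forall x, lsum l (fun i => c i * u i x)%C = 0) ->
     forall i, In i l -> c i = 0) ->
  (forall f, V f -> exists c : I -> C, forall x, f x = lsum l (fun i => c i * u i x)%C) ->
  has_dim V (length l).
Proof.
  intros ND HV HI HS. destruct l as [|d0 l0].
  - exists (fun _ _ => RtoC 0). split; [|split].
    + simpl; intros; lia.
    + simpl; intros; lia.
    + intros f Hf. destruct (HS f Hf) as [c Hc]. exists (fun _ => RtoC 0). intro x.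
      rewrite Hc, sum_n_m_lsum. reflexivity.
  - set (l := d0 :: l0) in *.
    exists (fun k => u (nth (k - 1) l d0)). split; [|split].
    + intros i Hi. apply HV, nth_In. lia.
    + intros a Ha.
      assert (Hc : exists c : I -> C, forall k, (k < length l)%nat -> c (nth k l d0) = a (S k)).
      { clear -ND dec. clearbody l. revert a. induction l as [|i l IH]; intro a.
        - exists (fun _ => RtoC 0). simpl; intros; lia.
        - inversion_clear ND as [|? ? Hn ND']. destruct (IH ND' (fun k => a (S k))) as [c Hc].
          exists (fun j => if dec j i then a 1%nat else c j). intros [|k] Hk; simpl.
          + destruct (dec i i); [reflexivity|tauto].
          + simpl in Hk. destruct (dec (nth k l d0) i) as [E|_].
            * exfalso. apply Hn. rewrite <- E. apply nth_In. lia.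
            * apply Hc. lia. }
      destruct Hc as [c Hc]. intros i Hi.
      replace i with (S (i - 1)) by lia. rewrite <- Hc by lia. apply HI.
      * intro x. rewrite (lsum_nth d0), <- (Ha x), sum_n_m_lsum. apply lsum_ext.
        intros k Hk. apply in_seq in Hk. rewrite Hc by lia. do 2 f_equal. lia.
      * apply nth_In. lia.
    + intros f Hf. destruct (HS f Hf) as [c Hc]. exists (fun k => c (nth (k - 1) l d0)).
      intro x. now rewrite Hc, (lsum_nth d0), sum_n_m_lsum.
Qed.

(** * A basis of rotation eigenvectors *)

Lemma Db_Dz_sect d f z : sect d f -> Db (nu d) (Dz (nu d) f) z = (- (2 * nu d) * f z)%C.
Proof.
  intros [H [_ B]]. assert (E := commutator (nu d) f z H).
  replace (Db (nu d) f) with (fun z => (0 * f z)%C) in E by (extensionality u; rewrite B; ring).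
  rewrite Dz_scal in E by exact H.
  transitivity (Db (nu d) (Dz (nu d) f) z + 2 * nu d * f z - 2 * nu d * f z)%C; [ring|].
  rewrite <- E. ring.
Qed.

Definition wsigma1 : C -> C := Dz (nu 1) wsigma.
Definition wsigma2 : C -> C := Dz (nu 1) wsigma1.

(** The products below are brackets of Rankin-Cohen type: [Dz] does not
    preserve the equation [Db = 0], but the defects cancel in these combinations.
    Up to constants they are sigma^2 wp and sigma^3 wp'. *)
Definition wp2 (z : C) : C := (1 * (wsigma z * wsigma2 z) + - (1) * (wsigma1 z * wsigma1 z))%C.
Definition wp3 (z : C) : C := (1 * (wsigma z * Dz (nu 2) wp2 z) + - (2) * (wp2 z * wsigma1 z))%C.

Lemma psmooth_wsigma1 : psmooth wsigma1.
Proof. apply psmooth_Dz, psmooth_wsigma. Qed.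

Lemma psmooth_wsigma2 : psmooth wsigma2.
Proof. apply psmooth_Dz, psmooth_wsigma1. Qed.

Lemma Db_wsigma1 z : Db (nu 1) wsigma1 z = (- (2 * nu 1) * wsigma z)%C.
Proof. apply Db_Dz_sect, sect_wsigma. Qed.

Lemma Db_wsigma2 z : Db (nu 1) wsigma2 z = (- (4 * nu 1) * wsigma1 z)%C.
Proof.
  assert (E := commutator (nu 1) wsigma1 z psmooth_wsigma1).
  replace (Db (nu 1) wsigma1) with (fun z => (- (2 * nu 1) * wsigma z)%C) in E
    by (extensionality u; now rewrite Db_wsigma1).
  rewrite Dz_scal in E by apply psmooth_wsigma. fold wsigma1 wsigma2 in E.
  transitivity (Db (nu 1) wsigma2 z + 2 * nu 1 * wsigma1 z - 2 * nu 1 * wsigma1 z)%C; [ring|].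
  rewrite <- E. ring.
Qed.

Lemma sect_wp2 : sect 2 wp2.
Proof.
  assert (H0 := psmooth_wsigma). assert (H1 := psmooth_wsigma1). assert (H2 := psmooth_wsigma2).
  destruct sect_wsigma as [_ [Q0 B0]].
  assert (Q1 : quasi 1 wsigma1) by now apply quasi_Dz.
  assert (Q2 : quasi 1 wsigma2) by now apply quasi_Dz.
  split; [|split].
  - apply psmooth_comb; now apply psmooth_mult.
  - apply quasi_comb; change 2%Z with (1 + 1)%Z; now apply quasi_mult.
  - intro z. unfold wp2. change 2%Z with (1 + 1)%Z.
    rewrite nu_plus, Db_comb, !Db_mult by first [assumption | apply psmooth_mult; assumption].
    rewrite B0, Db_wsigma1, Db_wsigma2. ring.
Qed.

Lemma sect_wp3 : sect 3 wp3.
Proof.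
  assert (H0 := psmooth_wsigma). assert (H1 := psmooth_wsigma1).
  destruct sect_wsigma as [_ [Q0 B0]].
  assert (Q1 : quasi 1 wsigma1) by now apply quasi_Dz.
  assert (S2 := sect_wp2). destruct S2 as [H2 [Q2 B2]].
  assert (H3 := psmooth_Dz (nu 2) wp2 H2).
  assert (Q3 := quasi_Dz 2 wp2 H2 Q2).
  split; [|split].
  - apply psmooth_comb; now apply psmooth_mult.
  - apply quasi_comb; [change 3%Z with (1 + 2)%Z | change 3%Z with (2 + 1)%Z]; now apply quasi_mult.
  - intro z. unfold wp3.
    rewrite Db_comb by now apply psmooth_mult.
    assert (X : Db (nu 3) (fun z => wsigma z * Dz (nu 2) wp2 z)%C z =
      (Db (nu 1) wsigma z * Dz (nu 2) wp2 z + wsigma z * Db (nu 2) (Dz (nu 2) wp2) z)%C).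
    { change 3%Z with (1 + 2)%Z. rewrite nu_plus. now apply Db_mult. }
    assert (Y : Db (nu 3) (fun z => wp2 z * wsigma1 z)%C z =
      (Db (nu 2) wp2 z * wsigma1 z + wp2 z * Db (nu 1) wsigma1 z)%C).
    { change 3%Z with (2 + 1)%Z. rewrite nu_plus. now apply Db_mult. }
    rewrite X, Y.
    rewrite B0, Db_wsigma1, B2, (Db_Dz_sect 2 wp2) by apply sect_wp2.
    assert (N2 : nu 2 = nu 1 + nu 1) by (rewrite <- nu_plus; reflexivity).
    rewrite N2, RtoC_plus. ring.
Qed.

Lemma rotates_wsigma1 : rotates 1 wsigma1.
Proof.
  replace (RtoC 1) with (eta / eta)%C by (field; apply eta_neq_0).
  apply rotates_Dz; [apply psmooth_wsigma | apply rotates_wsigma].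
Qed.

Lemma rotates_wp2 : rotates 1 wp2.
Proof.
  assert (R2 : rotates (1 / eta) wsigma2) by (apply rotates_Dz; [apply psmooth_wsigma1 | apply rotates_wsigma1]).
  apply rotates_comb.
  - replace (RtoC 1) with (eta * (1 / eta))%C by (field; apply eta_neq_0).
    apply rotates_mult; [apply rotates_wsigma | exact R2].
  - replace (RtoC 1) with (1 * 1)%C by ring. apply rotates_mult; apply rotates_wsigma1.
Qed.

Lemma rotates_wp3 : rotates 1 wp3.
Proof.
  assert (R2 : rotates (1 / eta) (Dz (nu 2) wp2)).
  { apply rotates_Dz; [apply sect_wp2 | apply rotates_wp2]. }
  apply rotates_comb.
  - replace (RtoC 1) with (eta * (1 / eta))%C by (field; apply eta_neq_0).
    apply rotates_mult; [apply rotates_wsigma | exact R2].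
  - replace (RtoC 1) with (1 * 1)%C by ring.
    apply rotates_mult; [apply rotates_wp2 | apply rotates_wsigma1].
Qed.

Lemma wp2_0 : wp2 0 <> 0.
Proof.
  unfold wp2. rewrite wsigma_0.
  replace (1 * (0 * wsigma2 0) + - (1) * (wsigma1 0 * wsigma1 0))%C with (- (1) * (wsigma1 0 * wsigma1 0))%C by ring.
  assert (D := Dz_wsigma_0). fold wsigma1 in D. repeat apply Cmult_neq_0; try exact D.
  intro E. apply (f_equal Re) in E. simpl in E. lra.
Qed.

Lemma wp3_0 : wp3 0 <> 0.
Proof.
  unfold wp3. rewrite wsigma_0.
  replace (1 * (0 * Dz (nu 2) wp2 0) + - (2) * (wp2 0 * wsigma1 0))%C
    with (- (2) * (wp2 0 * wsigma1 0))%C by ring.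
  repeat apply Cmult_neq_0; [|apply wp2_0 | apply Dz_wsigma_0].
  intro E. apply (f_equal Re) in E. simpl in E. lra.
Qed.

(** Rotation invariant sections that do not vanish at the origin exist in
    every degree except one. *)
Fixpoint inv_sect (e : nat) : C -> C :=
  match e with
  | O => fun _ => RtoC 1
  | S O => fun _ => RtoC 0
  | S (S e') => match e' with
                | S O => wp3
                | _ => fun z => (wp2 z * inv_sect e' z)%C
                end
  end.

Lemma sect_one : sect 0 (fun _ => RtoC 1).
Proof.
  assert (N : nu 0 = 0) by (unfold nu; field; generalize sqrt3_pos; lra).
  split; [apply psmooth_const | split].
  - split; intro z; rewrite N, !Rmult_0_r, !Rmult_0_l, Rminus_0_r, cis_0; ring.
  - intro z. unfold Db. rewrite N, (pgrad_pdx _ _ _ (pgrad_const 1)), (pgrad_pdy _ _ _ (pgrad_const 1)).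
    ring.
Qed.

Lemma inv_sect_spec e : e <> 1%nat ->
  sect (Z.of_nat e) (inv_sect e) /\ rotates 1 (inv_sect e) /\ inv_sect e 0 <> 0.
Proof.
  assert (H : forall e, (e <> 1%nat ->
      sect (Z.of_nat e) (inv_sect e) /\ rotates 1 (inv_sect e) /\ inv_sect e 0 <> 0) /\
    (S e <> 1%nat ->
      sect (Z.of_nat (S e)) (inv_sect (S e)) /\ rotates 1 (inv_sect (S e)) /\ inv_sect (S e) 0 <> 0)).
  { clear e. induction e as [|e [IH1 IH2]].
    - split; [intros _|easy]. split; [apply sect_one | split; [intro z; simpl; ring | apply C1_nz]].
    - split; [exact IH2|]. intros _. destruct (Nat.eq_dec e 1) as [->|He].
      + split; [apply sect_wp3 | split; [apply rotates_wp3 | apply wp3_0]].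
      + destruct (IH1 He) as [A [B D]].
        replace (inv_sect (S (S e))) with (fun z => (wp2 z * inv_sect e z)%C)
          by (destruct e as [|[|e]]; [reflexivity | now elim He | reflexivity]).
        split; [|split].
        * replace (Z.of_nat (S (S e))) with (2 + Z.of_nat e)%Z by lia.
          apply sect_mult; [apply sect_wp2 | exact A].
        * replace (RtoC 1) with (1 * 1)%C by ring. apply rotates_mult; [apply rotates_wp2 | exact B].
        * apply Cmult_neq_0; [apply wp2_0 | exact D]. }
  intro He. now apply H.
Qed.

Definition eig (d a : nat) (z : C) : C := (wsigma z ^ a * inv_sect (d - a) z)%C.

Lemma sect_wsigma_pow a : sect (Z.of_nat a) (fun z => wsigma z ^ a)%C.
Proof.
  induction a as [|a IH]; [apply sect_one|].
  replace (Z.of_nat (S a)) with (1 + Z.of_nat a)%Z by lia.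
  apply (sect_mult 1 (Z.of_nat a) wsigma); [apply sect_wsigma | exact IH].
Qed.

Lemma eig_spec d a : (a <= d)%nat -> (d - a <> 1)%nat ->
  sect (Z.of_nat d) (eig d a) /\ rotates (eta ^ a) (eig d a).
Proof.
  intros Ha Hd. destruct (inv_sect_spec (d - a) Hd) as [A [B _]]. split.
  - replace (Z.of_nat d) with (Z.of_nat a + Z.of_nat (d - a))%Z by lia.
    apply sect_mult; [apply sect_wsigma_pow | exact A].
  - replace (eta ^ a)%C with (eta ^ a * 1)%C by ring. apply (rotates_mult _ _ (fun z => wsigma z ^ a)%C); [|exact B].
    intro z. rewrite rotates_wsigma. apply Cpow_mult_l.
Qed.

(** The orders of vanishing at the origin of the sections of degree [d]. The order
    [d - 1] is missing: the [d] zeros add up to a lattice point, so if [d - 1] of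
    them are at the origin then so is the last one. *)
Definition orders (d : nat) : list nat := seq 0 (d - 1) ++ d :: nil.

Lemma in_orders d a : (0 < d)%nat -> In a (orders d) <-> (a <= d /\ d - a <> 1)%nat.
Proof. intro Hd. unfold orders. rewrite in_app_iff, in_seq. simpl. lia. Qed.

Lemma orders_NoDup d : (0 < d)%nat -> NoDup (orders d).
Proof.
  intro Hd. unfold orders. apply (Permutation_NoDup (l := d :: seq 0 (d - 1))).
  - apply Permutation_cons_append.
  - constructor; [rewrite in_seq; lia | apply seq_NoDup].
Qed.

Lemma orders_length d : (0 < d)%nat -> length (orders d) = d.
Proof. intro Hd. unfold orders. rewrite length_app, length_seq. simpl. lia. Qed.

Lemma psmooth_lsum {I} (l : list I) (u : I -> C -> C) : (forall i, In i l -> psmooth (u i)) ->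
  psmooth (fun z => lsum l (fun i => u i z)).
Proof.
  induction l as [|i l IH]; intro H; [exact (psmooth_const 0)|]. simpl.
  apply psmooth_plus; [apply H; now left|]. apply IH. intros; apply H; now right.
Qed.

Lemma sect_zero_fun d : sect d (fun _ => RtoC 0).
Proof.
  split; [apply psmooth_const | split; [split; intro z; ring | intro z; apply Db_zero]].
Qed.

Lemma sect_lsum {I} d (l : list I) (c : I -> C) (u : I -> C -> C) :
  (forall i, In i l -> sect d (u i)) ->
  sect d (fun z => lsum l (fun i => c i * u i z)%C) /\
  forall m, tcoef d (fun z => lsum l (fun i => c i * u i z)%C) m
            = lsum l (fun i => c i * tcoef d (u i) m)%C.
Proof.
  induction l as [|i l IH]; intro H.
  - split; [apply sect_zero_fun|]. intro m. simpl.
    replace (fun _ : C => RtoC 0) with (fun z : C => 0 * (fun _ => RtoC 0) z + 0 * (fun _ => RtoC 0) z)%C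
      by (extensionality z; ring).
    rewrite tcoef_comb by apply psmooth_const. ring.
  - destruct IH as [A B]. { intros; apply H; now right. }
    assert (Hi : sect d (u i)) by (apply H; now left).
    assert (E : (fun z => lsum (i :: l) (fun i => c i * u i z)%C) =
                (fun z => c i * u i z + 1 * lsum l (fun i => c i * u i z))%C).
    { extensionality z. simpl. ring. }
    rewrite E. split; [now apply sect_comb|].
    intro m. rewrite tcoef_comb by (apply Hi || apply A). rewrite B. simpl. ring.
Qed.

Lemma nonzero_near_0 (g : R -> C) l : cder g 0 l -> l <> 0 -> g 0 = 0 ->
  exists d : posreal, forall x, x <> 0 -> Rabs x < d -> g x <> 0.
Proof.
  intros [H1 H2] Hl H0.
  assert (K : forall f k, is_derive f 0 k -> k <> 0 -> f 0 = 0 ->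
    exists d : posreal, forall x, x <> 0 -> Rabs x < d -> f x <> 0).
  { intros f k Hf Hk Hf0. apply is_derive_Reals in Hf.
    destruct (Hf (Rabs k)) as [d Hd]; [now apply Rabs_pos_lt|].
    exists d. intros x Hx Hxd E. specialize (Hd x Hx Hxd).
    rewrite Rplus_0_l, E, Hf0 in Hd. unfold Rdiv in Hd.
    rewrite Rminus_diag, Rmult_0_l, Rminus_0_l, Rabs_Ropp in Hd. lra. }
  destruct (Req_EM_T (Re l) 0) as [E|E].
  - destruct (K _ _ H2) as [d Hd].
    + intro E2. apply Hl. now apply C_eq.
    + now rewrite H0.
    + exists d. intros x Hx Hxd E2. apply (Hd x Hx Hxd). now rewrite E2.
  - destruct (K _ _ H1 E) as [d Hd]; [now rewrite H0|].
    exists d. intros x Hx Hxd E2. apply (Hd x Hx Hxd). now rewrite E2.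
Qed.

Lemma zero_at_0 (g : R -> C) (d : posreal) : @ccont R_UniformSpace g 0 ->
  (forall x, x <> 0 -> Rabs x < d -> g x = 0) -> g 0 = 0.
Proof.
  intros Hc H0.
  assert (K : forall f : R -> R, continuous f 0 -> (forall x, x <> 0 -> Rabs x < d -> f x = 0) -> f 0 = 0).
  { intros f Hf Hz. apply NNPP. intro Hne.
    assert (P : 0 < Rabs (f 0)) by now apply Rabs_pos_lt.
    destruct (proj1 (filterlim_locally f (f 0)) Hf (mkposreal _ P)) as [e He].
    set (x := Rmin (d / 2) (e / 2)).
    assert (Hx : 0 < x).
    { apply Rmin_pos; [generalize (cond_pos d) | generalize (cond_pos e)]; lra. }
    assert (X1 := Rmin_l (d / 2) (e / 2)). assert (X2 := Rmin_r (d / 2) (e / 2)). fold x in X1, X2.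
    assert (Pd := cond_pos d). assert (Pe := cond_pos e).
    specialize (He x). assert (B : Rabs (f x - f 0) < Rabs (f 0)).
    { apply He. change (Rabs (x - 0) < e). rewrite Rminus_0_r, Rabs_pos_eq; lra. }
    rewrite Hz in B; [|lra|rewrite Rabs_pos_eq; lra].
    rewrite Rminus_0_l, Rabs_Ropp in B. lra. }
  apply C_eq.
  - apply (K (fun x => Re (g x))); [now apply (ccont_Re (X := R_UniformSpace))|].
    intros x Hx Hd. now rewrite H0.
  - apply (K (fun x => Im (g x))); [now apply (ccont_Im (X := R_UniformSpace))|].
    intros x Hx Hd. now rewrite H0.
Qed.

(** The [eig d a] are independent because they vanish at the origin to distinct
    orders [a]. *)
Lemma eig_independent d (c : nat -> C) : (0 < d)%nat ->
  (forall z, lsum (orders d) (fun a => c a * eig d a z)%C = 0) ->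
  forall a, In a (orders d) -> c a = 0.
Proof.
  intros Hd Hz a. induction a as [a IH] using lt_wf_ind. intro Ha.
  assert (ND := orders_NoDup d Hd).
  (* The sum divided by the power [a] of [wsigma]. *)
  set (H := fun z => lsum (orders d) (fun b =>
     (if lt_dec b a then 0 else c b) * (wsigma z ^ (b - a) * inv_sect (d - b) z))%C).
  assert (PH : psmooth H).
  { unfold H. apply psmooth_lsum. intros b Hb. apply in_orders in Hb; [|exact Hd].
    apply (psmooth_mult (fun _ => if lt_dec b a then RtoC 0 else c b)); [apply psmooth_const|].
    apply psmooth_mult; [apply sect_wsigma_pow | now apply inv_sect_spec]. }
  assert (F : forall z, (wsigma z ^ a * H z = 0)%C).
  { intro z. rewrite <- (Hz z). unfold H. rewrite <- lsum_scal. apply lsum_ext. intros b Hb.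
    destruct (lt_dec b a) as [L|L].
    - rewrite (IH b L Hb). ring.
    - unfold eig.
      assert (Eb : (wsigma z ^ b = wsigma z ^ a * wsigma z ^ (b - a))%C) by (rewrite <- Cpow_add_r; f_equal; lia).
      rewrite Eb. ring. }
  assert (H00 : H 0 = (c a * inv_sect (d - a) 0)%C).
  { unfold H. rewrite (lsum_single _ _ a ND Ha).
    - destruct (lt_dec a a); [lia|]. rewrite Nat.sub_diag. simpl. ring.
    - intros b Hb Hba. destruct (lt_dec b a) as [L|L]; [ring|].
      rewrite wsigma_0. replace (b - a)%nat with (S (b - a - 1)) by lia. rewrite Cpow_S. ring. }
  destruct (nonzero_near_0 (fun x => wsigma (x, 0)) (pdx wsigma 0)) as [e He].
  - apply (psmooth_pgrad _ psmooth_wsigma (0, 0)).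
  - apply pdx_wsigma_0.
  - apply wsigma_0.
  - assert (E0 : H 0 = 0).
    { apply (zero_at_0 (fun x => H (x, 0)) e).
      - apply continuous_slice. intro; now apply psmooth_cont.
      - intros x Hx Hxe. destruct (Cmult_integral _ _ (F (x, 0))) as [E|E]; [|exact E].
        exfalso. revert E. apply Cpow_nz. now apply He. }
    rewrite H00 in E0. apply Cmult_integral in E0. destruct E0 as [E|E]; [exact E|].
    exfalso. revert E. apply inv_sect_spec. apply in_orders in Ha; tauto.
Qed.

(** A section and the [d] sections [eig d a] have [d] coefficients each that
    determine them, so they are dependent. *)
Lemma eig_spanning d f : (0 < d)%nat -> sect (Z.of_nat d) f ->
  exists c : nat -> C, forall z, f z = lsum (orders d) (fun a => c a * eig d a z)%C.
Proof.
  intros Hd Hf.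
  set (u := fun o : option nat => match o with None => f | Some a => eig d a end).
  set (l := None :: map Some (orders d)).
  assert (Hu : forall o, In o l -> sect (Z.of_nat d) (u o)).
  { intros [a|] Ho; [|exact Hf]. destruct Ho as [Ho|Ho]; [easy|].
    apply in_map_iff in Ho. destruct Ho as [b [E Hb]]. injection E as <-.
    apply in_orders in Hb; [|exact Hd]. now apply eig_spec. }
  assert (dec : forall i j : option nat, {i = j} + {i <> j}).
  { decide equality. apply Nat.eq_dec. }
  destruct (linear_dependence _ dec d l (fun o k => tcoef (Z.of_nat d) (u o) (Z.of_nat k)))
    as [c [[i [Hi Hci]] Hc]].
  - constructor.
    + rewrite in_map_iff. intros [b [E _]]. discriminate.
    + apply FinFun.Injective_map_NoDup; [intros x y E; now injection E | now apply orders_NoDup].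
  - simpl. rewrite length_map, orders_length; auto.
  - destruct (sect_lsum (Z.of_nat d) l c u Hu) as [A B].
    assert (Z0 : forall z, lsum l (fun o => c o * u o z)%C = 0).
    { apply (sect_determined (Z.of_nat d)); [lia | exact A |].
      intros m Hm. rewrite B. rewrite <- (Z2Nat.id m) by lia. apply Hc. lia. }
    assert (E : forall z, (c None * f z + lsum (orders d) (fun a => c (Some a) * eig d a z) = 0)%C).
    { intro z. rewrite <- (Z0 z). simpl. rewrite lsum_map. reflexivity. }
    assert (Hn : c None <> 0).
    { intro Hn. apply Hci. destruct Hi as [<-|Hi]; [exact Hn|].
      apply in_map_iff in Hi. destruct Hi as [a [<- Ha]].
      apply (eig_independent d (fun a => c (Some a)) Hd); [|exact Ha].
      intro z. rewrite <- (E z), Hn. ring. }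
    exists (fun a => - / c None * c (Some a))%C. intro z.
    apply (Cmult_cancel (c None) _ _ Hn).
    rewrite (lsum_ext _ _ (fun a => - / c None * (c (Some a) * eig d a z))%C) by (intros; ring).
    rewrite lsum_scal. apply Ceq_minus. rewrite <- (E z). field. exact Hn.
Qed.

(** * Eigenspaces of the rotation, and the multiplicity formula *)

Lemma eta_pow6 : (eta ^ 6 = 1)%C.
Proof.
  rewrite eta_cis, cis_pow. replace (INR 6 * (PI / 3)) with (2 * PI * 1) by (simpl; field).
  apply (cis_2PI_Z 1).
Qed.

Lemma eta_pow_mod a : (eta ^ a = eta ^ (a mod 6))%C.
Proof.
  rewrite (Nat.div_mod a 6) at 1 by lia.
  rewrite Cpow_add_r, Cpow_mult_r, eta_pow6, Cpow_1_l. ring.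
Qed.

Lemma eta_sq : (eta * eta = eta - 1)%C.
Proof. rewrite eta_val. assert (S := sqrt3_sq). apply C_eq; unfold Re, Im; simpl; field [S]. Qed.

Lemma eta_pow_eq a b : (eta ^ a = eta ^ b)%C -> a mod 6 = b mod 6.
Proof.
  rewrite (eta_pow_mod a), (eta_pow_mod b).
  assert (Ha : (a mod 6 < 6)%nat) by (apply Nat.mod_upper_bound; lia).
  assert (Hb : (b mod 6 < 6)%nat) by (apply Nat.mod_upper_bound; lia).
  generalize dependent (a mod 6). generalize dependent (b mod 6). clear. intros b Hb a Ha.
  assert (P : forall n, (eta ^ n)%C = (cos (INR n * (PI / 3)), sin (INR n * (PI / 3)))).
  { intro n. rewrite eta_cis. apply cis_pow. }
  assert (E2 : (eta ^ 2)%C = (- (1 / 2), sqrt 3 / 2)) by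
    (simpl; rewrite Cmult_1_r, eta_sq, eta_val; cfield).
  assert (E3 : (eta ^ 3)%C = (- (1))%C).
  { replace (eta ^ 3)%C with (eta * eta * eta)%C by (simpl; ring). rewrite eta_sq.
    transitivity (eta * eta - eta)%C; [ring|]. rewrite eta_sq. ring. }
  assert (T : forall n, (n < 6)%nat -> (eta ^ n)%C =
    match n with 0 => (1, 0) | 1 => (1 / 2, sqrt 3 / 2) | 2 => (- (1 / 2), sqrt 3 / 2)
    | 3 => (-1, 0) | 4 => (- (1 / 2), - (sqrt 3 / 2)) | _ => (1 / 2, - (sqrt 3 / 2)) end).
  { intros n Hn. destruct n as [|[|[|[|[|[|n]]]]]]; [| | | | | |lia].
    - reflexivity.
    - rewrite Cpow_1_r. apply eta_val.
    - exact E2.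
    - rewrite E3. cring.
    - change (eta ^ 4)%C with (eta ^ (3 + 1))%C. rewrite Cpow_add_r, E3, Cpow_1_r, eta_val. cfield.
    - change (eta ^ 5)%C with (eta ^ (3 + 2))%C. rewrite Cpow_add_r, E3, E2. cfield. }
  rewrite !T by assumption. clear P T E2 E3.
  assert (S := sqrt3_pos).
  destruct a as [|[|[|[|[|[|a]]]]]]; [| | | | | |lia];
    (destruct b as [|[|[|[|[|[|b]]]]]]; [| | | | | |lia]);
    intro E; try reflexivity; exfalso;
    assert (E1 := f_equal fst E); assert (E2 := f_equal snd E); simpl in E1, E2; lra.
Qed.

Definition level0 (d j : nat) (f : C -> C) : Prop :=
  sect (Z.of_nat d) f /\ rotates (eta ^ j) f.

Definition mult_count (d j : nat) : nat :=
  length (filter (fun a => a mod 6 =? j mod 6)%nat (orders d)).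

(** The condition on the rotation removes the basis vectors with another
    eigenvalue. *)
Lemma has_dim_level0 d j : (0 < d)%nat -> has_dim (level0 d j) (mult_count d j).
Proof.
  intro Hd. apply (has_dim_list Nat.eq_dec _ (eig d)).
  - apply NoDup_filter, orders_NoDup, Hd.
  - intros a Ha. apply filter_In in Ha. destruct Ha as [Ha E].
    apply in_orders in Ha; [|exact Hd]. destruct (eig_spec d a) as [A B]; try tauto.
    split; [exact A|]. apply Nat.eqb_eq in E. now rewrite eta_pow_mod, <- E, <- eta_pow_mod.
  - intros c Hc a Ha.
    set (c' := fun a => if (a mod 6 =? j mod 6)%nat then c a else RtoC 0).
    assert (Z0 : forall b, In b (orders d) -> c' b = 0).
    { intros b Hb. apply (eig_independent d c' Hd); [|exact Hb]. intro z.
      rewrite <- (Hc z). rewrite (lsum_filter (fun a => a mod 6 =? j mod 6)%nat).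
      - apply lsum_ext. intros i Hi. apply filter_In in Hi. unfold c'. now rewrite (proj2 Hi).
      - intros i _ Hi. unfold c'. rewrite Hi. ring. }
    apply filter_In in Ha. destruct Ha as [Ha E]. specialize (Z0 a Ha). unfold c' in Z0.
    now rewrite E in Z0.
  - intros f [Hf Hr]. destruct (eig_spanning d f Hd Hf) as [c Hc]. exists c. intro z.
    rewrite Hc. apply lsum_filter. intros a Ha E.
    assert (K : forall b, In b (orders d) -> (c b * (eta ^ b - eta ^ j))%C = 0).
    { apply (eig_independent d (fun b => c b * (eta ^ b - eta ^ j))%C Hd). intro w.
      transitivity (f (eta * w) - eta ^ j * f w)%C; [|rewrite Hr; ring].
      rewrite !Hc.
      transitivity (lsum (orders d) (fun b => c b * eig d b (eta * w))%C
        + - eta ^ j * lsum (orders d) (fun b => c b * eig d b w))%C; [|ring].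
      rewrite <- lsum_scal, <- lsum_plus. apply lsum_ext. intros b Hb.
      apply in_orders in Hb; [|exact Hd]. destruct (eig_spec d b) as [_ R]; try tauto.
      rewrite R. ring. }
    destruct (Cmult_integral _ _ (K a Ha)) as [Ea|Ea]; [rewrite Ea; ring|].
    exfalso. apply Nat.eqb_neq in E. apply E, eta_pow_eq, Ceq_minus, Ea.
Qed.

Lemma cos_period_Z x (k : Z) : cos (x + 2 * IZR k * PI) = cos x.
Proof.
  destruct (Z_le_gt_dec 0 k) as [H|H].
  - rewrite <- (Z2Nat.id k H), <- INR_IZR_INZ. apply cos_period.
  - rewrite <- (cos_period (x + 2 * IZR k * PI) (Z.to_nat (- k))). f_equal.
    rewrite INR_IZR_INZ, Z2Nat.id, opp_IZR by lia. ring.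
Qed.

Lemma cos_PI_third (m : Z) : 2 * cos (PI * IZR m / 3) =
  match (m mod 6)%Z with 0%Z => 2 | 1%Z => 1 | 2%Z => -1 | 3%Z => -2 | 4%Z => -1 | _ => 1 end.
Proof.
  assert (B := Z.mod_pos_bound m 6 ltac:(lia)).
  rewrite (Z.div_mod m 6) at 1 by lia. set (r := (m mod 6)%Z) in *.
  rewrite plus_IZR, mult_IZR.
  replace (PI * (6 * IZR (m / 6) + IZR r) / 3) with (IZR r * (PI / 3) + 2 * IZR (m / 6) * PI) by field.
  rewrite cos_period_Z. clearbody r.
  assert (H : r = 0%Z \/ r = 1%Z \/ r = 2%Z \/ r = 3%Z \/ r = 4%Z \/ r = 5%Z) by lia.
  destruct H as [->|[->|[->|[->|[->| ->]]]]].
  - rewrite Rmult_0_l, cos_0. ring.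
  - rewrite Rmult_1_l, cos_PI3. field.
  - replace (2 * (PI / 3)) with (- (PI / 3) + PI) by field. rewrite neg_cos, cos_neg, cos_PI3. field.
  - replace (3 * (PI / 3)) with PI by field. rewrite cos_PI. ring.
  - replace (4 * (PI / 3)) with (PI / 3 + PI) by field. rewrite neg_cos, cos_PI3. field.
  - replace (5 * (PI / 3)) with (- (PI / 3) + 2 * PI) by field.
    replace (- (PI / 3) + 2 * PI) with (- (PI / 3) + 2 * IZR 1 * PI) by ring.
    rewrite cos_period_Z, cos_neg, cos_PI3. field.
Qed.

Lemma cos_2PI_third (m : Z) : 2 / sqrt 3 * cos (2 * PI * IZR m / 3 - PI / 6) =
  match (m mod 3)%Z with 0%Z => 1 | 1%Z => 0 | _ => -1 end.
Proof.
  assert (B := Z.mod_pos_bound m 3 ltac:(lia)).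
  assert (S := sqrt3_pos).
  rewrite (Z.div_mod m 3) at 1 by lia. set (r := (m mod 3)%Z) in *.
  rewrite plus_IZR, mult_IZR.
  replace (2 * PI * (3 * IZR (m / 3) + IZR r) / 3 - PI / 6)
    with ((2 * PI * IZR r / 3 - PI / 6) + 2 * IZR (m / 3) * PI) by field.
  rewrite cos_period_Z. clearbody r.
  assert (H : r = 0%Z \/ r = 1%Z \/ r = 2%Z) by lia.
  destruct H as [->|[->| ->]].
  - replace (2 * PI * 0 / 3 - PI / 6) with (- (PI / 6)) by field. rewrite cos_neg, cos_PI6. field. lra.
  - replace (2 * PI * 1 / 3 - PI / 6) with (PI / 2) by field. rewrite cos_PI2. ring.
  - replace (2 * PI * 2 / 3 - PI / 6) with (PI / 6 + PI) by field. rewrite neg_cos, cos_PI6. field. lra.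
Qed.

Lemma filter_seq_shift6 (p : nat -> bool) s n : (forall a, p (6 + a)%nat = p a) ->
  length (filter p (seq (6 + s) n)) = length (filter p (seq s n)).
Proof.
  intro Hp. revert s. induction n as [|n IH]; intro s; [reflexivity|].
  change (seq (6 + s) (S n)) with ((6 + s)%nat :: seq (6 + S s) n).
  change (seq s (S n)) with (s :: seq (S s) n).
  cbn [filter]. rewrite Hp. destruct (p s); cbn [length]; now rewrite IH.
Qed.

Lemma mult_count_step d j : (0 < d)%nat -> mult_count (6 + d) j = S (mult_count d j).
Proof.
  intro Hd. unfold mult_count, orders.
  set (p := fun a => (a mod 6 =? j mod 6)%nat).
  assert (Hp : forall a, p (6 + a)%nat = p a).
  { intro a. unfold p. replace (6 + a)%nat with (a + 1 * 6)%nat by lia. now rewrite Nat.Div0.mod_add. }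
  rewrite !filter_app, !length_app. cbn [filter]. rewrite Hp.
  replace (6 + d - 1)%nat with (6 + (d - 1))%nat by lia.
  rewrite seq_app, filter_app, length_app.
  replace (0 + 6)%nat with (6 + 0)%nat by reflexivity.
  rewrite (filter_seq_shift6 p 0 (d - 1) Hp).
  replace (length (filter p (seq 0 6))) with 1%nat.
  { destruct (p d); cbn [length]; lia. }
  unfold p. assert (H : (j mod 6 < 6)%nat) by (apply Nat.mod_upper_bound; lia).
  generalize dependent (j mod 6). clear. intros j H.
  do 6 (destruct j as [|j]; [reflexivity|]). lia.
Qed.

Lemma mult_count_mod d j : mult_count d j = mult_count d (j mod 6).
Proof. unfold mult_count. now rewrite Nat.Div0.mod_mod. Qed.

(** The factor 4 of the last term is split so that its cosine has the same
    coefficient as that of the previous one. *)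
Definition mult_formula (d j : Z) (s : R) : R :=
  1 / 6 * (IZR d + 2 * s
           + 2 * cos (PI * IZR (j - 1) / 3)
           + 2 / sqrt 3 * cos (2 * PI * IZR j / 3 - PI / 6)
           + 2 * (2 / sqrt 3 * cos (2 * PI * IZR (j - d) / 3 - PI / 6))).

(** Both sides grow by one when [d] grows by six and only depend on the residue
    of [j] modulo six, which leaves finitely many cases. *)
Lemma mult_count_formula d j : (0 < d)%nat -> Nat.Even d ->
  INR (mult_count d j) = mult_formula (Z.of_nat d) (Z.of_nat j) ((-1) ^ j).
Proof.
  intros Hd He.
  assert (Ed : exists q e, d = (6 * q + e)%nat /\ (e = 2 \/ e = 4 \/ e = 6)%nat).
  { destruct He as [h ->]. exists ((h - 1) / 3)%nat, (2 * ((h - 1) mod 3) + 2)%nat.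
    assert (H := Nat.div_mod (h - 1) 3 ltac:(lia)).
    assert (H' := Nat.mod_upper_bound (h - 1) 3 ltac:(lia)).
    revert H H'. generalize ((h - 1) / 3)%nat ((h - 1) mod 3). intros; lia. }
  destruct Ed as [q [e [-> Ee]]]. clear He Hd.
  assert (Ej := Nat.div_mod j 6 ltac:(lia)).
  assert (Bj := Nat.mod_upper_bound j 6 ltac:(lia)).
  rewrite mult_count_mod. rewrite Ej at 2 3. set (p := (j / 6)%nat) in *.
  generalize dependent (j mod 6). intros i Ej Bi. clearbody p. clear Ej j.
  assert (Ec : INR (mult_count (6 * q + e) i) = INR q + INR (mult_count e i)).
  { induction q as [|q IH].
    - simpl INR at 2. rewrite Rplus_0_l. reflexivity.
    - replace (6 * S q + e)%nat with (6 + (6 * q + e))%nat by lia.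
      rewrite mult_count_step, !S_INR, IH by lia. ring. }
  assert (Es : (-1) ^ (6 * p + i) = (-1) ^ i).
  { rewrite pow_add, pow_mult. replace ((-1) ^ 6) with 1 by ring. rewrite pow1. ring. }
  unfold mult_formula. rewrite Ec, Es, cos_PI_third, !cos_2PI_third.
  rewrite !Nat2Z.inj_add, !Nat2Z.inj_mul, !plus_IZR, !mult_IZR, <- !INR_IZR_INZ.
  replace (Z.of_nat 6 * Z.of_nat p + Z.of_nat i - 1)%Z with ((Z.of_nat i - 1) + Z.of_nat p * 6)%Z by lia.
  replace (Z.of_nat 6 * Z.of_nat p + Z.of_nat i - (Z.of_nat 6 * Z.of_nat q + Z.of_nat e))%Z
    with ((Z.of_nat i - Z.of_nat e) + (2 * Z.of_nat p - 2 * Z.of_nat q) * 3)%Z by lia.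
  replace (Z.of_nat 6 * Z.of_nat p + Z.of_nat i)%Z with (Z.of_nat i + (2 * Z.of_nat p) * 3)%Z by lia.
  rewrite !Z_mod_plus_full.
  generalize (INR q). clear - Ee Bi. intro x.
  destruct Ee as [->|[->| ->]]; do 6 (destruct i as [|i]; [unfold mult_count; simpl; field|]); lia.
Qed.

(** * Transport of dimensions *)

Lemma has_dim_transport {X Y : Type} (V : (X -> C) -> Prop) (W : (Y -> C) -> Prop)
  (L : (Y -> C) -> X -> C) m :
  W (fun _ => RtoC 0) ->
  (forall a b f g, W f -> W g -> W (fun y => a * f y + b * g y)%C) ->
  (forall a b f g, W f -> W g -> forall x,
     L (fun y => a * f y + b * g y)%C x = (a * L f x + b * L g x)%C) ->
  (forall w, W w -> V (L w)) ->
  (forall w, W w -> (forall x, L w x = 0) -> forall y, w y = 0) ->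
  (forall v, V v -> exists w, W w /\ forall x, v x = L w x) ->
  has_dim W m -> has_dim V m.
Proof.
  intros W0 WC LC LV Linj Lsurj [e [He [HI HS]]].
  assert (L0 : forall x, L (fun _ => RtoC 0) x = 0).
  { intro x. transitivity (L (fun y => 0 * (fun _ => RtoC 0) y + 0 * (fun _ => RtoC 0) y)%C x).
    - f_equal. extensionality y. ring.
    - rewrite LC by assumption. ring. }
  assert (K : forall (a : nat -> C) l, (forall i, In i l -> W (e i)) ->
    W (fun y => lsum l (fun i => a i * e i y)%C) /\
    forall x, L (fun y => lsum l (fun i => a i * e i y)%C) x = lsum l (fun i => a i * L (e i) x)%C).
  { intro a. induction l as [|i l IH]; intro Hl.
    - split; [exact W0|]. intro x. apply L0.
    - destruct IH as [A B]. { intros; apply Hl; now right. }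
      assert (Wi : W (e i)) by (apply Hl; now left).
      assert (E : (fun y => lsum (i :: l) (fun i => a i * e i y)%C) =
        (fun y => a i * e i y + 1 * lsum l (fun i => a i * e i y))%C).
      { extensionality y. rewrite lsum_cons. ring. }
      rewrite E. split; [now apply WC|]. intro x.
      rewrite LC, B, lsum_cons by assumption. ring. }
  assert (Hseq : forall i, In i (seq 1 m) -> W (e i)).
  { intros i Hi. apply in_seq in Hi. apply He. lia. }
  exists (fun i => L (e i)). split; [|split].
  - intros i Hi. now apply LV, He.
  - intros a Ha. apply HI. intro y. destruct (K a _ Hseq) as [A B].
    rewrite sum_n_m_lsum. apply (Linj _ A). intro x. rewrite B, <- sum_n_m_lsum. apply Ha.
  - intros v Hv. destruct (Lsurj v Hv) as [w [Hw E]]. destruct (HS w Hw) as [a Ha].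
    exists a. intro x. destruct (K a _ Hseq) as [A B].
    rewrite E, sum_n_m_lsum, <- B. f_equal. extensionality y. now rewrite Ha, sum_n_m_lsum.
Qed.

Lemma has_dim_conj {X : Type} (V W : (X -> C) -> Prop) m :
  (forall f, V f -> W (fun x => Cconj (f x))) ->
  (forall f, W f -> V (fun x => Cconj (f x))) -> has_dim W m -> has_dim V m.
Proof.
  intros VW WV [e [He [HI HS]]].
  assert (K : forall l (a : nat -> C) x, Cconj (lsum l (fun i => a i * e i x)%C)
     = lsum l (fun i => Cconj (a i) * Cconj (e i x))%C).
  { intros l a x. induction l as [|i l IH].
    - apply C_eq; simpl; ring.
    - now rewrite !lsum_cons, Cplus_conj, Cmult_conj, IH. }
  exists (fun i x => Cconj (e i x)). split; [|split].
  - intros i Hi. now apply WV, He.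
  - intros a Ha i Hi. rewrite <- (Cconj_conj (a i)).
    rewrite (HI (fun i => Cconj (a i))); [apply C_eq; simpl; ring | | exact Hi].
    intro x. specialize (Ha x). rewrite sum_n_m_lsum in Ha |- *.
    rewrite <- (Cconj_conj (lsum _ _)), K.
    rewrite (lsum_ext _ _ (fun i => a i * Cconj (e i x))%C) by (intros; now rewrite Cconj_conj).
    rewrite Ha. apply C_eq; simpl; ring.
  - intros f Hf. destruct (HS _ (VW f Hf)) as [a Ha]. exists (fun i => Cconj (a i)). intro x.
    rewrite <- (Cconj_conj (f x)), Ha, !sum_n_m_lsum. apply K.
Qed.

Lemma has_dim_iff {X : Type} (V W : (X -> C) -> Prop) m :
  (forall f, V f <-> W f) -> has_dim W m -> has_dim V m.
Proof.
  intros H [e [He [HI HS]]]. exists e. split; [|split].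
  - intros i Hi. now apply H, He.
  - exact HI.
  - intros f Hf. now apply HS, H.
Qed.

(** * Landau levels *)

Definition level (d : Z) (k : nat) (c : C) (phi : C -> C) : Prop :=
  psmooth phi /\ quasi d phi /\ rotates c phi /\
  forall z, Dz (nu d) (Db (nu d) phi) z = (- (2 * INR k * nu d) * phi z)%C.

Lemma nu_pos d : (0 < d)%Z -> 0 < nu d.
Proof.
  intro H. apply IZR_lt in H. unfold nu. apply Rdiv_lt_0_compat; [|apply sqrt3_pos].
  apply Rmult_lt_0_compat; [exact H | apply PI_RGT_0].
Qed.

Lemma level_comb d k c a b f g : level d k c f -> level d k c g ->
  level d k c (fun z => a * f z + b * g z)%C.
Proof.
  intros [A1 [A2 [A3 A4]]] [B1 [B2 [B3 B4]]]. split; [|split; [|split]].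
  - now apply psmooth_comb.
  - now apply quasi_comb.
  - now apply rotates_comb.
  - intro z.
    replace (Db (nu d) (fun z => a * f z + b * g z)%C)
      with (fun z => a * Db (nu d) f z + b * Db (nu d) g z)%C
      by (extensionality u; now rewrite Db_comb).
    rewrite Dz_comb, A4, B4 by now apply psmooth_Db. ring.
Qed.

Lemma level_zero_fun d k c : level d k c (fun _ => RtoC 0).
Proof.
  split; [apply psmooth_const | split; [apply sect_zero_fun | split; [intro z; ring|]]].
  intro z. replace (Db (nu d) (fun _ => RtoC 0)) with (fun _ : C => RtoC 0)
    by (extensionality u; now rewrite Db_zero).
  rewrite Dz_zero. ring.
Qed.

(** At the bottom level [Db f] is killed by [Dz], hence its conjugate is a section
    of negative degree and vanishes. *)
Lemma level_bottom d j f : (0 < d)%nat ->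
  level (Z.of_nat d) 0 (eta ^ j) f <-> level0 d j f.
Proof.
  intro Hd. split.
  - intros [A [B [D E]]]. split; [|exact D]. split; [exact A | split; [exact B|]].
    apply (Dz_kernel (Z.of_nat d)); [lia | now apply psmooth_Db | now apply quasi_Db |].
    intro z. rewrite E. simpl. ring.
  - intros [[A [B D]] E]. split; [exact A | split; [exact B | split; [exact E|]]].
    intro z. replace (Db (nu (Z.of_nat d)) f) with (fun u : C => (0 * f u)%C)
      by (extensionality u; rewrite D; ring).
    rewrite Dz_scal by exact A. simpl. ring.
Qed.

Lemma Db_Dz_level d k c f z : level d k c f ->
  Db (nu d) (Dz (nu d) f) z = (- (2 * INR (S k) * nu d) * f z)%C.
Proof.
  intros [A [_ [_ E]]]. assert (X := commutator (nu d) f z A). rewrite E in X.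
  transitivity (Db (nu d) (Dz (nu d) f) z + 2 * nu d * f z - 2 * nu d * f z)%C; [ring|].
  rewrite <- X, S_INR, RtoC_plus. ring.
Qed.

(** Ladder step: by the commutator relation, [Db] is up to a nonzero constant an
    inverse of [Dz] between consecutive levels. The factor [eta] appears because Z
    and the rotation commute only up to [eta] ([Dz_rotate]). *)
Lemma has_dim_level_S d k c m : (0 < d)%Z ->
  has_dim (level d k (c * eta)) m -> has_dim (level d (S k) c) m.
Proof.
  intros Hd. assert (Hn := nu_pos d Hd).
  assert (Nz : (- (2 * INR (S k) * nu d))%C <> 0).
  { rewrite <- !RtoC_mult, <- RtoC_opp. intro E. apply RtoC_inj in E.
    assert (0 < INR (S k)) by (apply lt_0_INR; lia). nra. }
  apply (has_dim_transport _ _ (Dz (nu d))).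
  - apply level_zero_fun.
  - intros; now apply level_comb.
  - intros a b f g [Hf _] [Hg _] x. now apply Dz_comb.
  - intros w Hw. assert (Hw' := Hw). destruct Hw' as [A [B [D E]]]. split; [|split; [|split]].
    + now apply psmooth_Dz.
    + now apply quasi_Dz.
    + replace c with (c * eta / eta)%C by (field; apply eta_neq_0). now apply rotates_Dz.
    + intro z. replace (Db (nu d) (Dz (nu d) w)) with (fun z => - (2 * INR (S k) * nu d) * w z)%C
        by (extensionality u; now rewrite (Db_Dz_level d k _ w u Hw)).
      now rewrite Dz_scal.
  - intros w Hw H0 z. apply (Cmult_cancel _ _ _ Nz).
    rewrite <- (Db_Dz_level d k _ w z Hw).
    replace (Dz (nu d) w) with (fun _ : C => RtoC 0) by (extensionality u; now rewrite H0).
    rewrite Db_zero. ring.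
  - intros v [A [B [D E]]].
    exists (fun z => / - (2 * INR (S k) * nu d) * Db (nu d) v z)%C.
    assert (Av := psmooth_Db (nu d) v A). split.
    + split; [|split; [|split]].
      * now apply psmooth_scal.
      * now apply quasi_scal, quasi_Db.
      * now apply rotates_scal, rotates_Db.
      * intro z.
        replace (Db (nu d) (fun z => / - (2 * INR (S k) * nu d) * Db (nu d) v z)%C)
          with (fun z => / - (2 * INR (S k) * nu d) * Db (nu d) (Db (nu d) v) z)%C
          by (extensionality u; now rewrite Db_scal).
        rewrite Dz_scal by now apply psmooth_Db.
        rewrite commutator by exact Av.
        replace (Dz (nu d) (Db (nu d) v)) with (fun z => - (2 * INR (S k) * nu d) * v z)%C
          by (extensionality u; now rewrite E).
        rewrite Db_scal by exact A.
        transitivity (/ - (2 * INR (S k) * nu d) *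
          ((- (2 * INR (S k) * nu d) + 2 * nu d) * Db (nu d) v z))%C; [ring|].
        replace (- (2 * INR (S k) * nu d) + 2 * nu d)%C with (- (2 * INR k * nu d))%C
          by (rewrite S_INR, RtoC_plus; ring).
        ring.
    + intro z. rewrite Dz_scal, E, Cmult_assoc, Cinv_l by assumption. ring.
Qed.

Lemma has_dim_level d k j : (0 < d)%nat ->
  has_dim (level (Z.of_nat d) k (eta ^ j)) (mult_count d (j + k)).
Proof.
  intro Hd. revert j. induction k as [|k IH]; intro j.
  - rewrite Nat.add_0_r. apply (has_dim_iff _ (level0 d j)); [|now apply has_dim_level0].
    intro f. now apply level_bottom.
  - apply has_dim_level_S; [lia|].
    replace (eta ^ j * eta)%C with (eta ^ S j)%C by (rewrite Cpow_S; ring).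
    replace (j + S k)%nat with (S j + k)%nat by lia. apply IH.
Qed.

(** * From the Heisenberg group to the plane *)

Definition lift (v : R) (phi : C -> C) (p : heis) : C := (phi (fst p) * cis (v * snd p))%C.

Lemma cder_cis v s : cder (fun u => cis (v * u)) s (v * Ci * cis (v * s)).
Proof.
  assert (E : forall u : R, cis (v * u) = cexp (v * Ci * u)).
  { intro u. rewrite cis_cexp. f_equal. cring. }
  rewrite E. eapply cder_ext. { intro u. symmetry. apply E. }
  apply (cder_cexp (fun u => (v * Ci * u)%C)).
  eapply cder_eq; [apply cder_scal, cder_id | ring].
Qed.

Lemma lift_derivatives v phi p : psmooth phi ->
  cder (line_x (lift v phi) p) (Re (fst p)) (lift v (pdx phi) p) /\
  cder (line_y (lift v phi) p) (Im (fst p)) (lift v (pdy phi) p) /\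
  cder (line_t (lift v phi) p) (snd p) (lift v (fun z => v * Ci * phi z)%C p).
Proof.
  intro H. destruct (psmooth_pgrad _ H (fst p)) as [A B]. destruct p as [[x y] t].
  unfold line_x, line_y, line_t, lift in *. simpl in *. split; [|split].
  - eapply cder_eq; [apply (cder_mult (fun s => phi (s, y)) (fun _ => cis (v * t))); [exact A | apply cder_const]|].
    ring.
  - eapply cder_eq; [apply (cder_mult (fun s => phi (x, s)) (fun _ => cis (v * t))); [exact B | apply cder_const]|].
    ring.
  - eapply cder_eq; [apply cder_scal, cder_cis|]. ring.
Qed.

Lemma dx_lift v phi : psmooth phi -> dx (lift v phi) = lift v (pdx phi).
Proof. intro H. extensionality p. apply cder_CDerive, (lift_derivatives v phi p H). Qed.
Lemma dy_lift v phi : psmooth phi -> dy (lift v phi) = lift v (pdy phi).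
Proof. intro H. extensionality p. apply cder_CDerive, (lift_derivatives v phi p H). Qed.
Lemma dt_lift v phi : psmooth phi -> dt (lift v phi) = lift v (fun z => v * Ci * phi z)%C.
Proof. intro H. extensionality p. apply cder_CDerive, (lift_derivatives v phi p H). Qed.

Lemma ccont_lift v phi p : psmooth phi -> @ccont heis_UniformSpace (lift v phi) p.
Proof.
  intro H. unfold lift. apply (ccont_mult (X := heis_UniformSpace)).
  - apply (continuous_comp (U := heis_UniformSpace) (V := C_UniformSpace) fst phi).
    + destruct p. apply (continuous_fst (U := C_UniformSpace) (V := R_UniformSpace)).
    + now apply psmooth_cont.
  - apply (continuous_comp (U := heis_UniformSpace) (V := R_UniformSpace) snd (fun t => cis (v * t))).
    + destruct p. apply (continuous_snd (U := C_UniformSpace) (V := R_UniformSpace)).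
    + eapply cder_ccont, cder_cis.
Qed.

Lemma smooth_lift v phi : psmooth phi -> smooth (lift v phi).
Proof.
  intros H k. revert phi H. induction k as [|k IH]; intros phi H.
  - split; [|trivial]. intro p. now apply ccont_lift.
  - split; [intro p; now apply ccont_lift|].
    rewrite dx_lift, dy_lift, dt_lift by exact H. split; [|split; [|split]].
    + intro p. destruct (lift_derivatives v phi p H) as [A [B D]].
      split; [|split]; eapply cder_ex_CDerive; eassumption.
    + now apply IH, psmooth_pdx.
    + now apply IH, psmooth_pdy.
    + now apply IH, psmooth_scal.
Qed.

Lemma psmooth_restrict f : smooth f -> psmooth (fun z => f (z, 0)).
Proof.
  intros H k. specialize (H k).
  assert (CR : forall g : heis -> C, (forall p, @ccont heis_UniformSpace g p) ->
    forall z, @ccont C_UniformSpace (fun z => g (z, 0)) z).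
  { intros g Hg z.
    apply (continuous_comp (U := C_UniformSpace) (V := heis_UniformSpace) (fun z => (z, 0)) g); [|apply Hg].
    apply (continuous_comp_2 (V := C_UniformSpace) (W := R_UniformSpace) (X := heis_UniformSpace)
       (fun z : C_UniformSpace => z) (fun _ => 0) (fun z t => (z, t))).
    - apply continuous_id.
    - apply continuous_const.
    - apply (continuous_ext (U := prod_UniformSpace C_UniformSpace R_UniformSpace) (fun x => x)).
      + intros [a b]; reflexivity.
      + apply continuous_id. }
  revert f H. induction k as [|k IH]; intros f [Hc H].
  - split; [|trivial]. now apply CR.
  - destruct H as [Hd [Hx [Hy Ht]]].
    split; [now apply CR|]. split; [|split; [exact (IH (dx f) Hx) | exact (IH (dy f) Hy)]].
    intro z. destruct (Hd (z, 0)) as [A [B _]].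
    split; [exact (ex_CDerive_cder _ _ A) | exact (ex_CDerive_cder _ _ B)].
Qed.

Lemma Zop_lift v phi : psmooth phi -> Zop (lift v phi) = lift v (Dz v phi).
Proof.
  intro H. extensionality p. unfold Zop, dz. rewrite dx_lift, dy_lift, dt_lift by exact H.
  unfold lift, Dz. generalize (cis (v * snd p)). intro k. cfield.
Qed.

Lemma Zbarop_lift v phi : psmooth phi -> Zbarop (lift v phi) = lift v (Db v phi).
Proof.
  intro H. extensionality p. unfold Zbarop, dzbar. rewrite dx_lift, dy_lift, dt_lift by exact H.
  unfold lift, Db. generalize (cis (v * snd p)). intro k. cfield.
Qed.

Lemma sublaplacian_lift v r phi p : psmooth phi -> sublaplacian r (lift v phi) p =
  lift v (fun z => (- (1 / (2 * r)))%R * (Dz v (Db v phi) z + Db v (Dz v phi) z))%C p.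
Proof.
  intro H. unfold sublaplacian.
  rewrite (Zop_lift v phi H), (Zbarop_lift v phi H).
  rewrite (Zop_lift v _ (psmooth_Db v phi H)), (Zbarop_lift v _ (psmooth_Dz v phi H)).
  unfold lift. ring.
Qed.

Lemma Reeb_eigen_lift (f : heis -> C) (v : R) : smooth f -> (forall p, dt f p = (v * Ci * f p)%C) ->
  forall p, f p = lift v (fun z => f (z, 0)) p.
Proof.
  intros H Ht [z t]. unfold lift. simpl.
  assert (E := cder_linear_ode (fun s => f (z, s)) (v * Ci)%C). cbv beta in E. rewrite E.
  - rewrite cis_cexp. replace (v * Ci * t)%C with ((0, v * t) : C) by cring. ring.
  - intro s. rewrite <- Ht. apply (ex_CDerive_cder (line_t f (z, s))).
    destruct (H 1%nat) as [_ [Hd _]]. apply (Hd (z, s)).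
Qed.

(** ** Invariance under the group *)

Ltac heis_ring := apply injective_projections; [apply C_eq|]; unfold Re, Im; simpl; ring.

Lemma heis_mul_assoc a b d : heis_mul a (heis_mul b d) = heis_mul (heis_mul a b) d.
Proof.
  destruct a as [[a1 a2] a3], b as [[b1 b2] b3], d as [[d1 d2] d3].
  heis_ring.
Qed.

Lemma heis_inv_r a : heis_mul a (heis_inv a) = heis_one.
Proof.
  destruct a as [[a1 a2] a3]. heis_ring.
Qed.

Lemma heis_one_l a : heis_mul heis_one a = a.
Proof.
  destruct a as [[a1 a2] a3]. heis_ring.
Qed.

Lemma mu_mul l a b : mu l (heis_mul a b) = heis_mul (mu l a) (mu l b).
Proof.
  destruct a as [[a1 a2] a3], b as [[b1 b2] b3]. unfold mu, heis_mul. rewrite !Cmod2_alt.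
  destruct l as [l1 l2]. heis_ring.
Qed.

Lemma mu_comp l m a : mu l (mu m a) = mu (Cmult l m) a.
Proof.
  destruct a as [z t]. unfold mu. cbn [fst snd]. rewrite Cmod_mult, Cmult_assoc.
  f_equal. ring.
Qed.

Lemma mu_1 a : mu 1 a = a.
Proof.
  destruct a as [z t]. unfold mu. cbn [fst snd]. rewrite Cmod_1, Cmult_1_l. f_equal. ring.
Qed.

Lemma sim_act_mul a b p : sim_act (sim_mul a b) p = sim_act a (sim_act b p).
Proof.
  unfold sim_act, sim_mul. cbn [fst snd].
  now rewrite mu_mul, mu_comp, heis_mul_assoc.
Qed.

Lemma sim_act_inv (a : sim) (p : heis) : snd a <> 0 -> sim_act a (sim_act (sim_inv a) p) = p.
Proof.
  intro H. rewrite <- sim_act_mul. unfold sim_act, sim_mul, sim_inv. cbn [fst snd].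
  rewrite mu_comp, Cinv_r, !mu_1, heis_inv_r by exact H. apply heis_one_l.
Qed.

(** Invariance under a generated group is invariance under the generators, since
    the elements of modulus one act by bijections. *)
Lemma invariant_Gamma' (c : R) (f : heis -> C) :
  (forall g p, Gamma' c g -> f (sim_act g p) = f p) <->
  (forall p, f (heis_mul (RtoC 1, 0) p) = f p) /\
  (forall p, f (heis_mul (eta, 0) p) = f p) /\
  (forall p, f (heis_mul (RtoC 0, c) p) = f p) /\
  (forall p, f (sim_act ((RtoC 0, 5 * c / 6), eta) p) = f p).
Proof.
  split.
  - intro H.
    assert (HL : forall g, Lambda eta c g -> forall p, f (heis_mul g p) = f p).
    { intros g Hg p. rewrite <- (H (g, RtoC 1) p).
      - unfold sim_act. cbn [fst snd]. now rewrite mu_1.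
      - apply generated_in. left. now exists g. }
    split; [|split; [|split]].
    + apply HL, generated_in. now left.
    + apply HL, generated_in. right; now left.
    + apply HL, generated_in. right; now right.
    + intro p. apply H, generated_in. now right.
  - intros [H1 [H2 [H3 H4]]].
    assert (HL : forall g, Lambda eta c g -> forall p, f (heis_mul g p) = f p).
    { intros g Hg. induction Hg as [g [->|[->| ->]]| |g h _ IHg _ IHh|g _ IHg].
      - exact H1.
      - exact H2.
      - exact H3.
      - intro p. now rewrite heis_one_l.
      - intro p. now rewrite <- heis_mul_assoc, IHg, IHh.
      - intro p. rewrite <- (IHg (heis_mul (heis_inv g) p)), heis_mul_assoc, heis_inv_r.
        now rewrite heis_one_l. }
    assert (HG : forall g, Gamma' c g -> Cmod (snd g) = 1 /\ forall p, f (sim_act g p) = f p).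
    { intros g Hg. induction Hg as [g [[h [Hh ->]]| ->]| |g h _ [Mg IHg] _ [Mh IHh]|g _ [Mg IHg]].
      - split; [apply Cmod_1|]. intro p. unfold sim_act. cbn [fst snd].
        rewrite mu_1. now apply HL.
      - split; [|exact H4]. simpl. rewrite eta_cis. apply Cmod_cis.
      - split; [apply Cmod_1|]. intro p. unfold sim_act, sim_one. cbn [fst snd].
        now rewrite mu_1, heis_one_l.
      - split.
        + simpl. rewrite Cmod_mult, Mg, Mh. ring.
        + intro p. now rewrite sim_act_mul, IHg, IHh.
      - assert (Nz : snd g <> 0) by (intro E; rewrite E, Cmod_0 in Mg; lra).
        split.
        + simpl. rewrite Cmod_inv, Mg by exact Nz. apply Rinv_1.
        + intro p. now rewrite <- (IHg (sim_act (sim_inv g) p)), sim_act_inv. }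
    intros g p Hg. now apply HG.
Qed.

(** The joint eigenspace, seen on the plane; [v] is the product of [q = r] with the
    Reeb eigenvalue. *)
Definition plane_space (v q a : R) (c : C) (phi : C -> C) : Prop :=
  psmooth phi /\ translates v 0 1 phi /\ translates v 0 eta phi /\ rotates c phi /\
  forall z, (Dz v (Db v phi) z + Db v (Dz v phi) z)%C = (- (2 * q * a) * phi z)%C.

Lemma translates_lift v w phi : translates v 0 w phi <->
  forall p, lift v phi (heis_mul (w, 0) p) = lift v phi p.
Proof.
  unfold lift, heis_mul. split.
  - intros H [z t]. cbn [fst snd].
    replace (w + z)%C with (z + w)%C by ring. rewrite H.
    replace (v * (0 + t + 2 * Im (w * Cconj z))) with (v * t + 2 * v * Im (w * Cconj z)) by ring.
    rewrite cis_plus.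
    transitivity (cis (0 - 2 * v * Im (w * Cconj z)) * cis (2 * v * Im (w * Cconj z)) * (phi z * cis (v * t)))%C; [ring|].
    rewrite <- cis_plus.
    replace (0 - 2 * v * Im (w * Cconj z) + 2 * v * Im (w * Cconj z)) with 0 by ring.
    rewrite cis_0. ring.
  - intros H z. specialize (H (z, 0)). cbn [fst snd] in H.
    rewrite Rmult_0_r, cis_0, Cmult_1_r in H. rewrite <- H.
    replace (w + z)%C with (z + w)%C by ring.
    transitivity (phi (z + w)%C * (cis (0 - 2 * v * Im (w * Cconj z)) * cis (v * (0 + 0 + 2 * Im (w * Cconj z)))))%C; [|ring].
    rewrite <- cis_plus.
    replace (0 - 2 * v * Im (w * Cconj z) + v * (0 + 0 + 2 * Im (w * Cconj z))) with 0 by ring.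
    rewrite cis_0. ring.
Qed.

Lemma rotates_lift v s phi : rotates (cis (- (v * s))) phi <->
  forall p, lift v phi (sim_act ((RtoC 0, s), eta) p) = lift v phi p.
Proof.
  assert (A : forall z t, sim_act ((RtoC 0, s), eta) (z, t) = ((eta * z)%C, s + t)).
  { intros z t. unfold sim_act, heis_mul, mu. cbn [fst snd]. f_equal.
    - ring.
    - rewrite eta_cis, Cmod_cis, Cmult_0_l. simpl. ring. }
  split.
  - intros H [z t]. rewrite A. unfold lift. cbn [fst snd]. rewrite H.
    rewrite Rmult_plus_distr_l, cis_plus.
    transitivity ((cis (- (v * s)) * cis (v * s)) * (phi z * cis (v * t)))%C; [ring|].
    rewrite cis_opp_l. ring.
  - intros H z. specialize (H (z, 0)). rewrite A in H. unfold lift in H. cbn [fst snd] in H.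
    rewrite Rplus_0_r, Rmult_0_r, cis_0, Cmult_1_r in H. rewrite <- H.
    transitivity (phi (eta * z)%C * (cis (- (v * s)) * cis (v * s)))%C; [|ring].
    rewrite cis_opp_l. ring.
Qed.

Lemma lift_inj v phi psi : (forall p, lift v phi p = lift v psi p) -> forall z, phi z = psi z.
Proof.
  intros H z. specialize (H (z, 0)). unfold lift in H. simpl in H.
  now rewrite Rmult_0_r, cis_0, !Cmult_1_r in H.
Qed.

Lemma joint_eigenspace_lift c r a b phi : 0 < r -> cis (r * b * c) = 1 -> psmooth phi ->
  joint_eigenspace (Gamma' c) r a b (lift (r * b) phi) <->
  plane_space (r * b) r a (cis (- (r * b * (5 * c / 6)))) phi.
Proof.
  intros Hr Hc H. set (v := r * b) in *.
  assert (EL : forall p, sublaplacian r (lift v phi) p = (a * lift v phi p)%C <->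
     (Dz v (Db v phi) (fst p) + Db v (Dz v phi) (fst p))%C = (- (2 * r * a) * phi (fst p))%C).
  { intro p. rewrite sublaplacian_lift by exact H. unfold lift.
    assert (Nk := cis_neq_0 (v * snd p)).
    set (X := (Dz v (Db v phi) (fst p) + Db v (Dz v phi) (fst p))%C).
    assert (R1 : ((- (1 / (2 * r)))%R * (- (2 * r))%R = 1)%C).
    { rewrite <- RtoC_mult. f_equal. field. lra. }
    split; intro E.
    - apply (Cmult_cancel (cis (v * snd p) * (- (1 / (2 * r)))%R)).
      + apply Cmult_neq_0; [exact Nk|]. intro F. rewrite F, Cmult_0_l in R1. now apply C1_nz.
      + transitivity ((- (1 / (2 * r)))%R * X * cis (v * snd p))%C; [ring|]. rewrite E.
        transitivity (a * (phi (fst p) * cis (v * snd p)) * 1)%C; [ring|].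
        rewrite <- R1, (RtoC_opp (2 * r)), (RtoC_mult 2 r). ring.
    - rewrite E.
      transitivity (a * (phi (fst p) * cis (v * snd p)) * ((- (1 / (2 * r)))%R * (- (2 * r))%R))%C.
      + rewrite (RtoC_opp (2 * r)), (RtoC_mult 2 r). ring.
      + rewrite R1. ring. }
  assert (ET : forall p, (Cinv Ci * Reeb r (lift v phi) p = b * lift v phi p)%C).
  { intro p. unfold Reeb. rewrite dt_lift by exact H. unfold lift, v.
    rewrite RtoC_div, RtoC_mult, Ci_inv by lra.
    transitivity (- (Ci * Ci) * (b * (phi (fst p) * cis (r * b * snd p))) * (r / r))%C.
    - unfold Cdiv. ring.
    - replace (r / r)%C with (RtoC 1).
      + replace (Ci * Ci)%C with (- (1))%C by cring. ring.
      + unfold Cdiv. rewrite Cinv_r; [reflexivity|]. intro E; apply RtoC_inj in E; lra. }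
  unfold joint_eigenspace, plane_space. rewrite invariant_Gamma', !translates_lift, rotates_lift.
  split.
  - intros [_ [[I1 [I2 [_ I4]]] [E _]]]. repeat (split; [assumption|]).
    intro z. apply (EL (z, 0)), E.
  - intros [_ [I1 [I2 [I4 E]]]]. split; [now apply smooth_lift|].
    split; [|split].
    + repeat (split; [assumption|]). split; [|exact I4].
      intros [z t]. unfold lift, heis_mul. cbn [fst snd].
      replace (0 + z)%C with z by ring. f_equal.
      replace (v * (c + t + 2 * Im (0 * Cconj z))) with (v * c + v * t)
        by (unfold Im; simpl; ring).
      rewrite cis_plus, Hc. ring.
    + intro p. apply EL, E.
    + exact ET.
Qed.

Lemma plane_space_comb v q a c s t f g : plane_space v q a c f -> plane_space v q a c g ->
  plane_space v q a c (fun z => s * f z + t * g z)%C.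
Proof.
  intros [A1 [A2 [A3 [A4 A5]]]] [B1 [B2 [B3 [B4 B5]]]].
  split; [now apply psmooth_comb|]. split; [now apply translates_comb|].
  split; [now apply translates_comb|]. split; [now apply rotates_comb|].
  intro z.
  replace (Db v (fun z => s * f z + t * g z)%C) with (fun z => s * Db v f z + t * Db v g z)%C
    by (extensionality u; now rewrite Db_comb).
  replace (Dz v (fun z => s * f z + t * g z)%C) with (fun z => s * Dz v f z + t * Dz v g z)%C
    by (extensionality u; now rewrite Dz_comb).
  rewrite Dz_comb, Db_comb by (now apply psmooth_Db || now apply psmooth_Dz).
  transitivity (s * (Dz v (Db v f) z + Db v (Dz v f) z) + t * (Dz v (Db v g) z + Db v (Dz v g) z))%C;
    [ring|]. rewrite A5, B5. ring.
Qed.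

Lemma has_dim_joint c r a b m : 0 < r -> cis (r * b * c) = 1 ->
  has_dim (plane_space (r * b) r a (cis (- (r * b * (5 * c / 6))))) m ->
  joint_multiplicity (Gamma' c) r a b m.
Proof.
  intros Hr Hc. set (v := r * b) in *. apply (has_dim_transport _ _ (lift v)).
  - assert (Z1 : Dz v (fun _ => RtoC 0) = fun _ => RtoC 0) by (extensionality u; apply Dz_zero).
    assert (Z2 : Db v (fun _ => RtoC 0) = fun _ => RtoC 0) by (extensionality u; apply Db_zero).
    split; [apply psmooth_const|]. split; [intro z; ring|]. split; [intro z; ring|].
    split; [intro z; ring|]. intro z. rewrite Z2, Z1, Z2. ring.
  - intros; now apply plane_space_comb.
  - intros s t f g _ _ p. unfold lift. ring.
  - intros w Hw. apply joint_eigenspace_lift; auto. apply Hw.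
  - intros w _ H0. apply (lift_inj v w (fun _ => RtoC 0)). intro p. rewrite H0. unfold lift. ring.
  - intros f Hf.
    assert (Hs : smooth f) by apply Hf.
    assert (Ht : forall p, dt f p = (v * Ci * f p)%C).
    { intro p. destruct Hf as [_ [_ [_ E]]]. specialize (E p). unfold Reeb in E.
      apply (Cmult_cancel (/ Ci * RtoC (1 / r))).
      - apply Cmult_neq_0.
        + rewrite Ci_inv. intro F. apply (f_equal Im) in F. simpl in F. lra.
        + intro F. apply RtoC_inj in F. apply (Rmult_eq_compat_l r) in F.
          replace (r * (1 / r)) with 1 in F by (field; lra). lra.
      - rewrite <- Cmult_assoc, E. unfold v. rewrite RtoC_mult, RtoC_div by lra.
        field. split; [intro F; apply RtoC_inj in F; lra | apply Ci_nz]. }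
    assert (E := Reeb_eigen_lift f v Hs Ht).
    exists (fun z => f (z, 0)). split; [|exact E].
    apply joint_eigenspace_lift; auto; [now apply psmooth_restrict|].
    fold v. replace (lift v (fun z => f (z, 0))) with f; [exact Hf|].
    extensionality p. apply E.
Qed.

(** ** Complex conjugation *)

Lemma CDerive_conj g s : CDerive (fun u => Cconj (g u)) s = Cconj (CDerive g s).
Proof.
  apply C_eq; [reflexivity|]. unfold CDerive. simpl. apply Derive_opp.
Qed.

Definition hconj (f : heis -> C) (p : heis) : C := Cconj (f p).

Lemma dx_conj f : dx (hconj f) = hconj (dx f).
Proof. extensionality p. apply (CDerive_conj (line_x f p)). Qed.
Lemma dy_conj f : dy (hconj f) = hconj (dy f).
Proof. extensionality p. apply (CDerive_conj (line_y f p)). Qed.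
Lemma dt_conj f : dt (hconj f) = hconj (dt f).
Proof. extensionality p. apply (CDerive_conj (line_t f p)). Qed.

Lemma smooth_conj f : smooth f -> smooth (hconj f).
Proof.
  intros H k. specialize (H k). revert f H. induction k as [|k IH]; intros f [Hc H].
  - split; [|trivial]. intro p. apply (ccont_conj f), Hc.
  - destruct H as [Hd [Hx [Hy Ht]]].
    split; [intro p; apply (ccont_conj f), Hc|].
    rewrite dx_conj, dy_conj, dt_conj. split; [|split; [|split]]; auto.
    intro p. destruct (Hd p) as [A [B D]].
    split; [|split]; (eapply cder_ex_CDerive; apply (cder_conj (fun s => f _));
      apply ex_CDerive_cder; eassumption).
Qed.

Lemma Zop_conj f : Zop (hconj f) = hconj (Zbarop f).
Proof.
  extensionality p. unfold Zop, dz. rewrite dx_conj, dy_conj, dt_conj.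
  unfold hconj, Zbarop, dzbar. cfield.
Qed.

Lemma Zbarop_conj f : Zbarop (hconj f) = hconj (Zop f).
Proof.
  extensionality p. unfold Zbarop, dzbar. rewrite dx_conj, dy_conj, dt_conj.
  unfold hconj, Zop, dz. cfield.
Qed.

Lemma joint_eigenspace_conj Gam r a b f :
  joint_eigenspace Gam r a b f -> joint_eigenspace Gam r a (- b) (hconj f).
Proof.
  intros [A [B [D E]]]. split; [now apply smooth_conj|]. split; [|split].
  - intros g p Hg. unfold hconj. now rewrite B.
  - intro p. unfold sublaplacian. rewrite Zbarop_conj, Zop_conj, Zop_conj, Zbarop_conj.
    transitivity (Cconj (sublaplacian r f p)).
    + unfold sublaplacian, hconj. rewrite Cmult_conj, Cplus_conj. f_equal; [cring|ring].
    + rewrite D, Cmult_conj. unfold hconj. f_equal. cring.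
  - intro p. unfold Reeb. rewrite dt_conj.
    transitivity (- Cconj (/ Ci * Reeb r f p))%C.
    + unfold Reeb, hconj. rewrite !Cmult_conj, Ci_inv. cring.
    + rewrite E, Cmult_conj, RtoC_opp. unfold hconj. cring.
Qed.

Lemma joint_multiplicity_opp Gam r a b m :
  joint_multiplicity Gam r a b m -> joint_multiplicity Gam r a (- b) m.
Proof.
  apply has_dim_conj.
  - intros f Hf. rewrite <- (Ropp_involutive b). apply (joint_eigenspace_conj _ _ _ _ f Hf).
  - apply joint_eigenspace_conj.
Qed.

(** * The multiplicities away from the zero Reeb eigenvalue *)

Lemma plane_space_level d k q a c f : (0 < d)%nat -> Nat.Even d ->
  (q * a = (2 * INR k + 1) * nu (Z.of_nat d))%R ->
  plane_space (nu (Z.of_nat d)) q a c f <-> level (Z.of_nat d) k c f.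
Proof.
  intros Hd He Hq. set (v := nu (Z.of_nat d)) in *.
  assert (Hp : forall x, cis (PI * IZR (Z.of_nat d) - x) = cis (0 - x)).
  { intro x. destruct He as [h ->].
    replace (PI * IZR (Z.of_nat (2 * h)) - x) with ((0 - x) + 2 * PI * IZR (Z.of_nat h))
      by (rewrite <- !INR_IZR_INZ, mult_INR; simpl; ring).
    rewrite cis_plus, cis_2PI_Z. ring. }
  assert (ET : forall w, translates v 0 w f <-> translates v (PI * IZR (Z.of_nat d)) w f).
  { intro w. unfold translates. split; intros H z; rewrite H, Hp; reflexivity. }
  unfold plane_space, level, quasi. fold v. rewrite <- !ET.
  assert (EQ : psmooth f -> forall z,
    (Dz v (Db v f) z + Db v (Dz v f) z)%C = (- (2 * q * a) * f z)%C <->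
    Dz v (Db v f) z = (- (2 * INR k * v) * f z)%C).
  { intros H z. assert (X := commutator v f z H).
    assert (Q : (2 * q * a = 2 * (2 * INR k + 1) * v)%C).
    { rewrite <- !RtoC_mult, <- RtoC_plus, <- !RtoC_mult. f_equal. rewrite Rmult_assoc, Hq. ring. }
    rewrite Q. split; intro E.
    - apply (Cmult_cancel 2).
      + intro F; apply RtoC_inj in F; lra.
      + transitivity ((Dz v (Db v f) z + Db v (Dz v f) z) + 2 * v * f z)%C.
        * rewrite X. ring.
        * rewrite E. ring.
    - transitivity (2 * Dz v (Db v f) z - 2 * v * f z)%C.
      + rewrite X. ring.
      + rewrite E. ring. }
  split.
  - intros [A [B [D [E F]]]]. repeat (split; [tauto|]). intro z. now apply EQ.
  - intros [A [[B D] [E F]]]. repeat (split; [tauto|]). intro z. now apply EQ.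
Qed.

Lemma multiplicity_positive (N n k : nat) (c r : R) : (0 < N)%nat -> Nat.Even N ->
  c = 4 * Im eta / INR N -> 0 < r -> (0 < n)%nat ->
  joint_multiplicity (Gamma' c) r ((4 * INR k + 2) * PI * INR n / (c * r))
    (2 * PI * INR n / (c * r)) (mult_count (n * N) (n + k)).
Proof.
  intros HN He Hc Hr Hn.
  assert (PN : 0 < INR N) by now apply lt_0_INR.
  assert (S3 := sqrt3_pos). assert (SS := sqrt3_sq).
  assert (Hc' : c = 2 * sqrt 3 / INR N).
  { rewrite Hc, eta_val. simpl. field. lra. }
  assert (Pc : 0 < c) by (rewrite Hc'; apply Rdiv_lt_0_compat; lra).
  set (b := 2 * PI * INR n / (c * r)).
  assert (Eb : r * b = 2 * PI * INR n / c) by (unfold b; field; lra).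
  assert (Ev : r * b = nu (Z.of_nat (n * N))).
  { rewrite Eb, Hc'. unfold nu. rewrite <- INR_IZR_INZ, mult_INR. field_simplify; [|lra|lra].
    reflexivity. }
  apply has_dim_joint; [exact Hr | |].
  - rewrite Eb. replace (2 * PI * INR n / c * c) with (2 * PI * IZR (Z.of_nat n))
      by (rewrite <- INR_IZR_INZ; field; lra).
    apply cis_2PI_Z.
  - replace (cis (- (r * b * (5 * c / 6)))) with (eta ^ n)%C.
    + rewrite Ev. apply (has_dim_iff _ (level (Z.of_nat (n * N)) k (eta ^ n))).
      * intro f. apply plane_space_level; [nia | |].
        -- destruct He as [h ->]. exists (n * h)%nat. lia.
        -- rewrite <- Ev, Eb. field. lra.
      * apply has_dim_level. nia.
    + rewrite eta_cis, cis_pow, Eb.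
      replace (- (2 * PI * INR n / c * (5 * c / 6))) with (INR n * (PI / 3) + 2 * PI * IZR (- Z.of_nat n)).
      * rewrite cis_plus, cis_2PI_Z. ring.
      * rewrite opp_IZR, <- INR_IZR_INZ. field. lra.
Qed.

Lemma multiplicity_nonzero (N : nat) (c r : R) (n : Z) (k : nat) : (0 < N)%nat -> Nat.Even N ->
  c = 4 * Im eta / INR N -> 0 < r -> n <> 0%Z ->
  joint_multiplicity (Gamma' c) r ((4 * INR k + 2) * PI * Rabs (IZR n) / (c * r))
    (2 * PI * IZR n / (c * r)) (mult_count (Z.abs_nat n * N) (Z.abs_nat n + k)).
Proof.
  intros HN He Hc Hr Hn.
  assert (P := multiplicity_positive N (Z.abs_nat n) k c r HN He Hc Hr ltac:(lia)).
  rewrite <- abs_IZR. rewrite (INR_IZR_INZ (Z.abs_nat n)), Zabs2Nat.id_abs in P.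
  destruct (Z_le_gt_dec 0 n) as [L|L].
  - rewrite (Z.abs_eq n L) in P |- *. exact P.
  - assert (Hm : Z.abs n = (- n)%Z) by lia. apply joint_multiplicity_opp in P.
    replace (2 * PI * IZR n / (c * r)) with (- (2 * PI * IZR (Z.abs n) / (c * r))); [exact P|].
    rewrite Hm, opp_IZR. unfold Rdiv. ring.
Qed.

Lemma multiplicity_value (N : nat) (n : Z) (k : nat) : (0 < N)%nat -> Nat.Even N -> n <> 0%Z ->
  INR (mult_count (Z.abs_nat n * N) (Z.abs_nat n + k)) =
  1 / 6 *
    (Rabs (IZR n) * INR N
     + 2 * powerRZ (-1) (n + Z.of_nat k)
     + 2 * cos (PI * (Rabs (IZR n) + INR k - 1) / 3)
     + 2 / sqrt 3 * cos (2 * PI * (Rabs (IZR n) + INR k) / 3 - PI / 6)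
     + 4 / sqrt 3 *
       cos (2 * PI * (Rabs (IZR n) + INR k - Rabs (IZR n) * INR N) / 3 - PI / 6)).
Proof.
  intros HN He Hn. rewrite mult_count_formula.
  2: nia.
  2: { destruct He as [h ->]. exists (Z.abs_nat n * h)%nat. lia. }
  assert (En : Rabs (IZR n) = INR (Z.abs_nat n)).
  { now rewrite INR_IZR_INZ, Zabs2Nat.id_abs, abs_IZR. }
  assert (Es : powerRZ (-1) (n + Z.of_nat k) = (-1) ^ (Z.abs_nat n + k)).
  { rewrite powerRZ_add by lra. rewrite <- pow_powerRZ, pow_add. f_equal.
    destruct (Z_le_gt_dec 0 n) as [L|L].
    - rewrite pow_powerRZ, Zabs2Nat.id_abs, Z.abs_eq by lia. reflexivity.
    - replace n with (- Z.of_nat (Z.abs_nat n))%Z at 1 by lia.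
      rewrite powerRZ_neg', <- pow_powerRZ. 
      assert (Q : (-1) ^ Z.abs_nat n * (-1) ^ Z.abs_nat n = 1).
      { rewrite <- Rpow_mult_distr. replace (-1 * -1) with 1 by ring. apply pow1. }
      assert (Q0 : (-1) ^ Z.abs_nat n <> 0) by (apply pow_nonzero; lra).
      apply (Rmult_eq_reg_l ((-1) ^ Z.abs_nat n)); [|exact Q0].
      rewrite Q. field. exact Q0. }
  unfold mult_formula. rewrite Es, En, !minus_IZR, <- !INR_IZR_INZ, plus_INR, mult_INR.
  generalize sqrt3_pos. intro S.
  field_simplify_eq; [|lra]. ring.
Qed.

(** * Lattice periodic functions *)

(** The element of the dual lattice pairing to [m] with 1 and to [l] with [eta],
    for [p = (m, l)]. *)
Definition zeta (p : Z * Z) : C := (IZR (fst p), (2 * IZR (snd p) - IZR (fst p)) / sqrt 3).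

Definition chi (p : Z * Z) (z : C) : C :=
  cexp (2 * PI * Ci * (Re (zeta p) * Re z + Im (zeta p) * Im z)).

(** Coordinates with respect to the basis 1, [eta] of the lattice. *)
Definition basis_map : C -> C := affine 1 (1 / 2) 0 (sqrt 3 / 2) 0 0.

Definition latper (phi : C -> C) : Prop :=
  (forall z, phi (z + 1)%C = phi z) /\ (forall z, phi (z + eta)%C = phi z).

Definition pull (phi : C -> C) (w : C) : C := phi (basis_map w).

Definition fourier2 (phi : C -> C) (p : Z * Z) : C := fcoef (fun v => coef (pull phi) (fst p) v) (snd p).

Lemma psmooth_pull phi : psmooth phi -> psmooth (pull phi).
Proof. apply psmooth_affine. Qed.

Lemma pull_xperiodic phi : latper phi -> xperiodic (pull phi).
Proof.
  intros [H _] x y. unfold pull. rewrite <- (H (basis_map (x, y))). f_equal. unfold basis_map, affine. cfield.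
Qed.

Lemma pull_yperiodic phi x y : latper phi -> pull phi (x, y + 1) = pull phi (x, y).
Proof.
  intros [_ H]. unfold pull. rewrite <- (H (basis_map (x, y))). f_equal. unfold basis_map, affine.
  rewrite eta_val. cfield.
Qed.

Lemma coef_pull_yperiodic phi m y : latper phi -> coef (pull phi) m (y + 1) = coef (pull phi) m y.
Proof. intro H. apply fcoef_ext. intros x _. now apply pull_yperiodic. Qed.

Lemma cont01_coef phi m : psmooth phi -> cont01 (coef phi m).
Proof. intros H y _. eapply cder_ccont. now apply coef_dy. Qed.

Lemma fourier2_comb a b f g p : psmooth f -> psmooth g ->
  fourier2 (fun z => a * f z + b * g z)%C p = (a * fourier2 f p + b * fourier2 g p)%C.
Proof.
  intros Hf Hg. apply psmooth_pull in Hf. apply psmooth_pull in Hg. unfold fourier2.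
  rewrite <- !fcoef_scal, <- fcoef_plus.
  - apply fcoef_ext. intros v _.
    rewrite <- !coef_scal, <- coef_plus by (try apply psmooth_scal; assumption). reflexivity.
  - apply cont01_mult; [apply cont01_const | now apply cont01_coef].
  - apply cont01_mult; [apply cont01_const | now apply cont01_coef].
  - now apply cont01_coef.
  - now apply cont01_coef.
Qed.

Lemma latper_grad phi : psmooth phi -> latper phi -> latper (pdx phi) /\ latper (pdy phi).
Proof.
  intros H [P1 P2].
  assert (K : forall w, (forall z, phi (z + w)%C = phi z) -> forall z,
     pdx phi (z + w)%C = pdx phi z /\ pdy phi (z + w)%C = pdy phi z).
  { intros w Hw. assert (G := pgrad_translate phi w H). apply (pgrad_ext _ _ _ _ Hw) in G.
    intro z. destruct (pgrad_unique _ _ _ _ _ G (psmooth_pgrad _ H) z) as [A B]. now split. }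
  split; split; intro z; first [apply (K 1 P1) | apply (K eta P2)].
Qed.

Lemma fourier2_dx phi p : psmooth phi -> latper phi ->
  fourier2 (pdx phi) p = (2 * PI * Ci * Re (zeta p) * fourier2 phi p)%C.
Proof.
  intros H Hp. assert (HP := psmooth_pull phi H).
  assert (E : pdx (pull phi) = pull (pdx phi)).
  { unfold pull, basis_map. rewrite (pgrad_pdx _ _ _ (pgrad_affine phi _ _ _ _ _ _ H)).
    extensionality w. ring. }
  unfold fourier2. rewrite <- fcoef_scal by now apply cont01_coef.
  apply fcoef_ext. intros v _. rewrite <- E, coef_dx by (auto; now apply pull_xperiodic).
  simpl Re. ring.
Qed.

Lemma fourier2_pull_dy phi p : psmooth phi -> latper phi ->
  fcoef (fun v => coef (pdy (pull phi)) (fst p) v) (snd p)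
  = (2 * PI * IZR (snd p) * Ci * fourier2 phi p)%C.
Proof.
  intros H Hp. assert (HP := psmooth_pull phi H). apply fcoef_deriv.
  - intro v. now apply coef_dy.
  - now apply cont01_coef, psmooth_pdy.
  - replace 1 with (0 + 1) by ring. now apply coef_pull_yperiodic.
Qed.

Lemma fourier2_dy phi p : psmooth phi -> latper phi ->
  fourier2 (pdy phi) p = (2 * PI * Ci * Im (zeta p) * fourier2 phi p)%C.
Proof.
  intros H Hp.
  assert (S := sqrt3_pos).
  assert (S0 : RtoC (sqrt 3 / 2) <> 0) by (intro F; apply RtoC_inj in F; lra).
  apply (Cmult_cancel (RtoC (sqrt 3 / 2)) _ _ S0).
  assert (Hx := psmooth_pdx _ H). assert (Hy := psmooth_pdy _ H).
  assert (E : pdy (pull phi) = pull (fun z => (1 / 2)%R * pdx phi z + (sqrt 3 / 2)%R * pdy phi z)%C).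
  { unfold pull, basis_map. now rewrite (pgrad_pdy _ _ _ (pgrad_affine phi _ _ _ _ _ _ H)). }
  assert (F := fourier2_pull_dy phi p H Hp). rewrite E in F.
  fold (fourier2 (fun z => (1 / 2)%R * pdx phi z + (sqrt 3 / 2)%R * pdy phi z)%C p) in F.
  rewrite fourier2_comb, fourier2_dx in F by assumption.
  transitivity (((1 / 2)%R * (2 * PI * Ci * Re (zeta p) * fourier2 phi p) + (sqrt 3 / 2)%R * fourier2 (pdy phi) p)
     - (1 / 2)%R * (2 * PI * Ci * Re (zeta p) * fourier2 phi p))%C; [ring|].
  rewrite F. unfold zeta. simpl Re. simpl Im.
  generalize (fourier2 phi p). intro k. cfield; lra.
Qed.

(** Completeness in two variables, one variable at a time. *)
Lemma fourier2_unique phi : psmooth phi -> latper phi ->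
  (forall p, fourier2 phi p = 0) -> forall z, phi z = 0.
Proof.
  intros H Hp H0. assert (HP := psmooth_pull phi H).
  assert (A : forall m v, coef (pull phi) m v = 0).
  { intro m. apply (fourier_unique _ (coef (pdy (pull phi)) m)).
    - intro v. now apply coef_dy.
    - intro v. now apply coef_pull_yperiodic.
    - intro l. apply (H0 (m, l)). }
  assert (B : forall w, pull phi w = 0).
  { intros [x y]. apply coef_unique; auto. now apply pull_xperiodic. }
  intros [x y]. rewrite <- (B (x - y / sqrt 3, 2 * y / sqrt 3)). unfold pull. f_equal.
  unfold basis_map, affine. generalize sqrt3_pos. intro S. cfield; lra.
Qed.

(** ** Characters *)

Lemma psmooth_chi p : psmooth (chi p).
Proof.
  apply psmooth_cexp, psmooth_scal, psmooth_plus; apply psmooth_scal; [apply psmooth_Re | apply psmooth_Im].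
Qed.

Lemma pgrad_chi p : pgrad (chi p) (fun z => 2 * PI * Ci * Re (zeta p) * chi p z)%C
  (fun z => 2 * PI * Ci * Im (zeta p) * chi p z)%C.
Proof.
  unfold chi. eapply pgrad_eq.
  3: { apply pgrad_cexp, pgrad_scal, pgrad_plus; apply pgrad_scal; [apply pgrad_Re | apply pgrad_Im]. }
  all: intro z; simpl; ring.
Qed.

Lemma pull_chi p x y : pull (chi p) (x, y) = (expn (snd p) y * expn (fst p) x)%C.
Proof.
  unfold pull, chi, expn. rewrite !cis_cexp, <- cexp_plus. f_equal.
  unfold basis_map, affine, zeta. generalize sqrt3_pos. intro S. cfield; lra.
Qed.

Lemma latper_chi p : latper (chi p).
Proof.
  assert (P : forall n : Z, cexp (2 * PI * Ci * RtoC (IZR n)) = 1).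
  { intro n. rewrite <- (cis_2PI_Z n), cis_cexp. f_equal. cring. }
  generalize sqrt3_pos. intro S.
  split; intro z; unfold chi.
  - transitivity (cexp (2 * PI * Ci * (Re (zeta p) * Re z + Im (zeta p) * Im z))
      * cexp (2 * PI * Ci * RtoC (IZR (fst p))))%C; [|rewrite P; ring].
    rewrite <- cexp_plus. f_equal. unfold zeta. cfield; lra.
  - transitivity (cexp (2 * PI * Ci * (Re (zeta p) * Re z + Im (zeta p) * Im z))
      * cexp (2 * PI * Ci * RtoC (IZR (snd p))))%C; [|rewrite P; ring].
    rewrite <- cexp_plus. f_equal. unfold zeta. rewrite eta_val. cfield; lra.
Qed.

Definition Zpair_dec : forall p q : Z * Z, {p = q} + {p <> q}.
Proof. decide equality; apply Z.eq_dec. Defined.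

Lemma fourier2_chi p q : fourier2 (chi p) q = if Zpair_dec p q then 1 else 0.
Proof.
  unfold fourier2.
  rewrite (fcoef_ext _ (fun v => (if Z.eq_dec (fst p) (fst q) then 1 else 0) * expn (snd p) v)%C).
  - rewrite fcoef_scal, fcoef_expn by apply cont01_expn.
    destruct p as [m l], q as [m' l']. cbn [fst snd].
    destruct (Zpair_dec (m, l) (m', l')) as [E|E].
    + injection E as -> ->. destruct (Z.eq_dec m' m'); [|tauto]. destruct (Z.eq_dec l' l'); [|tauto]. ring.
    + destruct (Z.eq_dec m m') as [->|]; [|ring]. destruct (Z.eq_dec l l') as [->|]; [tauto|ring].
  - intros v _. unfold coef.
    rewrite (fcoef_ext _ (fun x => expn (snd p) v * expn (fst p) x)%C) by (intros; apply pull_chi).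
    rewrite fcoef_scal, fcoef_expn by apply cont01_expn.
    destruct (Z.eq_dec (fst p) (fst q)); ring.
Qed.

Lemma fourier2_lsum {I} (l : list I) (c : I -> C) (u : I -> C -> C) p :
  (forall i, psmooth (u i)) ->
  fourier2 (fun z => lsum l (fun i => c i * u i z)%C) p = lsum l (fun i => c i * fourier2 (u i) p)%C.
Proof.
  intro H. induction l as [|i l IH].
  - simpl. replace (fun _ : C => RtoC 0) with (fun z : C => 0 * (fun _ => RtoC 0) z + 0 * (fun _ => RtoC 0) z)%C
      by (extensionality z; ring).
    rewrite fourier2_comb by apply psmooth_const. ring.
  - replace (fun z => lsum (i :: l) (fun i => c i * u i z)%C)
      with (fun z => c i * u i z + 1 * lsum l (fun i => c i * u i z))%C
      by (extensionality z; rewrite lsum_cons; ring).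
    rewrite fourier2_comb, IH, lsum_cons; [ring | apply H |].
    apply (psmooth_lsum l (fun i z => c i * u i z)%C). intros; apply psmooth_scal, H.
Qed.

(** * Eigenfunctions with zero Reeb eigenvalue *)

Definition lap (phi : C -> C) (z : C) : C := (1 / 2 * (pdx (pdx phi) z + pdy (pdy phi) z))%C.

Lemma DzDb_0 phi z : psmooth phi -> (Dz 0 (Db 0 phi) z + Db 0 (Dz 0 phi) z)%C = lap phi z.
Proof.
  intro H.
  assert (UD : forall f, Dz 0 f z = (1 / 2 * (pdx f z - Ci * pdy f z) - 0 * Cconj z * f z)%C)
    by reflexivity.
  assert (UB : forall f, Db 0 f z = (1 / 2 * (pdx f z + Ci * pdy f z) + 0 * z * f z)%C)
    by reflexivity.
  rewrite (UD (Db 0 phi)), (UB (Dz 0 phi)).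
  rewrite_pgrad (pgrad_Db 0 phi H).
  rewrite_pgrad (pgrad_Dz 0 phi H).
  unfold lap. cfield.
Qed.

Lemma lap_comb a b f g z : psmooth f -> psmooth g ->
  lap (fun z => a * f z + b * g z)%C z = (a * lap f z + b * lap g z)%C.
Proof.
  intros Hf Hg. assert (G := pgrad_comb a b f g Hf Hg). unfold lap.
  rewrite_pgrad G.
  rewrite (pgrad_pdx _ _ _ (pgrad_comb a b _ _ (psmooth_pdx _ Hf) (psmooth_pdx _ Hg))).
  rewrite (pgrad_pdy _ _ _ (pgrad_comb a b _ _ (psmooth_pdy _ Hf) (psmooth_pdy _ Hg))). ring.
Qed.

Definition latper_eigen (s : R) (phi : C -> C) : Prop :=
  psmooth phi /\ latper phi /\ forall z, lap phi z = (- (2 * s) * phi z)%C.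

Lemma plane_space_0 q a phi :
  plane_space 0 q a 1 phi <-> latper_eigen (q * a) phi /\ rotates 1 phi.
Proof.
  assert (T : forall w, translates 0 0 w phi <-> forall z, phi (z + w)%C = phi z).
  { intro w. unfold translates. split; intros H z; rewrite H;
      replace (0 - 2 * 0 * Im (w * Cconj z)) with 0 by ring; rewrite cis_0; ring. }
  unfold plane_space, latper_eigen, latper. rewrite !T. split.
  - intros [A [B [D [E F]]]]. split; [|exact E]. split; [exact A|]. split; [tauto|].
    intro z. rewrite <- DzDb_0, F, RtoC_mult by exact A. ring.
  - intros [[A [[B D] F]] E]. repeat (split; [assumption|]).
    intro z. rewrite DzDb_0, F, RtoC_mult by exact A. ring.
Qed.

Lemma latper_eigen_comb s a b f g : latper_eigen s f -> latper_eigen s g ->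
  latper_eigen s (fun z => a * f z + b * g z)%C.
Proof.
  intros [A [[B1 B2] D]] [A' [[B1' B2'] D']]. split; [now apply psmooth_comb|]. split.
  - split; intro z; congruence.
  - intro z. rewrite lap_comb, D, D' by assumption. ring.
Qed.

(** The dual lattice points contributing to the eigenvalue: a circle. *)
Definition on_shell (s : R) (p : Z * Z) : Prop := PI ^ 2 * Cmod (zeta p) ^ 2 = s.

Lemma latper_eigen_chi s p : on_shell s p -> latper_eigen s (chi p).
Proof.
  intro H. split; [apply psmooth_chi|]. split; [apply latper_chi|]. intro z.
  assert (G := pgrad_chi p). assert (Hs := psmooth_pgrad _ (psmooth_chi p)).
  unfold lap. rewrite_pgrad G.
  rewrite (pgrad_pdx _ _ _ (pgrad_scal (2 * PI * Ci * Re (zeta p)) _ _ _ G)).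
  rewrite (pgrad_pdy _ _ _ (pgrad_scal (2 * PI * Ci * Im (zeta p)) _ _ _ G)).
  unfold on_shell in H. rewrite Cmod2_alt in H. rewrite <- H.
  generalize (chi p z) (Re (zeta p)) (Im (zeta p)). intros k x y. cfield.
Qed.

Lemma fourier2_off_shell s phi p : latper_eigen s phi -> ~ on_shell s p -> fourier2 phi p = 0.
Proof.
  intros [A [B D]] Hp. destruct (latper_grad phi A B) as [Bx By].
  assert (Ax := psmooth_pdx _ A). assert (Ay := psmooth_pdy _ A).
  assert (E : fourier2 (lap phi) p = (- (2 * s) * fourier2 phi p)%C).
  { replace (lap phi) with (fun z => - (2 * s) * phi z + 0 * phi z)%C
      by (extensionality z; rewrite D; ring).
    rewrite fourier2_comb by exact A. ring. }
  replace (lap phi) with (fun z => 1 / 2 * pdx (pdx phi) z + 1 / 2 * pdy (pdy phi) z)%C in E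
    by (extensionality z; unfold lap; ring).
  rewrite fourier2_comb in E by (now apply psmooth_pdx || now apply psmooth_pdy).
  rewrite !fourier2_dx, !fourier2_dy in E by assumption.
  assert (F : (RtoC (2 * (s - PI ^ 2 * Cmod (zeta p) ^ 2)) * fourier2 phi p = 0)%C).
  { rewrite Cmod2_alt.
    match type of E with ?X = ?Y => transitivity (X - Y)%C; [|rewrite E; ring] end.
    generalize (fourier2 phi p) (Re (zeta p)) (Im (zeta p)). intros k x y. clear. cfield. }
  apply Cmult_integral in F. destruct F as [F|F]; [|exact F].
  exfalso. apply Hp. apply RtoC_inj in F. unfold on_shell. lra.
Qed.

(** ** Orbits of the rotation on the dual lattice *)

(** Multiplication by [eta] maps [zeta (m, l)] to [zeta (m - l, m)]. *)
Definition orbit (p : Z * Z) : list (Z * Z) :=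
  let (m, l) := p in
  ((m, l) :: (m - l, m) :: (- l, m - l) :: (- m, - l) :: (l - m, - m) :: (l, l - m) :: nil)%Z.

Definition unrot (p : Z * Z) : Z * Z := (snd p, (snd p - fst p)%Z).

(** A sector of 60 degrees, which is a fundamental domain for the rotation. *)
Definition in_sector (p : Z * Z) : bool := andb (0 <=? snd p)%Z (snd p <? fst p)%Z.

Lemma in_sector_iff m l : in_sector (m, l) = true <-> (0 <= l < m)%Z.
Proof. unfold in_sector. cbn [fst snd]. rewrite Bool.andb_true_iff, Z.leb_le, Z.ltb_lt. tauto. Qed.

Lemma on_shell_form s m l :
  on_shell s (m, l) <-> PI ^ 2 * (4 / 3 * IZR (m * m - m * l + l * l)) = s.
Proof.
  unfold on_shell, zeta. rewrite Cmod2_alt. cbn [fst snd]. unfold Re, Im. cbn [fst snd].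
  replace (IZR m ^ 2 + ((2 * IZR l - IZR m) / sqrt 3) ^ 2)
    with (4 / 3 * IZR (m * m - m * l + l * l)); [tauto|].
  rewrite plus_IZR, minus_IZR, !mult_IZR.
  replace (((2 * IZR l - IZR m) / sqrt 3) ^ 2) with ((2 * IZR l - IZR m) ^ 2 / (sqrt 3 * sqrt 3))
    by (field; generalize sqrt3_pos; lra).
  rewrite sqrt3_sq. field.
Qed.

Lemma on_shell_orbit s p q : In q (orbit p) -> on_shell s p <-> on_shell s q.
Proof.
  destruct p as [m l], q as [a b]. intro H. rewrite !on_shell_form.
  replace (a * a - a * b + b * b)%Z with (m * m - m * l + l * l)%Z; [tauto|].
  simpl in H. destruct H as [H|[H|[H|[H|[H|[H|[]]]]]]]; injection H as <- <-; ring.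
Qed.

Lemma sector_orbit_unique p q x : in_sector p = true -> in_sector q = true ->
  In x (orbit p) -> In x (orbit q) -> p = q.
Proof.
  destruct p as [m l], q as [m' l'], x as [a b]. rewrite !in_sector_iff. intros Hp Hq H H'.
  simpl in H, H'.
  assert (E : m = m' /\ l = l').
  { destruct H as [H|[H|[H|[H|[H|[H|[]]]]]]]; injection H as H1 H2;
      destruct H' as [H'|[H'|[H'|[H'|[H'|[H'|[]]]]]]]; injection H' as H1' H2'; lia. }
  destruct E as [-> ->]. reflexivity.
Qed.

Lemma orbit_NoDup p : in_sector p = true -> NoDup (orbit p).
Proof.
  destruct p as [m l]. rewrite in_sector_iff. intro H. simpl.
  repeat (constructor; [simpl; intro K;
    repeat (destruct K as [K|K]; [injection K as K1 K2; lia|]); exact K|]).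
  constructor.
Qed.

Lemma sector_orbit_exists x : x <> (0, 0)%Z -> exists p, in_sector p = true /\ In x (orbit p).
Proof.
  destruct x as [a b]. intro H.
  assert (Hn : a <> 0%Z \/ b <> 0%Z).
  { destruct (Z.eq_dec a 0) as [->|]; [|tauto]. destruct (Z.eq_dec b 0) as [->|]; tauto. }
  assert (D : (0 <= b < a \/ 0 <= b - a < b \/ 0 <= - a < b - a \/ 0 <= - b < - a
    \/ 0 <= a - b < - b \/ 0 <= a < a - b)%Z) by lia.
  assert (P : forall u v u' v' : Z, u = u' -> v = v' -> (u, v) = (u', v')) by (intros; congruence).
  destruct D as [D|[D|[D|[D|[D|D]]]]].
  - exists (a, b). rewrite in_sector_iff. split; [lia|]. simpl. tauto.
  - exists (b, b - a)%Z. rewrite in_sector_iff. split; [lia|]. simpl. right; left. apply P; lia.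
  - exists (b - a, - a)%Z. rewrite in_sector_iff. split; [lia|]. simpl. do 2 right; left. apply P; lia.
  - exists (- a, - b)%Z. rewrite in_sector_iff. split; [lia|]. simpl. do 3 right; left. apply P; lia.
  - exists (- b, a - b)%Z. rewrite in_sector_iff. split; [lia|]. simpl. do 4 right; left. apply P; lia.
  - exists (a - b, a)%Z. rewrite in_sector_iff. split; [lia|]. simpl. do 5 right; left. apply P; lia.
Qed.

Lemma orbit_head p : In p (orbit p).
Proof. destruct p. now left. Qed.

Lemma shell_list s : exists E : list (Z * Z), NoDup E /\ forall p, In p E <-> on_shell s p.
Proof.
  destruct (INR_archimed 1 (s / PI ^ 2)) as [B HB]; [lra|]. rewrite Rmult_1_r in HB.
  assert (PP := PI_RGT_0).
  (* Both coordinates of a point on the circle have square at most [s / PI ^ 2]. *)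
  set (range := map (fun k => (Z.of_nat k - Z.of_nat B)%Z) (seq 0 (2 * B + 1))).
  assert (HR : forall m : Z, IZR (m * m) <= s / PI ^ 2 -> In m range).
  { intros m Hm. assert (m * m < Z.of_nat B)%Z.
    { apply lt_IZR. rewrite <- INR_IZR_INZ. lra. }
    apply in_map_iff. exists (Z.to_nat (m + Z.of_nat B)). rewrite in_seq.
    assert (- Z.of_nat B <= m <= Z.of_nat B)%Z by nia. lia. }
  exists (filter (fun p => if Req_EM_T (PI ^ 2 * Cmod (zeta p) ^ 2) s then true else false)
    (nodup Zpair_dec (list_prod range range))).
  split; [apply NoDup_filter, NoDup_nodup|].
  intro p. rewrite filter_In, nodup_In.
  unfold on_shell at 1. destruct (Req_EM_T (PI ^ 2 * Cmod (zeta p) ^ 2) s) as [E|E].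
  2: { split; [intros [_ F]; discriminate | tauto]. }
  split; [tauto|]. intros _. split; [|reflexivity].
  destruct p as [m l]. apply in_prod_iff.
  assert (F : on_shell s (m, l)) by exact E. rewrite on_shell_form in F.
  assert (G : s / PI ^ 2 = 4 / 3 * IZR (m * m - m * l + l * l)) by (rewrite <- F; field; lra).
  rewrite plus_IZR, minus_IZR, !mult_IZR in G.
  split; apply HR; rewrite mult_IZR, G.
  - generalize (Rle_0_sqr (IZR m - 2 * IZR l)). unfold Rsqr. lra.
  - generalize (Rle_0_sqr (2 * IZR m - IZR l)). unfold Rsqr. lra.
Qed.

Lemma NoDup_flat_map {A B : Type} (f : A -> list B) (l : list A) : NoDup l ->
  (forall a, In a l -> NoDup (f a)) ->
  (forall a b x, In a l -> In b l -> In x (f a) -> In x (f b) -> a = b) -> NoDup (flat_map f l).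
Proof.
  intro ND. induction ND as [|a l Ha ND IH]; intros Hf Hd; [constructor|]. simpl.
  apply NoDup_app.
  - apply Hf. now left.
  - apply IH; [intros; apply Hf; now right|]. intros b d x Hb Hd'. apply Hd; now right.
  - intros x Hx Hx'. apply in_flat_map in Hx'. destruct Hx' as [b [Hb Hxb]].
    apply Ha. rewrite (Hd a b x); auto; [now left | now right].
Qed.

Lemma length_flat_map_orbit D : length (flat_map orbit D) = (6 * length D)%nat.
Proof.
  induction D as [|[m l] D IH]; [reflexivity|]. simpl flat_map. simpl length.
  rewrite IH. lia.
Qed.

Lemma lsum_flat_map {A B : Type} (f : A -> list B) (l : list A) F :
  lsum (flat_map f l) F = lsum l (fun a => lsum (f a) F).
Proof.
  induction l as [|a l IH]; [reflexivity|]. simpl flat_map. now rewrite lsum_app, lsum_cons, IH.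
Qed.

Lemma shell_orbits s E : 0 < s -> NoDup E -> (forall p, In p E <-> on_shell s p) ->
  Permutation E (flat_map orbit (filter in_sector E)).
Proof.
  intros Hs ND HE. apply NoDup_Permutation; [exact ND | |].
  - apply NoDup_flat_map.
    + now apply NoDup_filter.
    + intros p Hp. apply filter_In in Hp. now apply orbit_NoDup.
    + intros p q x Hp Hq. apply filter_In in Hp. apply filter_In in Hq. now apply sector_orbit_unique.
  - intro x. rewrite in_flat_map. split.
    + intro Hx. destruct (sector_orbit_exists x) as [p [Hp Hxp]].
      * intros ->. apply HE in Hx. rewrite on_shell_form in Hx. simpl in Hx. lra.
      * exists p. split; [|exact Hxp]. apply filter_In. split; [|exact Hp].
        apply HE. apply HE in Hx. now apply (on_shell_orbit s p x).
    + intros [p [Hp Hxp]]. apply filter_In in Hp. destruct Hp as [Hp _]. apply HE.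
      apply HE in Hp. now apply (on_shell_orbit s p x).
Qed.

Lemma chi_unrot p z : chi p (eta * z)%C = chi (unrot p) z.
Proof.
  unfold chi. f_equal. destruct p as [m l]. unfold zeta, unrot. cbn [fst snd].
  rewrite eta_val, minus_IZR. generalize sqrt3_pos sqrt3_sq. intros S SS.
  apply C_eq; unfold Re, Im; simpl; field [SS]; lra.
Qed.

Lemma orbit_unrot p : Permutation (map unrot (orbit p)) (orbit p).
Proof.
  destruct p as [m l]. unfold orbit, unrot. cbn [map fst snd].
  replace (m - (m - l))%Z with l by ring. replace (m - l - - l)%Z with m by ring.
  replace (- l - - m)%Z with (m - l)%Z by ring. replace (- m - (l - m))%Z with (- l)%Z by ring.
  replace (l - m - l)%Z with (- m)%Z by ring.
  apply (Permutation_cons_append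
    ((m, l) :: (m - l, m) :: (- l, m - l) :: (- m, - l) :: (l - m, - m) :: nil)%Z).
Qed.

Lemma latper_eigen_lsum s (l : list (Z * Z)) (c : Z * Z -> C) :
  (forall q, In q l -> on_shell s q) -> latper_eigen s (fun z => lsum l (fun q => c q * chi q z)%C).
Proof.
  induction l as [|q l IH]; intro H.
  - split; [exact (psmooth_const 0)|]. split; [split; reflexivity|].
    intro z. unfold lsum, lap. simpl.
    rewrite_pgrad (pgrad_const 0).
    rewrite_pgrad (pgrad_const 0). ring.
  - replace (fun z => lsum (q :: l) (fun q => c q * chi q z)%C)
      with (fun z => c q * chi q z + 1 * lsum l (fun q => c q * chi q z))%C
      by (extensionality z; rewrite lsum_cons; ring).
    apply latper_eigen_comb.
    + apply latper_eigen_chi, H. now left.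
    + apply IH. intros; apply H; now right.
Qed.

Lemma latper_eigen_expansion s E f : NoDup E -> (forall p, In p E <-> on_shell s p) ->
  latper_eigen s f -> forall z, f z = lsum E (fun p => fourier2 f p * chi p z)%C.
Proof.
  intros ND HE Hf z.
  assert (Hg : latper_eigen s (fun z => lsum E (fun p => fourier2 f p * chi p z)%C)).
  { apply latper_eigen_lsum. intros q Hq. now apply HE. }
  assert (Hd : latper_eigen s (fun z => 1 * f z + - (1) * lsum E (fun p => fourier2 f p * chi p z))%C)
    by (now apply latper_eigen_comb).
  apply Ceq_minus.
  transitivity (1 * f z + - (1) * lsum E (fun p => fourier2 f p * chi p z))%C; [ring|].
  apply (fourier2_unique _ (proj1 Hd) (proj1 (proj2 Hd))). intro p.
  destruct (classic (on_shell s p)) as [Hp|Hp].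
  - rewrite fourier2_comb by (apply Hf || apply Hg).
    rewrite (fourier2_lsum E (fourier2 f) chi p psmooth_chi).
    rewrite (lsum_single _ _ p ND).
    + rewrite fourier2_chi. destruct (Zpair_dec p p); [ring|tauto].
    + now apply HE.
    + intros q _ Hq. rewrite fourier2_chi. destruct (Zpair_dec q p); [tauto|ring].
  - now apply (fourier2_off_shell s).
Qed.

(** Compare the expansions of [f] and of its rotate. *)
Lemma fourier2_unrot s E f p : NoDup E -> (forall p, In p E <-> on_shell s p) ->
  latper_eigen s f -> rotates 1 f -> on_shell s p -> fourier2 f (unrot p) = fourier2 f p.
Proof.
  intros ND HE Hf Hr Hp.
  assert (X := latper_eigen_expansion s E f ND HE Hf).
  assert (Y : f = fun z => lsum E (fun q => fourier2 f q * chi (unrot q) z)%C).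
  { extensionality z. transitivity (f (eta * z)%C); [rewrite Hr; ring|].
    rewrite X. apply lsum_ext. intros q _. now rewrite chi_unrot. }
  rewrite Y at 1.
  rewrite (fourier2_lsum E (fourier2 f) (fun q => chi (unrot q)))
    by (intro; apply psmooth_chi).
  rewrite (lsum_single _ _ p ND).
  - rewrite fourier2_chi. destruct (Zpair_dec (unrot p) (unrot p)); [ring|tauto].
  - now apply HE.
  - intros q _ Hq. rewrite fourier2_chi. destruct (Zpair_dec (unrot q) (unrot p)) as [e|]; [|ring].
    exfalso. apply Hq. destruct q as [a b], p as [m l]. unfold unrot in e. cbn [fst snd] in e.
    injection e as E1 E2. f_equal; lia.
Qed.

Lemma has_dim_shell s E : 0 < s -> NoDup E -> (forall p, In p E <-> on_shell s p) ->
  has_dim (fun f => latper_eigen s f /\ rotates 1 f) (length (filter in_sector E)).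
Proof.
  intros Hs ND HE. set (D := filter in_sector E).
  assert (HD : forall p, In p D <-> on_shell s p /\ in_sector p = true).
  { intro p. unfold D. now rewrite filter_In, HE. }
  assert (NDD : NoDup D) by now apply NoDup_filter.
  set (u := fun p z => lsum (orbit p) (fun q => 1 * chi q z)%C).
  assert (Hu : forall p, psmooth (u p)).
  { intro p. apply (psmooth_lsum (orbit p) (fun q z => 1 * chi q z)%C).
    intros; apply psmooth_scal, psmooth_chi. }
  apply (has_dim_list Zpair_dec D u).
  - exact NDD.
  - intros p Hp. apply HD in Hp. destruct Hp as [Hp _]. split.
    + apply latper_eigen_lsum. intros q Hq. now apply (on_shell_orbit s p q).
    + intro z. unfold u. rewrite Cmult_1_l.
      transitivity (lsum (map unrot (orbit p)) (fun q => 1 * chi q z)%C).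
      * rewrite lsum_map. apply lsum_ext. intros q _. now rewrite chi_unrot.
      * apply lsum_perm, orbit_unrot.
  - intros c Hc p0 Hp0.
    assert (F : fourier2 (fun z => lsum D (fun i => c i * u i z)%C) p0 = 0).
    { replace (fun z => lsum D (fun i => c i * u i z)%C)
        with (fun z : C => lsum (@nil nat) (fun _ => 0 * 0)%C)
        by (extensionality z; now rewrite Hc).
      rewrite (fourier2_lsum nil (fun _ => RtoC 0) (fun _ _ => RtoC 0)); [reflexivity|].
      intro; apply psmooth_const. }
    rewrite (fourier2_lsum D c u p0 Hu), (lsum_single _ _ p0 NDD Hp0) in F.
    + rewrite <- F. unfold u.
      rewrite (fourier2_lsum (orbit p0) (fun _ => RtoC 1) chi p0 psmooth_chi).
      apply HD in Hp0. rewrite (lsum_single _ _ p0 (orbit_NoDup p0 (proj2 Hp0)) (orbit_head p0)).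
      * rewrite fourier2_chi. destruct (Zpair_dec p0 p0); [ring|tauto].
      * intros q _ Hq. rewrite fourier2_chi. destruct (Zpair_dec q p0); [tauto|ring].
    + intros p Hp Hne. unfold u.
      rewrite (fourier2_lsum (orbit p) (fun _ => RtoC 1) chi p0 psmooth_chi).
      rewrite (lsum_0 (orbit p)); [ring|].
      intros q Hq. rewrite fourier2_chi. destruct (Zpair_dec q p0) as [->|]; [|ring].
      exfalso. apply Hne. apply HD in Hp. apply HD in Hp0.
      apply (sector_orbit_unique p p0 p0); try tauto. apply orbit_head.
  - intros f [Hf Hr]. exists (fourier2 f). intro z.
    rewrite (latper_eigen_expansion s E f ND HE Hf z).
    rewrite (lsum_perm _ _ _ (shell_orbits s E Hs ND HE)), lsum_flat_map.
    apply lsum_ext. intros p Hp. apply HD in Hp. destruct Hp as [Hp _].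
    unfold u. rewrite <- lsum_scal. apply lsum_ext. intros q Hq.
    replace (fourier2 f q) with (fourier2 f p); [ring|].
    assert (K : forall a b, In a (orbit p) -> unrot a = b -> fourier2 f b = fourier2 f a).
    { intros a b Ha <-. apply (fourier2_unrot s E); auto. now apply (on_shell_orbit s p a). }
    destruct p as [m l]. simpl in K.
    assert (P : forall x y x' y' : Z, x = x' -> y = y' -> (x, y) = (x', y')) by (intros; congruence).
    assert (K1 : fourier2 f (m, l) = fourier2 f (m - l, m)%Z).
    { apply K; [tauto|]. unfold unrot; simpl. apply P; lia. }
    assert (K2 : fourier2 f (m - l, m)%Z = fourier2 f (- l, m - l)%Z).
    { apply K; [tauto|]. unfold unrot; simpl. apply P; lia. }
    assert (K3 : fourier2 f (- l, m - l)%Z = fourier2 f (- m, - l)%Z).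
    { apply K; [tauto|]. unfold unrot; simpl. apply P; lia. }
    assert (K4 : fourier2 f (- m, - l)%Z = fourier2 f (l - m, - m)%Z).
    { apply K; [tauto|]. unfold unrot; simpl. apply P; lia. }
    assert (K5 : fourier2 f (l - m, - m)%Z = fourier2 f (l, l - m)%Z).
    { apply K; [tauto|]. unfold unrot; simpl. apply P; lia. }
    simpl in Hq. destruct Hq as [<-|[<-|[<-|[<-|[<-|[<-|[]]]]]]]; congruence.
Qed.

(** ** The dual lattice *)

Lemma dual_lattice_iff w : dual_lattice (lattice eta) w <-> exists p, w = zeta p.
Proof.
  assert (S := sqrt3_pos). split.
  - intro H.
    destruct (H 1) as [m Hm]. { exists 1%Z, 0%Z. ring. }
    destruct (H eta) as [l Hl]. { exists 0%Z, 1%Z. ring. }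
    exists (m, l). rewrite eta_val in Hl. unfold zeta. cbn [fst snd].
    destruct w as [x y]. unfold Re in Hm, Hl. simpl in Hm, Hl.
    assert (Ex : x = IZR m) by lra. apply C_eq; unfold Re, Im; cbn [fst snd]; [exact Ex|].
    rewrite <- Hl, <- Ex. field. lra.
  - intros [[m l] ->] z [a [b ->]]. exists (a * m + b * l)%Z.
    rewrite plus_IZR, !mult_IZR, eta_val. unfold zeta. unfold Re. simpl. field. lra.
Qed.

Lemma zeta_inj p q : zeta p = zeta q -> p = q.
Proof.
  destruct p as [m l], q as [m' l']. unfold zeta. cbn [fst snd]. intro E. injection E as E1 E2.
  assert (S := sqrt3_pos).
  assert (m = m') by now apply eq_IZR. subst m'.
  apply Rmult_eq_reg_r in E2; [|apply Rinv_neq_0_compat; lra].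
  f_equal. apply eq_IZR. lra.
Qed.

Lemma multiplicity_zero_Reeb (c r kappa : R) : 0 < r -> 0 < kappa ->
  exists m e : nat,
    joint_multiplicity (Gamma' c) r kappa 0 m /\
    has_card (fun zeta : C => dual_lattice (lattice eta) zeta /\
                PI ^ 2 * Cmod zeta ^ 2 / r = kappa) e /\
    INR m = INR e / 6.
Proof.
  intros Hr Hk. assert (Hs : 0 < r * kappa) by now apply Rmult_lt_0_compat.
  destruct (shell_list (r * kappa)) as [E [ND HE]].
  exists (length (filter in_sector E)), (length E). split; [|split].
  - apply has_dim_joint; [exact Hr | |].
    + rewrite Rmult_0_r, Rmult_0_l. apply cis_0.
    + replace (cis (- (r * 0 * (5 * c / 6)))) with (RtoC 1)
        by (rewrite Rmult_0_r, Rmult_0_l, Ropp_0, cis_0; reflexivity).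
      rewrite Rmult_0_r.
      apply (has_dim_iff _ (fun f => latper_eigen (r * kappa) f /\ rotates 1 f)).
      * intro f. apply plane_space_0.
      * now apply has_dim_shell.
  - exists (map zeta E). split; [|split].
    + apply FinFun.Injective_map_NoDup; [|exact ND]. intros p q. apply zeta_inj.
    + intro w. rewrite in_map_iff, dual_lattice_iff.
      assert (K : forall p, PI ^ 2 * Cmod (zeta p) ^ 2 / r = kappa <-> on_shell (r * kappa) p).
      { intro p. unfold on_shell. split; intro H.
        - rewrite <- H. field. lra.
        - rewrite H. field. lra. }
      split.
      * intros [p [<- Hp]]. split; [now exists p|]. now apply K, HE.
      * intros [[p ->] Hw]. exists p. split; [reflexivity|]. now apply HE, K.
    + apply length_map.
  - rewrite (Permutation_length (shell_orbits _ E Hs ND HE)), length_flat_map_orbit, mult_INR.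
    simpl INR. field.
Qed.

Theorem theorem8p3 :
  forall (N : nat) (c r : R),
    (0 < N)%nat -> Nat.Even N ->
    c = 4 * Im eta / INR N ->
    0 < r ->
    Heisenberg_Bieberbach (Gamma' c) ->
    (forall (n : Z) (k : nat), n <> 0%Z ->
       exists m : nat,
         joint_multiplicity (Gamma' c) r
           ((4 * INR k + 2) * PI * Rabs (IZR n) / (c * r))
           (2 * PI * IZR n / (c * r)) m /\
         INR m =
           1 / 6 *
           (Rabs (IZR n) * INR N
            + 2 * powerRZ (-1) (n + Z.of_nat k)
            + 2 * cos (PI * (Rabs (IZR n) + INR k - 1) / 3)
            + 2 / sqrt 3 * cos (2 * PI * (Rabs (IZR n) + INR k) / 3 - PI / 6)
            + 4 / sqrt 3 *
              cos (2 * PI * (Rabs (IZR n) + INR k - Rabs (IZR n) * INR N) / 3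
                   - PI / 6))) /\
    (forall kappa : R, 0 < kappa ->
       exists m e : nat,
         joint_multiplicity (Gamma' c) r kappa 0 m /\
         has_card (fun zeta : C => dual_lattice (lattice eta) zeta /\
                     PI ^ 2 * Cmod zeta ^ 2 / r = kappa) e /\
         INR m = INR e / 6).
Proof.
  intros N c r HN He Hc Hr _. split.
  - intros n k Hn. exists (mult_count (Z.abs_nat n * N) (Z.abs_nat n + k)). split.
    + now apply multiplicity_nonzero.
    + now apply multiplicity_value.
  - intros kappa Hk. now apply multiplicity_zero_Reeb.
Qed.
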